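(* Let $\mu\in\mathcal{M}_{\mathbb{T}}^{\times}$ and let $\nu\in\mathcal{M}_{\mathbb{T}}^{\times}$ be a $\boxtimes$-infinitely divisible measure. The following are equivalent: (1) The pair $(\mu,\nu)$ is $\boxtimes$-infinitely divisible. (2) There exist $\gamma\in\mathbb{T}$ and a finite positive Borel measure $\sigma$ on $\mathbb{T}$ such that \[ \Sigma_{(\mu,\nu)}(z)=\gamma\exp\left(-\int_{\mathbb{T}}\frac{1+\zeta z}{1-\zeta z}\,d\sigma(\zeta)\right) \] in a neighborhood of zero. (3) There exists a weakly continuous semigroup $\{(\mu_t,\nu_t)\}_{t\ge0}$ relative to $\boxtimes$ such that $(\mu_1,\nu_1)=(\mu,\nu)$ and $(\mu_0,\nu_0)=(\delta_1,\delta_1)$. Moreover, if (1)–(3) are satisfied, then (with $\gamma,\sigma$ as in (2) and $\{(\mu_t,\nu_t)\}_{t\geq 0}$ as in (3)) the limit \[ \gamma=\lim_{t\to0^+}\exp\left(\frac1t\int_{\mathbb{T}}i\,\Im\zeta\,d\mu_t(\zeta)\right) \] exists, and $\sigma$ is the weak limit of the measures $\frac1t(1-\Re\zeta)\,d\mu_t(\zeta)$ as $t\to0^+$.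
   Context: $\mathbb{T}$ is the unit circle, $\mathbb{D}$ the open unit disk, $\mathcal{M}_{\mathbb{T}}$ the set of Borel probability measures on $\mathbb{T}$, $\mathcal{M}_{\mathbb{T}}^{\times}=\{\nu\in\mathcal{M}_{\mathbb{T}}:\int_{\mathbb{T}}\zeta\,d\nu(\zeta)\ne0\}$, and $\delta_\lambda$ is the point mass at $\lambda$. Weak convergence is convergence of integrals of continuous functions. For $\mu\in\mathcal{M}_{\mathbb{T}}$ and $z\in\mathbb{D}$: $m_\mu(z)=\int_{\mathbb{T}}\frac{z\zeta}{1-z\zeta}d\mu(\zeta)$, $\eta_\mu(z)=\frac{m_\mu(z)}{1+m_\mu(z)}$, $B_\mu(z)=\frac1z\eta_\mu(z)$. $F^{\langle-1\rangle}$ denotes the inverse under composition near $0$. For $\mu\in\mathcal{M}_{\mathbb{T}}$, $\nu\in\mathcal{M}_{\mathbb{T}}^\times$, define analytic functions near $0$ by $R_\nu(z[1+m_\nu(z)])=m_\nu(z)$, ${}^cR_{(\mu,\nu)}(z[1+m_\nu(z)])(1+m_\mu(z))=m_\mu(z)(1+m_\nu(z))$, $T_\nu(z)=\left(\frac1zR_\nu\right)\circ R_\nu^{\langle-1\rangle}(z)$, ${}^cT_{(\mu,\nu)}(z)=\left(\frac1z{}^cR_{(\mu,\nu)}\right)\circ R_\nu^{\langle-1\rangle}(z)$, and $\Sigma_{(\mu,\nu)}(z)={}^cT_{(\mu,\nu)}\left(\frac z{1-z}\right)$, which equals $B_\mu(\eta_\nu^{\langle-1\rangle}(z))$ near $0$.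 Here $\left(\frac1zF\right)\circ G$ is $F(z)/z$ composed with $G$. The multiplicative c-free convolution $(\mu_1,\nu_1)\boxtimes(\mu_2,\nu_2)$ of pairs in $\mathcal{M}_{\mathbb{T}}\times\mathcal{M}_{\mathbb{T}}^\times$ is the unique pair $(\mu,\nu)\in\mathcal{M}_{\mathbb{T}}\times\mathcal{M}_{\mathbb{T}}^\times$ with $T_\nu=T_{\nu_1}T_{\nu_2}$ and ${}^cT_{(\mu,\nu)}={}^cT_{(\mu_1,\nu_1)}{}^cT_{(\mu_2,\nu_2)}$; the second component is the free multiplicative convolution $\nu=\nu_1\boxtimes\nu_2$. (For second components of zero mean, $\boxtimes$ is defined as the distribution of the product of two c-free variables; a convolution whose second component has nonzero mean only involves factors whose second components have nonzero mean.) A measure $\nu\in\mathcal{M}_{\mathbb{T}}$ (respectively a pair $(\mu,\nu)\in\mathcal{M}_{\mathbb{T}}\times\mathcal{M}_{\mathbb{T}}$) is $\boxtimes$-infinitely divisible if for every $n\in\mathbb{N}$ it is the $n$-fold $\boxtimes$-convolution of some $\nu_n\in\mathcal{M}_{\mathbb{T}}$ (respectively $(\mu_n,\nu_n)\in\mathcal{M}_{\mathbb{T}}\times\mathcal{M}_{\mathbb{T}}$) with itself. A measure $\nu\in\mathcal{M}_{\mathbb{T}}^\times$ is $\boxtimes$-infinitely divisible if and only if $\eta_\nu^{\langle-1\rangle}(z)=z\gamma'\exp\left(\int_{\mathbb{T}}\frac{1+\zeta z}{1-\zeta z}d\sigma'(\zeta)\right)$ near $0$ for some $\gamma'\in\mathbb{T}$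 and finite positive Borel measure $\sigma'$ on $\mathbb{T}$. A family $\{(\mu_t,\nu_t)\}_{t\ge0}$ of pairs of probability measures on $\mathbb{T}$ is a weakly continuous semigroup relative to $\boxtimes$ if $(\mu_t,\nu_t)\boxtimes(\mu_s,\nu_s)=(\mu_{t+s},\nu_{t+s})$ for all $t,s\ge0$ and the maps $t\mapsto\mu_t$, $t\mapsto\nu_t$ are continuous for the weak topology. *)

(* Defs.v *)
From HB Require Import structures.
From mathcomp Require Import all_boot all_order all_algebra.
From mathcomp Require Import all_classical all_reals all_analysis.
From mathcomp Require Export complex.

Set Implicit Arguments.
Unset Strict Implicit.
Unset Printing Implicit Defensive.

Import Order.TTheory GRing.Theory Num.Theory.
Import numFieldNormedType.Exports.

Local Open Scope classical_set_scope.
Local Open Scope ring_scope.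
Local Open Scope complex_scope.

(* R[i] with the topology given by its modulus, as a normed space over itself,
   so that [derivable F z 1] below is complex differentiability at z. *)
HB.instance Definition _ (R : realType) := NormedModule.copy R[i] R[i]^o.

Section complex_functions.
Variable R : realType.
Local Notation C := R[i].
Implicit Types F G : C -> C.

Definition cexp (z : C) : C :=
  (expR (complex.Re z))%:C * (cos (complex.Im z) +i* sin (complex.Im z)).

Definition analytic0 F : Prop := \forall z \near (0 : C), derivable F z 1.

(* The analytic functions below are determined near 0 only: definitions by
   [xget] pick a representative of the germ (and the zero function if the
   germ does not exist), and identities are asserted near 0. *)
Definition inv0 F : C -> C := xget (fun=> 0) [set G | [/\ analytic0 G, G 0 = 0,
  \forall z \near (0 : C), F (G z) = z & \forall z \near (0 : C), G (F z) = z]].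

(* F(z)/z, with the removable singularity at 0 filled in (when F(0) = 0) *)
Definition div_id F (z : C) : C := if z == 0 then derive1 F 0 else F z / z.

End complex_functions.

Definition circle (R : realType) : Type := set_type [set z : R[i] | `|z| = 1].

Section circle.
Variable R : realType.

Definition circle_val (x : circle R) : R[i] := set_val x.

Definition circle1 : circle R := exist _ (1 : R[i]) (mem_set (normr1 R[i])).

HB.instance Definition _ := Topological.copy (circle R)
  (set_type [set z : R[i] | `|z| = 1]).
HB.instance Definition _ := isPointed.Build (circle R) circle1.

End circle.
Coercion circle_val : circle >-> complex.

(* the unit circle with its Borel sigma-algebra *)
Definition borel_circle (R : realType) := g_sigma_algebraType (@open (circle R)).

Notation prob_circle R := (probability (borel_circle R) R).

Section transforms.
Variable R : realType.
Local Notation C := R[i].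
Implicit Types (m : {measure set (borel_circle R) -> \bar R}).
Implicit Types (mu nu : prob_circle R).

Definition cintegral m (f : circle R -> C) : C :=
  (\int[m]_x complex.Re (f x)) +i* (\int[m]_x complex.Im (f x)).

(* Measures are functions on all sets: only Borel sets matter. *)
Definition eq_measure m1 m2 : Prop :=
  forall A : set (borel_circle R), measurable A -> m1 A = m2 A.

Definition nonzero_mean mu : Prop :=
  cintegral mu (fun x => (x : C)) != 0.

Definition moment_fun mu (z : C) : C :=
  cintegral mu (fun x => z * x / (1 - z * x)).

Definition R_transform nu : C -> C := xget (fun=> 0) [set F | analytic0 F /\
  \forall z \near (0 : C),
    F (z * (1 + moment_fun nu z)) = moment_fun nu z].

Definition cR_transform mu nu : C -> C := xget (fun=> 0) [set F | analytic0 F /\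
  \forall z \near (0 : C),
    F (z * (1 + moment_fun nu z)) * (1 + moment_fun mu z) =
    moment_fun mu z * (1 + moment_fun nu z)].

Definition T_transform nu : C -> C :=
  div_id (R_transform nu) \o inv0 (R_transform nu).

Definition cT_transform mu nu : C -> C :=
  div_id (cR_transform mu nu) \o inv0 (R_transform nu).

Definition Sigma_transform mu nu (z : C) : C :=
  cT_transform mu nu (z / (1 - z)).

End transforms.

Section freeness.
Variables (R : realType) (A : algType R[i]) (star : A -> A).
Local Notation C := R[i].
Implicit Types (phi psi : {scalar A}) (B : bool -> A -> Prop) (u v : A).

Definition star_algebra : Prop :=
  [/\ involutive star, {morph star : x y / x + y},
      forall (c : C) x, star (c *: x) = (conjc c) *: star x
    & forall x y, star (x * y) = star y * star x].

Definition state phi : Prop := phi 1 = 1 /\ forall x, 0 <= phi (star x * x).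

Definition unitary u : Prop := star u * u = 1 /\ u * star u = 1.

Inductive star_generated u : A -> Prop :=
| sg_gen : star_generated u u
| sg_one : star_generated u 1
| sg_add x y : star_generated u x -> star_generated u y ->
    star_generated u (x + y)
| sg_scale (c : C) x : star_generated u x -> star_generated u (c *: x)
| sg_mul x y : star_generated u x -> star_generated u y ->
    star_generated u (x * y)
| sg_star x : star_generated u x -> star_generated u (star x).

(* a_1, ..., a_k with a_j in B i_j, psi(a_j) = 0 and i_j <> i_(j+1) *)
Definition alternating_centered psi B (s : seq (bool * A)) : Prop :=
  sorted (fun x y => x.1 != y.1) s /\
  {in s, forall x, B x.1 x.2 /\ psi x.2 = 0}.

Definition free_family psi B : Prop := forall s, s != [::] ->
  alternating_centered psi B s -> psi (\prod_(x <- s) x.2) = 0.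

Definition cfree_family phi psi B : Prop := free_family psi B /\
  forall s, alternating_centered psi B s ->
    phi (\prod_(x <- s) x.2) = \prod_(x <- s) phi x.2.

Definition pair_generated u v (b : bool) : A -> Prop :=
  star_generated (if b then u else v).

(* For a unitary u and a state phi, these moments determine the distribution
   of u, the others being their complex conjugates. *)
Definition has_distribution phi u (mu : prob_circle R) : Prop :=
  forall n : nat, phi (u ^+ n) = cintegral mu (fun x => (x : C) ^+ n).

End freeness.

Section convolution.
Variable R : realType.
Local Notation C := R[i].
Local Notation M := (prob_circle R).

Definition free_product_distribution (nu1 nu2 nu : M) : Prop :=
  exists (A : algType C) (star : A -> A) (psi : {scalar A}) (u v : A),
    [/\ star_algebra star, state star psi, unitary star u & unitary star v] /\
    [/\ free_family psi (pair_generated star u v),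
        has_distribution psi u nu1, has_distribution psi v nu2
      & has_distribution psi (u * v) nu].

Definition cfree_product_distribution (p1 p2 p : M * M) : Prop :=
  exists (A : algType C) (star : A -> A) (phi psi : {scalar A}) (u v : A),
    [/\ star_algebra star, state star phi /\ state star psi,
        unitary star u & unitary star v] /\
    [/\ cfree_family phi psi (pair_generated star u v),
        has_distribution phi u p1.1 /\ has_distribution psi u p1.2,
        has_distribution phi v p2.1 /\ has_distribution psi v p2.2
      & has_distribution phi (u * v) p.1 /\ has_distribution psi (u * v) p.2].

(* [free_conv nu1 nu2 nu] : nu is the free multiplicative convolution of nu1
   and nu2; the T-transforms are available for nonzero means only. *)
Definition free_conv (nu1 nu2 nu : M) : Prop :=
  [/\ nonzero_mean nu1, nonzero_mean nu2, nonzero_mean nu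
    & \forall z \near (0 : C),
        T_transform nu z = T_transform nu1 z * T_transform nu2 z]
  \/ ~ (nonzero_mean nu1 /\ nonzero_mean nu2) /\
     free_product_distribution nu1 nu2 nu.

Definition cfree_conv (p1 p2 p : M * M) : Prop :=
  [/\ nonzero_mean p1.2, nonzero_mean p2.2, nonzero_mean p.2
    & \forall z \near (0 : C),
        T_transform p.2 z = T_transform p1.2 z * T_transform p2.2 z /\
        cT_transform p.1 p.2 z =
          cT_transform p1.1 p1.2 z * cT_transform p2.1 p2.2 z]
  \/ ~ (nonzero_mean p1.2 /\ nonzero_mean p2.2) /\
     cfree_product_distribution p1 p2 p.

(* y is the (n+1)-fold convolution of x with itself *)
Fixpoint conv_power X (eqX : X -> X -> Prop) (conv : X -> X -> X -> Prop)
    (n : nat) (x y : X) : Prop :=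
  if n is n'.+1 then exists2 w, conv_power eqX conv n' x w & conv w x y
  else eqX x y.

Definition eq_pair (p q : M * M) : Prop :=
  eq_measure p.1 q.1 /\ eq_measure p.2 q.2.

Definition free_infdiv (nu : M) : Prop :=
  forall n, exists nu_n : M,
    conv_power (fun a b : M => eq_measure a b) free_conv n nu_n nu.

Definition cfree_infdiv (p : M * M) : Prop :=
  forall n, exists p_n : M * M, conv_power eq_pair cfree_conv n p_n p.

Definition weakly_continuous (mu : R -> M) : Prop :=
  forall f : circle R -> R, continuous f ->
    {within `[0, +oo[, continuous (fun t => \int[mu t]_x f x)}.

(* only the values at t >= 0 are relevant *)
Definition cfree_semigroup (p : R -> M * M) : Prop :=
  [/\ forall t s, 0 <= t -> 0 <= s -> cfree_conv (p t) (p s) (p (t + s)),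
      weakly_continuous (fun t => (p t).1)
    & weakly_continuous (fun t => (p t).2)].

Definition cfree_semigroup_through (p : R -> M * M) (mu nu : M) : Prop :=
  [/\ cfree_semigroup p, eq_pair (p 1) (mu, nu)
    & eq_measure (p 0).1 \d_(circle1 R : borel_circle R) /\
      eq_measure (p 0).2 \d_(circle1 R : borel_circle R)].

Definition Sigma_representation (mu nu : M) (g : circle R)
    (sigma : {finite_measure set (borel_circle R) -> \bar R}) : Prop :=
  \forall z \near (0 : C), Sigma_transform mu nu z =
    (g : C) * cexp (- cintegral sigma (fun x : circle R =>
                         (1 + (x : C) * z) / (1 - (x : C) * z))).

End convolution.

(* Main.v *)
(** Call a function analytic if it has Taylor expansions of every order at every
    point.  A second-order test shows that |F|^2 has no strict local maximum, which
    gives the maximum principle, Schwarz' lemma, the identity theorem and local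
    inverses, and from them, with ultralimits of positive functionals on C(T), the
    Herglotz theorem; Riesz' theorem turns functionals into measures.

    If m_nu is inverted by psi(w) = w / ((1 + w) T(w)), then cT(w) = B_mu(psi(w)).
    (1) => (2): for the n-th roots (mu_n, nu_n) of (mu, nu), the functions
    n (1 - B_(mu_n)) have nonnegative real part, and on a common disk they take at
    the points w / ((1 + w) T(w)^(1/n)) the values n (1 - cT(w)^(1/n)); hence the
    Herglotz measures accumulate at some sigma with
    - log cT(w) = - i b + H_sigma(w / (1 + w)).
    (2) => (1) and (2) => (3): B = exp(t (i b - H_sigma(eta_nu))) is a Schur function,
    hence B = B_mu for some mu; nu_t itself solves eta = u exp(t L(eta)), which is done
    by iteration.  (3) => (1) is clear.
    For the limits, the means of a semigroup are multiplicative in t, which fixes the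
    branches of the logarithms, so (T, cT) = (exp(t tau), exp(t kappa)) at time t, and
    for |x| < 1
      - (i/t) int Im z dmu_t + (1/t) int (1 - Re z) (1 + z x) / (1 - z x) dmu_t
        = (1 - x) (1 + m_(mu_t)(x)) (1 - B_(mu_t)(x)) / t,
    whose right-hand side tends to - kappa(w) at points x tending to w / (1 + w). *)

Require Import Defs.
From mathcomp Require Import all_boot all_order all_algebra.
From mathcomp Require Import all_classical all_reals all_analysis.
From mathcomp Require Import ring lra measurable_realfun.

Import Order.TTheory GRing.Theory Num.Theory.
Import numFieldNormedType.Exports.
Import ComplexField.Normc.

Set Implicit Arguments.
Unset Strict Implicit.
Unset Printing Implicit Defensive.

Local Open Scope classical_set_scope.
Local Open Scope ring_scope.
Local Open Scope complex_scope.

(** Transform identities hold for germs only, on neighbourhoods of 0 that may shrink with the root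
    index n or the time t, whereas limits need one fixed disk. Parametrizing by the value w of the
    moment function cures this: if T = exp(s tau), that value is taken at the point [psie tau s w],
    which no longer involves the measure. For bounded s all these points lie in the disk of radius
    1/2 once w is small, and the identity theorem extends the germ identities to a disk of w's
    chosen beforehand. The price is that Herglotz transforms get evaluated at moving points; this is
    harmless because transforms of bounded mass are uniformly Lipschitz inside the unit disk. An
    n-th root of a germ is fixed only up to a root of unity. Its modulus is 1, so a rotation absorbs
    it without spoiling the bound |B| <= 1. Convolutions with a factor of zero mean are defined by
    free variables. There the mean is multiplicative, so a product of nonzero mean never comes from
    that case, and T-transforms are always available. *)

Section complex_modulus.
Variable R : realType.
Local Notation C := R[i].
Implicit Types (x y z a h : C) (r d : R).

Lemma normcE_abs z : `|z| = (normc z)%:C :> C. Proof. by case: z. Qed.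
Lemma normc_ge0 z : 0 <= normc z. Proof. by case: z => a b; rewrite sqrtr_ge0. Qed.
Lemma normc_eq0 z : (normc z == 0) = (z == 0).
Proof. by apply/eqP/eqP => [/eq0_normc//|->]; exact: normc0. Qed.
Lemma normc_gt0 z : (0 < normc z) = (z != 0).
Proof. by rewrite lt_def normc_eq0 normc_ge0 andbT. Qed.
Lemma normcD x y : normc (x + y) <= normc x + normc y.
Proof. exact: le_normcD. Qed.
Lemma normc_opp x : normc (- x) = normc x.
Proof. by case: x => a b /=; rewrite !sqrrN. Qed.
Lemma normcBC x y : normc (x - y) = normc (y - x).
Proof. by rewrite -normc_opp opprB. Qed.
Lemma normcB x y : normc (x - y) <= normc x + normc y.
Proof. by rewrite -(normc_opp y); exact: normcD. Qed.
Lemma normcD_ge x y : normc x - normc y <= normc (x + y).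
Proof. by have := normcB (x + y) y; rewrite addrK; lra. Qed.
Lemma normcB_ge x y : normc x - normc y <= normc (x - y).
Proof. by have := normcD_ge x (- y); rewrite normc_opp. Qed.
Lemma normc_1 : normc (1 : C) = 1. Proof. exact: normc1. Qed.
Lemma normcX z n : normc (z ^+ n) = normc z ^+ n.
Proof. by elim: n => [|n IH]; rewrite ?expr0 ?normc_1// !exprS normcM IH. Qed.
Lemma normcR r : normc (r%:C) = `|r|.
Proof. by rewrite /= expr0n /= addr0 sqrtr_sqr. Qed.
Lemma normc_nat n : normc (n%:R : C) = n%:R.
Proof. by rewrite -(rmorph_nat (real_complex R)) normcR ger0_norm. Qed.
Lemma normc_div x y : normc (x / y) = normc x / normc y.
Proof. by rewrite normcM normcV. Qed.
Lemma normc_Re z : `|complex.Re z| <= normc z.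
Proof.
by case: z => a b /=; rewrite -(sqrtr_sqr a) ler_wsqrtr// lerDl sqr_ge0.
Qed.
Lemma normc_Im z : `|complex.Im z| <= normc z.
Proof.
by case: z => a b /=; rewrite -(sqrtr_sqr b) ler_wsqrtr// lerDr sqr_ge0.
Qed.
Lemma normc_sqr z : normc z ^+ 2 = complex.Re z ^+ 2 + complex.Im z ^+ 2.
Proof. by case: z => a b /=; rewrite sqr_sqrtr// addr_ge0// sqr_ge0. Qed.
Lemma normc_le_ReIm z : normc z <= `|complex.Re z| + `|complex.Im z|.
Proof.
rewrite -(@ler_pXn2r _ 2)// ?nnegrE ?normc_ge0 ?addr_ge0//.
rewrite normc_sqr sqrrD !real_normK ?num_real//.
have : 0 <= `|complex.Re z| * `|complex.Im z| by rewrite mulr_ge0.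
lra.
Qed.
Lemma normc_conj z : normc (conjc z) = normc z.
Proof. by case: z => a b /=; rewrite sqrrN. Qed.
Lemma mulc_conj z : z * conjc z = (normc z ^+ 2)%:C.
Proof. by rewrite normc_sqr; case: z => a b /=; congr (_ +i* _); ring. Qed.

Lemma normc_sum (I : Type) (s : seq I) (P : pred I) (F : I -> C) :
  normc (\sum_(i <- s | P i) F i) <= \sum_(i <- s | P i) normc (F i).
Proof.
elim/big_rec2: _ => [|i y x _ le_yx]; first by rewrite normc0.
by rewrite (le_trans (normcD _ _))// lerD2l.
Qed.

Lemma ReD x y : complex.Re (x + y) = complex.Re x + complex.Re y.
Proof. by case: x; case: y. Qed.
Lemma ImD x y : complex.Im (x + y) = complex.Im x + complex.Im y.
Proof. by case: x; case: y. Qed.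
Lemma ReN x : complex.Re (- x) = - complex.Re x. Proof. by case: x. Qed.
Lemma ImN x : complex.Im (- x) = - complex.Im x. Proof. by case: x. Qed.
Lemma ReB x y : complex.Re (x - y) = complex.Re x - complex.Re y.
Proof. by rewrite ReD ReN. Qed.
Lemma ImB x y : complex.Im (x - y) = complex.Im x - complex.Im y.
Proof. by rewrite ImD ImN. Qed.
Lemma ReM x y : complex.Re (x * y) =
  complex.Re x * complex.Re y - complex.Im x * complex.Im y.
Proof. by case: x; case: y. Qed.
Lemma ImM x y : complex.Im (x * y) =
  complex.Re x * complex.Im y + complex.Im x * complex.Re y.
Proof. by case: x; case: y. Qed.
Lemma ReMr r x : complex.Re (r%:C * x) = r * complex.Re x.
Proof. by rewrite ReM /= mul0r subr0. Qed.
Lemma ImMr r x : complex.Im (r%:C * x) = r * complex.Im x.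
Proof. by rewrite ImM /= mul0r addr0. Qed.
Lemma Re_sum (I : Type) (s : seq I) (P : pred I) (F : I -> C) :
  complex.Re (\sum_(i <- s | P i) F i) = \sum_(i <- s | P i) complex.Re (F i).
Proof. by elim/big_rec2: _ => // i y x _ <-; rewrite ReD. Qed.

Lemma eqcP x y : complex.Re x = complex.Re y -> complex.Im x = complex.Im y -> x = y.
Proof. by case: x; case: y => /= a b c d -> ->. Qed.

(** Balls of R[i] have radii in R[i] itself; a positive one is real, so real radii and [normc]
    suffice. *)
Lemma nbhsCP (a : C) (P : set C) :
  nbhs a P <-> exists2 d : R, 0 < d & forall z, normc (z - a) < d -> P z.
Proof.
split=> [/nbhs_ballP[e /= e0 eP]|[d d0 dP]].
  have [e0' ee] : 0 < complex.Re e /\ e = (complex.Re e)%:C.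
    by move: e0; rewrite ltcE => /andP[/eqP /= eI eR]; split => //; apply: eqcP.
  exists (complex.Re e) => // z zd; apply: eP; rewrite /ball /= ee.
  by rewrite distrC normcE_abs ltcR.
apply/nbhs_ballP; exists d%:C => /=; first by rewrite ltcR.
by move=> z; rewrite /ball /= distrC normcE_abs ltcR => /dP.
Qed.

Lemma near0CP (P : set C) :
  (\forall z \near (0 : C), P z) <-> exists2 d : R, 0 < d & forall z, normc z < d -> P z.
Proof.
apply: (iff_trans (nbhsCP 0 P)).
by split=> -[d d0 dP]; exists d => // z zd; apply: dP; move: zd; rewrite subr0.
Qed.

End complex_modulus.

(** * Taylor expansions and the maximum principle *)

Section peano_expansions.
Variable R : realType.
Local Notation C := R[i].
Implicit Types (f g k F G : C -> C) (a b z : C) (n m : nat) (p q : {poly C}).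

(** Landau's O(h^n) at 0 with the point 0 included: for n > 0 it forces g(0) = 0, because 0^n =
    0. *)
Definition bigO n g := exists K d : R, 0 < d /\
  forall h, normc h < d -> normc (g h) <= K * normc h ^+ n.

Lemma bigO_pos n g : bigO n g -> exists K d : R, [/\ 0 < K, 0 < d, d <= 1 &
  forall h, normc h < d -> normc (g h) <= K * normc h ^+ n].
Proof.
move=> [K [d [d0 H]]]; exists (`|K| + 1), (Num.min d 1); split.
- by rewrite ltr_wpDl.
- by rewrite lt_min d0 ltr01.
- by rewrite ge_min lexx orbT.
move=> h; rewrite lt_min => /andP[hd _]; apply: (le_trans (H h hd)).
rewrite ler_wpM2r ?exprn_ge0 ?normc_ge0//.
by rewrite (le_trans (ler_norm K))// lerDl.
Qed.

Lemma bigO_eq n f g (d : R) : 0 < d -> (forall h, normc h < d -> f h = g h) ->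
  bigO n f -> bigO n g.
Proof.
move=> d0 fg [K [e [e0 H]]]; exists K, (Num.min d e); split.
  by rewrite lt_min d0.
by move=> h; rewrite lt_min => /andP[hd he]; rewrite -fg//; apply: H.
Qed.

Lemma bigO_ext n f g : (forall h, f h = g h) -> bigO n f -> bigO n g.
Proof. by move=> fg; apply: (@bigO_eq _ _ _ 1). Qed.

Lemma bigO_le m n g : (m <= n)%N -> bigO n g -> bigO m g.
Proof.
move=> mn /bigO_pos[K [d [K0 d0 d1 H]]]; exists K, d; split => // h hd.
apply: (le_trans (H h hd)); rewrite ler_wpM2l ?(ltW K0)//.
by rewrite ler_wiXn2l// ?normc_ge0// (le_trans (ltW hd)).
Qed.

Lemma bigO0 n : bigO n (fun=> 0).
Proof. by exists 0, 1; split => // h _; rewrite mul0r normc0. Qed.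

Lemma bigOD n f g : bigO n f -> bigO n g -> bigO n (fun h => f h + g h).
Proof.
move=> [K [d [d0 H]]] [K' [d' [d0' H']]]; exists (K + K'), (Num.min d d').
split; first by rewrite lt_min d0.
move=> h; rewrite lt_min => /andP[hd hd'].
by rewrite (le_trans (normcD _ _))// mulrDl lerD ?H ?H'.
Qed.

Lemma bigOM m n f g : bigO m f -> bigO n g -> bigO (m + n) (fun h => f h * g h).
Proof.
move=> /bigO_pos[K [d [K0 d0 _ H]]] /bigO_pos[K' [d' [K0' d0' _ H']]].
exists (K * K'), (Num.min d d'); split; first by rewrite lt_min d0.
move=> h; rewrite lt_min => /andP[hd hd'].
by rewrite normcM exprD mulrACA ler_pM ?normc_ge0 ?H ?H'.
Qed.

Lemma bigO_cst c : bigO 0 (fun=> c).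
Proof. by exists (normc c), 1; split => // h _; rewrite mulr1. Qed.

Lemma bigO_id : bigO 1 id.
Proof. by exists 1, 1; split => // h _; rewrite mul1r. Qed.

Lemma bigOMl n c g : bigO n g -> bigO n (fun h => c * g h).
Proof. by apply: (@bigOM 0); exact: bigO_cst. Qed.

Lemma bigON n g : bigO n g -> bigO n (fun h => - g h).
Proof. by move=> /(bigOMl (-1)); apply: bigO_ext => h; rewrite mulN1r. Qed.

Lemma bigOB n f g : bigO n f -> bigO n g -> bigO n (fun h => f h - g h).
Proof. by move=> Hf Hg; exact: (bigOD Hf (bigON Hg)). Qed.

Lemma bigO_poly p : bigO 0 (fun h => p.[h]).
Proof.
elim/poly_ind: p => [|p c IH].
  by apply: bigO_ext (bigO0 0) => h; rewrite horner0.
have := bigOD (bigOM IH (bigO_le (leq0n 1) bigO_id)) (bigO_cst c).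
by apply: bigO_ext => h; rewrite hornerMXaddC.
Qed.

Lemma bigO_poly1 p : p.[0] = 0 -> bigO 1 (fun h => p.[h]).
Proof.
move=> p0; have /factor_theorem[q pE] : root p 0 by apply/rootP.
have := bigOM (bigO_poly q) bigO_id.
by apply: bigO_ext => h; rewrite pE hornerM hornerXsubC subr0.
Qed.

Lemma bigO_comp n g k : bigO n g -> bigO 1 k -> bigO n (fun h => g (k h)).
Proof.
move=> /bigO_pos[K [d [K0 d0 _ H]]] /bigO_pos[K' [d' [K0' d0' _ H']]].
exists (K * K' ^+ n), (Num.min d' (d / K')); split.
  by rewrite lt_min d0'/= divr_gt0.
move=> h; rewrite lt_min => /andP[hd'].
rewrite ltr_pdivlMr// mulrC => hd.
have kh : normc (k h) <= K' * normc h by have := H' h hd'; rewrite expr1.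
apply: (le_trans (H _ (le_lt_trans kh hd))).
rewrite -mulrA -exprMn ler_wpM2l ?(ltW K0)//.
by rewrite lerXn2r ?nnegrE ?mulr_ge0 ?normc_ge0// (ltW K0').
Qed.

Lemma bigO_at0 n g : bigO n.+1 g -> g 0 = 0.
Proof.
move=> [K [d [d0 /(_ 0)]]]; rewrite normc0 expr0n mulr0 => /(_ d0) H.
by apply/eqP; rewrite -normc_eq0 eq_le normc_ge0 H.
Qed.

Definition jet n g := exists p, bigO n (fun h => g h - p.[h]).

Lemma jet_le m n g : (m <= n)%N -> jet n g -> jet m g.
Proof. by move=> mn [p H]; exists p; apply: bigO_le H. Qed.

Lemma jet_eq n f g (d : R) : 0 < d -> (forall h, normc h < d -> f h = g h) ->
  jet n f -> jet n g.
Proof.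
by move=> d0 fg [p H]; exists p; apply: bigO_eq d0 _ H => h /fg ->.
Qed.

Lemma jet_bigO n f g : bigO n (fun h => f h - g h) -> jet n g -> jet n f.
Proof.
move=> fg [p H]; exists p; apply: bigO_ext (bigOD fg H) => h; ring.
Qed.

Lemma jet_poly n p : jet n (fun h => p.[h]).
Proof. by exists p; apply: bigO_ext (bigO0 n) => h; rewrite subrr. Qed.

Lemma jet_cst n c : jet n (fun=> c).
Proof. by apply: jet_eq (jet_poly n c%:P) => [//|h _]; rewrite hornerC. Qed.

Lemma jet_id n : jet n id.
Proof. by apply: jet_eq (jet_poly n 'X) => [//|h _]; rewrite hornerX. Qed.

Lemma jetD n f g : jet n f -> jet n g -> jet n (fun h => f h + g h).
Proof.
move=> [p Hp] [q Hq]; exists (p + q); apply: bigO_ext (bigOD Hp Hq) => h.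
rewrite hornerD; ring.
Qed.

Lemma jet_bounded n f : jet n f -> bigO 0 f.
Proof.
move=> [p H]; apply: bigO_ext (bigOD (bigO_le (leq0n n) H) (bigO_poly p)) => h; ring.
Qed.

Lemma jetM n f g : jet n f -> jet n g -> jet n (fun h => f h * g h).
Proof.
move=> jf; have Bf := jet_bounded jf; case: jf => p Hp [q Hq]; exists (p * q).
have := bigOD (bigOM Bf Hq) (bigOM (bigO_poly q) Hp).
rewrite add0n; apply: bigO_ext => h; rewrite hornerM; ring.
Qed.

(** The factor h gains one order; the inductions in [peano_invr] and [peano_cauchyT] run on this
    gain. *)
Lemma jetMX n g : jet n g -> jet n.+1 (fun h => h * g h).
Proof.
move=> [p H]; exists (p * 'X); apply: bigO_ext (bigOM bigO_id H) => h.
rewrite hornerMX; ring.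
Qed.

Lemma jet_hornerc n p g : jet n g -> jet n (fun h => p.[g h]).
Proof.
move=> jg; elim/poly_ind: p => [|p c IH].
  by apply: jet_eq (jet_cst n 0) => [//|h _]; rewrite horner0.
apply: jet_eq (jetD (jetM IH jg) (jet_cst n c)) => [//|h _].
by rewrite hornerMXaddC.
Qed.

Lemma jet_bigO1 n g : jet n.+1 g -> g 0 = 0 -> bigO 1 g.
Proof.
move=> [p H] g0; have p0 : p.[0] = 0 by have := bigO_at0 H; rewrite g0 sub0r => /eqP; rewrite oppr_eq0 => /eqP.
have := bigOD (bigO_le (isT : (1 <= n.+1)%N) H) (bigO_poly1 p0).
by apply: bigO_ext => h; ring.
Qed.

(** One more order is asked of k because [jet 0] means boundedness only; from order 1 on, k(0) = 0
    yields k(h) = O(h). *)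
Lemma jet_comp n g k : jet n g -> jet n.+1 k -> k 0 = 0 -> jet n (fun h => g (k h)).
Proof.
move=> [p H] jk k0; apply: (@jet_bigO _ _ (fun h => p.[k h])).
  exact: (bigO_comp H (jet_bigO1 jk k0)).
by apply: jet_hornerc; apply: jet_le jk.
Qed.

(* This stands in for analyticity; being stable under composition and difference
   quotients, it makes path integrals unnecessary. *)
Definition peano F a := forall n, jet n (fun h => F (a + h)).

Lemma peano_eq F G a (d : R) : 0 < d -> (forall z, normc (z - a) < d -> F z = G z) ->
  peano F a -> peano G a.
Proof.
move=> d0 FG pF n; apply: jet_eq d0 _ (pF n) => h hd; apply: FG.
by rewrite addrC addKr.
Qed.

Lemma peano_ext F G a : (forall z, F z = G z) -> peano F a -> peano G a.
Proof. by move=> FG; apply: (@peano_eq _ _ _ 1). Qed.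

Lemma peano_cst c a : peano (fun=> c) a. Proof. by move=> n; exact: jet_cst. Qed.

Lemma peano_id a : peano id a.
Proof. by move=> n; exact: jetD (jet_cst n a) (jet_id n). Qed.

Lemma peanoD F G a : peano F a -> peano G a -> peano (fun z => F z + G z) a.
Proof. by move=> pF pG n; exact: (jetD (pF n) (pG n)). Qed.

Lemma peanoM F G a : peano F a -> peano G a -> peano (fun z => F z * G z) a.
Proof. by move=> pF pG n; exact: jetM (pF n) (pG n). Qed.

Lemma peanoN F a : peano F a -> peano (fun z => - F z) a.
Proof.
move=> pF; apply: peano_ext (peanoM (peano_cst (-1) a) pF) => z.
by rewrite mulN1r.
Qed.

Lemma peanoB F G a : peano F a -> peano G a -> peano (fun z => F z - G z) a.
Proof. by move=> pF pG; exact: (peanoD pF (peanoN pG)). Qed.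

Lemma peano_sum (I : Type) (s : seq I) (F : I -> C -> C) a :
  (forall i, peano (F i) a) -> peano (fun z => \sum_(i <- s) F i z) a.
Proof.
move=> pF; elim: s => [|i s IH].
  by apply: peano_ext (peano_cst 0 a) => z; rewrite big_nil.
by apply: peano_ext (peanoD (pF i) IH) => z; rewrite big_cons.
Qed.

Lemma peanoX F n a : peano F a -> peano (fun z => F z ^+ n) a.
Proof.
move=> pF; elim: n => [|n IH].
  by apply: peano_ext (peano_cst 1 a) => z; rewrite expr0.
by apply: peano_ext (peanoM pF IH) => z; rewrite exprS.
Qed.

Lemma peano_comp F G a : peano F (G a) -> peano G a -> peano (fun z => F (G z)) a.
Proof.
move=> pF pG n.
have jk : jet n.+1 (fun h => G (a + h) - G a).
  exact: jetD (pG n.+1) (jet_cst _ _).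
have := jet_comp (pF n) jk; rewrite addr0 subrr => /(_ erefl).
by apply: (@jet_eq _ _ _ 1) => // h _; rewrite addrC subrK.
Qed.

(** Induction on the order by 1/(b + h) = 1/b - (1/b) h/(b + h), where the factor h gains an order;
    order 0 is boundedness near b. *)
Lemma peano_invr b : b != 0 -> peano (fun z => z^-1) b.
Proof.
move=> b0; have nb0 : 0 < normc b by rewrite normc_gt0.
have near_b h : normc h < normc b / 2 -> normc b / 2 <= normc (b + h).
  by move=> hb; have := normcD_ge b h; lra.
elim=> [|n IH].
  exists 0; exists (2 / normc b), (normc b / 2); split; first by rewrite divr_gt0.
  move=> h /near_b hb; rewrite horner0 subr0 expr0 mulr1 normcV.
  by rewrite -[leRHS]invrK lef_pV2 ?posrE ?invf_div// ?divr_gt0// (lt_le_trans _ hb)// divr_gt0.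
apply: (@jet_eq _ (fun h => b^-1 + (- b^-1) * (h * (b + h)^-1)) _ (normc b / 2)).
- by rewrite divr_gt0.
- move=> h /near_b hb.
  have bh0 : b + h != 0 by rewrite -normc_gt0 (lt_le_trans _ hb)// divr_gt0.
  by field; rewrite b0 bh0.
- by apply: jetD (jet_cst _ _) (jetM (jet_cst _ _) (jetMX IH)).
Qed.

Lemma peanoV F a : F a != 0 -> peano F a -> peano (fun z => (F z)^-1) a.
Proof. by move=> Fa0; apply: (@peano_comp (fun z => z^-1)); exact: peano_invr. Qed.

Lemma peano_div F G a : G a != 0 -> peano F a -> peano G a ->
  peano (fun z => F z / G z) a.
Proof. by move=> G0 pF /(peanoV G0); exact: peanoM. Qed.

Lemma bigO_derive F a c : bigO 2 (fun h => F (a + h) - F a - c * h) ->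
  derivable F a 1 /\ derive1 F a = c.
Proof.
move=> /bigO_pos[K [d [K0 d0 _ H]]].
have cv : (fun h : C => h^-1 *: (F (h *: (1 : C) + a) - F a)) @ 0^' --> c.
  apply/cvgrPdist_lt => e e0.
  have [e0' ee] : 0 < complex.Re e /\ e = (complex.Re e)%:C.
    by move: e0; rewrite ltcE => /andP[/eqP /= eI eR]; split => //; apply: eqcP.
  apply/nbhsCP; exists (Num.min d (complex.Re e / K)).
    by rewrite lt_min d0/= divr_gt0.
  move=> h; rewrite subr0 lt_min => /andP[hd hK] /= h0.
  have nh0 : 0 < normc h by rewrite normc_gt0.
  rewrite ee distrC normcE_abs ltcR.
  have -> : h^-1 *: (F (h *: (1 : C) + a) - F a) - c
      = h^-1 * (F (a + h) - F a - c * h).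
    by rewrite -[_ *: 1]/(h * 1) mulr1 (addrC h) -[_ *: _]/(_ * _); field.
  rewrite normcM normcV mulrC ltr_pdivrMr//.
  apply: (le_lt_trans (H h hd)); rewrite expr2 mulrA ltr_pM2r//.
  by rewrite mulrC -ltr_pdivlMr.
have dF : derivable F a 1 by apply/cvg_ex; exists c.
split=> //; rewrite derive1E; exact: (cvg_lim _ cv).
Qed.

(** Repeated division by 'X reads off the Taylor coefficients one by one. *)
Lemma poly_divX p : p = (p %/ 'X) * 'X + (p.[0])%:P.
Proof.
have E : 'X = 'X - (0 : C)%:P by rewrite polyC0 subr0.
by rewrite {1}(divp_eq p 'X) {3}E modp_XsubC.
Qed.

Lemma poly_bigO2 p : bigO 2 (fun h => p.[h] - p.[0] - (p %/ 'X).[0] * h).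
Proof.
have pE := poly_divX p; set q := p %/ 'X in pE *.
have q0 : (q - (q.[0])%:P).[0] = 0 by rewrite hornerD hornerN hornerC subrr.
apply: bigO_ext (bigOM bigO_id (bigO_poly1 q0)) => h.
have -> : p.[h] = q.[h] * h + p.[0] by rewrite {1}pE hornerD hornerC hornerMX.
rewrite hornerD hornerN hornerC /=; ring.
Qed.

Lemma jet_bigO2 F a p n : bigO n.+2 (fun h => F (a + h) - p.[h]) ->
  F a = p.[0] /\ bigO 2 (fun h => F (a + h) - F a - (p %/ 'X).[0] * h).
Proof.
move=> H; have Fa : F a = p.[0].
  by have := bigO_at0 H; rewrite addr0 => /eqP; rewrite subr_eq0 => /eqP.
split=> //; have := bigOD (bigO_le (isT : (2 <= n.+2)%N) H) (poly_bigO2 p).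
by apply: bigO_ext => h; rewrite Fa; ring.
Qed.

Lemma jet_derive F a p n : bigO n.+2 (fun h => F (a + h) - p.[h]) ->
  [/\ F a = p.[0], derivable F a 1 & derive1 F a = (p %/ 'X).[0]].
Proof. by move=> /jet_bigO2[Fa /bigO_derive[dF <-]]. Qed.

Lemma peano_derivable F a : peano F a -> derivable F a 1.
Proof. by move=> /(_ 2)[p /jet_derive[]]. Qed.

Lemma peano_bigO2 F a : peano F a ->
  bigO 2 (fun h => F (a + h) - F a - derive1 F a * h).
Proof. by move=> /(_ 2)[p /jet_bigO2[_ H]]; have [_ ->] := bigO_derive H. Qed.

Definition dquot F a z := if z == a then derive1 F a else (F z - F a) / (z - a).

Lemma dquotE F a z : (z - a) * dquot F a z = F z - F a.
Proof.
rewrite /dquot; case: eqP => [->|/eqP za]; first by rewrite !subrr mul0r.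
by rewrite mulrC divfK// subr_eq0.
Qed.

(** Division by h costs one order. The expansion of order n + 2 also identifies F'(a), the value put
    in at h = 0. *)
Lemma peano_dquot_at F a : peano F a -> peano (dquot F a) a.
Proof.
move=> pF n; have [p H] := pF n.+2; have [Fa _ dF] := jet_derive H.
have pE := poly_divX p; exists (p %/ 'X); set q := p %/ 'X in pE dF *.
move: H => /bigO_pos[K [d [K0 d0 d1 H]]]; exists K, d; split => // h hd.
rewrite /dquot -{2}[a]addr0 (inj_eq (addrI a)).
case: eqP => [->|/eqP h0].
  by rewrite dF subrr normc0 mulr_ge0 ?(ltW K0)// exprn_ge0 ?normc_ge0.
have nh0 : 0 < normc h by rewrite normc_gt0.
have -> : (F (a + h) - F a) / (a + h - a) - q.[h] = h^-1 * (F (a + h) - p.[h]).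
  have -> : p.[h] = q.[h] * h + p.[0] by rewrite {1}pE hornerD hornerC hornerMX.
  have -> : a + h - a = h by ring.
  by rewrite Fa; field.
rewrite normcM normcV mulrC ler_pdivrMr// (le_trans (H h hd))//.
rewrite -mulrA -exprSr ler_wpM2l ?(ltW K0)// exprSr ler_piMr ?exprn_ge0 ?normc_ge0//.
by rewrite (le_trans (ltW hd)).
Qed.

Lemma peano_dquot F a b : peano F a -> peano F b -> peano (dquot F a) b.
Proof.
move=> pFa pFb; have [->|ba] := eqVneq b a; first exact: peano_dquot_at.
have ba0 : 0 < normc (b - a) by rewrite normc_gt0 subr_eq0.
apply: (@peano_eq (fun z => (F z - F a) / (z - a)) _ _ (normc (b - a))) => //.
  move=> z; rewrite /dquot; case: eqP => // -> /=.
  by rewrite normcBC ltxx.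
apply: peano_div; first by rewrite subr_eq0.
  by apply: peanoB => //; exact: peano_cst.
by apply: peanoB; [exact: peano_id|exact: peano_cst].
Qed.

Lemma peano_continuous F a : peano F a -> forall e : R, 0 < e -> exists2 d : R, 0 < d &
  forall z, normc (z - a) < d -> normc (F z - F a) < e.
Proof.
move=> pF e e0.
have := @jet_bigO1 0 (fun h => F (a + h) - F a) (jetD (pF 1) (jet_cst _ _)).
rewrite addr0 subrr => /(_ erefl) /bigO_pos[K [d [K0 d0 _ H]]].
exists (Num.min d (e / K)); first by rewrite lt_min d0 divr_gt0.
move=> z; rewrite lt_min => /andP[zd zK].
have := H _ zd; rewrite addrCA subrr addr0 expr1 => /le_lt_trans; apply.
by rewrite mulrC -ltr_pdivlMr.
Qed.

End peano_expansions.

(** * The complex exponential and its Taylor expansion *)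

Section complex_exponential.
Variable R : realType.
Local Notation C := R[i].
Implicit Types (c h z w : C) (s t : R) (n : nat).

Lemma cexp0 : cexp (0 : C) = 1.
Proof. by rewrite /cexp /= expR0 cos0 sin0 mul1r. Qed.

Lemma cexpD z w : cexp (z + w) = cexp z * cexp w.
Proof.
case: z => a b; case: w => a' b'; rewrite /cexp /= expRD cosD sinD.
by apply: eqcP => /=; ring.
Qed.

Lemma normc_cexp z : normc (cexp z) = expR (complex.Re z).
Proof.
rewrite /cexp normcM normcR ger0_norm ?expR_ge0//=.
by rewrite cos2Dsin2 sqrtr1 mulr1.
Qed.

Lemma cexp_neq0 z : cexp z != 0.
Proof. by rewrite -normc_gt0 normc_cexp expR_gt0. Qed.

Lemma cexpN z : cexp (- z) = (cexp z)^-1.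
Proof. by apply: (mulIf (cexp_neq0 z)); rewrite -cexpD addNr cexp0 mulVf ?cexp_neq0. Qed.

Lemma cexpB z w : cexp (z - w) = cexp z / cexp w.
Proof. by rewrite cexpD cexpN. Qed.

Lemma cexpMn n z : cexp (n%:R * z) = cexp z ^+ n.
Proof.
elim: n => [|n IH]; first by rewrite mul0r cexp0 expr0.
by rewrite -natr1 mulrDl mul1r cexpD IH exprSr.
Qed.

Definition exp_taylor n z : C := \sum_(k < n) z ^+ k / k`!%:R.

Lemma is_derive_cexp_ray c h s :
  is_derive s 1 (fun s : R => complex.Re (c * cexp (s%:C * h)))
    (complex.Re (c * h * cexp (s%:C * h))).
Proof.
case: c => a b; case: h => x y.
have -> : (fun s : R => complex.Re ((a +i* b) * cexp (s%:C * (x +i* y)))) =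
  (fun s : R => expR (s * x) * (a * cos (s * y) - b * sin (s * y))).
  apply/funext => t; rewrite /cexp ReM ImM ReM ImM /= !mul0r !subr0 !addr0; ring.
apply: is_derive_eq.
rewrite /cexp /= !mul0r !subr0 !addr0 /GRing.scale /=; ring.
Qed.

Lemma exp_taylor_ray c h n t : complex.Re (c * exp_taylor n (t%:C * h)) =
  \sum_(k < n) t ^+ k * complex.Re (c * (h ^+ k / k`!%:R)).
Proof.
rewrite /exp_taylor mulr_sumr Re_sum; apply: eq_bigr => k _.
rewrite exprMn -(rmorphXn (real_complex R)) -ReMr; congr complex.Re; ring.
Qed.

Lemma is_derive_taylor_ray c h n s :
  is_derive s 1 (fun s : R => complex.Re (c * exp_taylor n.+1 (s%:C * h)))
    (complex.Re (c * h * exp_taylor n (s%:C * h))).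
Proof.
have -> : (fun s : R => complex.Re (c * exp_taylor n.+1 (s%:C * h))) =
  (fun s : R => \sum_(k < n.+1) s ^+ k * complex.Re (c * (h ^+ k / k`!%:R))).
  by apply/funext => t; exact: exp_taylor_ray.
rewrite exp_taylor_ray; elim: n => [|n IH].
  rewrite big_ord0; under eq_fun do rewrite big_ord1 expr0 mul1r.
  exact: is_derive_cst.
rewrite big_ord_recr /=; under eq_fun do rewrite big_ord_recr /=.
apply: is_deriveD.
set r := complex.Re (c * (h ^+ n.+1 / _)).
have dX : is_derive s 1 (fun x : R => x ^+ n.+1) (n.+1%:R *: s ^+ n *: 1).
  by apply: DeriveDef; [exact: exprn_derivable|exact: exp_derive].
apply: (is_derive_eq (is_deriveM dX (is_derive_cst r s 1))).
rewrite /r /GRing.scale /= mulr0 add0r mulr1.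
have n0 : (n.+1%:R : C) != 0 by rewrite pnatr_eq0.
have f0 : (n`!%:R : C) != 0 by rewrite pnatr_eq0 -lt0n fact_gt0.
have -> : c * h * (h ^+ n / n`!%:R) = n.+1%:R%:C * (c * (h ^+ n.+1 / (n.+1)`!%:R)).
  rewrite factS natrM rmorph_nat exprS; move: n0 f0; set u := n.+1%:R; set v := n`!%:R.
  by move: u v => u v u0 v0; field; rewrite u0 v0.
by rewrite ReMr; ring.
Qed.

(** Mean value theorem and induction on n: the derivative in s of the remainder of order n + 1 with
    coefficient c is the remainder of order n with coefficient c h, which is why c is arbitrary. *)
Lemma cexp_taylor_Re n c h s : normc h <= 1 -> 0 <= s <= 1 ->
  `|complex.Re (c * (cexp (s%:C * h) - exp_taylor n (s%:C * h)))|
    <= expR 1 * normc c * normc h ^+ n.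
Proof.
move=> h1; elim: n c s => [|n IH] c s /andP[s0 s1].
  rewrite /exp_taylor big_ord0 subr0 (le_trans (normc_Re _))// normcM normc_cexp.
  rewrite expr0 mulr1 mulrC ler_wpM2r ?normc_ge0// ler_expR.
  rewrite (le_trans (ler_norm _))// (le_trans (normc_Re _))// normcM normcR ger0_norm//.
  by rewrite mulr_ile1// normc_ge0.
pose f (s : R) := complex.Re (c * (cexp (s%:C * h) - exp_taylor n.+1 (s%:C * h))).
pose df (s : R) := complex.Re (c * h * (cexp (s%:C * h) - exp_taylor n (s%:C * h))).
have fd (t : R) : is_derive t 1 f (df t).
  rewrite /f /df; under eq_fun do rewrite mulrBr ReB.
  rewrite mulrBr ReB; apply: is_deriveB.
    exact: is_derive_cexp_ray.
  exact: is_derive_taylor_ray.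
have f0 : f 0 = 0.
  rewrite /f mul0r cexp0 /exp_taylor big_ord_recl expr0 fact0 divr1.
  by rewrite big1 ?addr0 ?subrr ?mulr0// => i _; rewrite expr0n mul0r.
have [->|sn0] := eqVneq s 0.
  by rewrite -/(f 0) f0 normr0 !mulr_ge0 ?expR_ge0 ?exprn_ge0 ?normc_ge0.
have s_gt0 : 0 < s by rewrite lt_def sn0.
have cf : {within `[0, s], continuous f}.
  apply: derivable_within_continuous => x _.
  exact: (@ex_derive _ _ _ _ _ _ _ (fd x)).
have [t] := MVT s_gt0 (fun x _ => fd x) cf.
rewrite in_itv /= f0 !subr0 => /andP[t0 ts] fE; rewrite -/(f s) fE normrM (ger0_norm s0).
have t1 : 0 <= t <= 1 by rewrite (ltW t0) (le_trans (ltW ts)).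
have := IH (c * h) t t1; rewrite -/(df t) normcM => H.
rewrite (le_trans (ler_piMr _ s1))// (le_trans H)// exprS.
by rewrite le_eqVlt; apply/orP; left; apply/eqP; ring.
Qed.

Lemma cexp_taylor n : bigO n (fun h => cexp h - exp_taylor n h).
Proof.
exists (expR 1 + expR 1), 1; split => // h /ltW h1.
have t1 : 0 <= (1 : R) <= 1 by rewrite ler01 lexx.
have H1 := cexp_taylor_Re n 1 h1 t1; have H2 := cexp_taylor_Re n (- 'i) h1 t1.
rewrite rmorph1 !mul1r in H1; rewrite rmorph1 !mul1r in H2.
rewrite normc_1 in H1; rewrite normc_opp in H2.
rewrite (le_trans (normc_le_ReIm _))// mulrDl lerD//.
  by rewrite (le_trans H1)// mulr1.
have -> : complex.Im (cexp h - exp_taylor n h) =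
  complex.Re (- 'i * (cexp h - exp_taylor n h)).
  by case: (cexp h - _) => a b /=; ring.
rewrite (le_trans H2)//= expr0n /= add0r expr1n sqrtr1 mulr1; exact: lexx.
Qed.

Lemma peano_cexp (z : C) : peano (@cexp R) z.
Proof.
move=> n; apply: (@jet_eq _ _ (fun h => cexp z * cexp h) _ 1) => //.
  by move=> h _; rewrite cexpD.
apply: jetM (jet_cst _ _) _.
exists (\poly_(k < n) (k`!%:R)^-1); apply: bigO_ext (cexp_taylor n) => h.
rewrite horner_poly; congr (_ - _); apply: eq_bigr => k _; exact: mulrC.
Qed.

Lemma derive1_cexp0 : derive1 (@cexp R) (0 : C) = 1.
Proof.
have [//|_ ] := @bigO_derive R (@cexp R) 0 1; last by [].
apply: bigO_ext (cexp_taylor 2) => h.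
rewrite /exp_taylor !big_ord_recr big_ord0 /= !add0r cexp0 fact0 factS fact0.
by rewrite muln1 expr0 expr1 !divr1; ring.
Qed.

End complex_exponential.

(** * Polar coordinates, limits in R[i], extrema on closed disks *)

Section polar.
Variable R : realType.
Local Notation C := R[i].
Implicit Types (z w : C) (s t r : R).

Lemma cvgCP (T : Type) (F : set_system T) (FF : Filter F) (f : T -> C) (l : C) :
  (f x @[x --> F] --> l) <-> forall e, 0 < e -> \forall x \near F, normc (f x - l) < e.
Proof.
split=> [fl e e0|H A /nbhsCP[e e0 eA]].
  by apply: (fl [set y | normc (y - l) < e]); apply/nbhsCP; exists e.
by apply: filterS (H e e0) => x; exact: eA.
Qed.

Lemma cvg_ReIm (T : Type) (F : set_system T) (FF : Filter F) (u v : T -> R) a b :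
  u x @[x --> F] --> a -> v x @[x --> F] --> b ->
  (u x +i* v x) @[x --> F] --> (a +i* b : C).
Proof.
move=> /cvgrPdist_lt ua /cvgrPdist_lt vb; apply/cvgCP => e e0.
have e20 : 0 < e / 2 by rewrite divr_gt0.
near=> x; apply: (le_lt_trans (normc_le_ReIm _)) => /=; rewrite (splitr e) ltrD//.
- by rewrite distrC; near: x; exact: ua.
- by rewrite distrC; near: x; exact: vb.
Unshelve. all: by end_near. Qed.

Lemma cvg_Re (T : Type) (F : set_system T) (FF : Filter F) (f : T -> C) (l : C) :
  f x @[x --> F] --> l -> complex.Re (f x) @[x --> F] --> complex.Re l.
Proof.
move=> /cvgCP fl; apply/cvgrPdist_lt => e /fl; apply: filterS => x.
by rewrite distrC -ReB; apply: le_lt_trans; exact: normc_Re.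
Qed.

Lemma cvg_Im (T : Type) (F : set_system T) (FF : Filter F) (f : T -> C) (l : C) :
  f x @[x --> F] --> l -> complex.Im (f x) @[x --> F] --> complex.Im l.
Proof.
move=> /cvgCP fl; apply/cvgrPdist_lt => e /fl; apply: filterS => x.
by rewrite distrC -ImB; apply: le_lt_trans; exact: normc_Im.
Qed.

Definition cis t : C := cexp (0 +i* t).

Lemma cisE t : cis t = cos t +i* sin t.
Proof. by rewrite /cis /cexp /= expR0 mul1r. Qed.
Lemma normc_cis t : normc (cis t) = 1.
Proof. by rewrite normc_cexp expR0. Qed.
Lemma cis0 : cis 0 = 1. Proof. by rewrite /cis cexp0. Qed.
Lemma cisD s t : cis (s + t) = cis s * cis t.
Proof. by rewrite -cexpD; congr cexp; apply: eqcP => /=; rewrite ?addr0. Qed.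
Lemma cisMn n t : cis (n%:R * t) = cis t ^+ n.
Proof.
rewrite -cexpMn; congr cexp; rewrite -(rmorph_nat (real_complex R)).
by apply: eqcP; rewrite ?ReMr ?ImMr /= ?mulr0.
Qed.
Lemma cis_2pi : cis (pi *+ 2) = 1.
Proof. by rewrite cisE cos2pi sin2pi. Qed.

(** The real part is 1 - 2 sin(t/2)^2, and t/2 lies strictly between 0 and pi. *)
Lemma cis_neq1 t : 0 < t < pi *+ 2 -> cis t != 1.
Proof.
move=> /andP[t0 t2]; rewrite cisE; apply/eqP => /(congr1 (@complex.Re _)) /= c1.
have s0 : 0 < sin (t / 2).
  by rewrite sin_gt0_pi// divr_gt0//= ltr_pdivrMr// mulr_natr.
have : cos t = 1 - sin (t / 2) ^+ 2 *+ 2.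
  by rewrite {1}[t]splitr cosD -!expr2 cos2sin2 mulr2n; ring.
have : 0 < sin (t / 2) ^+ 2 by rewrite exprn_gt0.
by rewrite c1; lra.
Qed.

Lemma unit_circleP z : normc z = 1 -> exists2 t, - pi <= t <= pi & z = cis t.
Proof.
move=> z1; have := normc_sqr z; rewrite z1 expr1n; case: z {z1} => a b /= ab.
have a1 : -1 <= a <= 1.
  by rewrite -ler_norml -(@ler_pXn2r _ 2)// ?nnegrE// real_normK ?num_real// expr1n ab lerDl sqr_ge0.
have ca : cos (acos a) = a by apply: acosK; rewrite in_itv.
have b2 : b ^+ 2 = 1 - a ^+ 2 by rewrite ab; ring.
have sa : sin (acos a) = `|b| by rewrite sin_acos// -b2 sqrtr_sqr.
have [b0|b0] := leP 0 b.
  exists (acos a); last by rewrite cisE ca sa ger0_norm.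
  by rewrite acos_lepi// (le_trans _ (acos_ge0 a1))// oppr_le0 pi_ge0.
exists (- acos a); last by rewrite cisE cosN sinN ca sa ltr0_norm// opprK.
rewrite lerN2 acos_lepi//= (le_trans _ (pi_ge0 R))// oppr_le0; exact: acos_ge0.
Qed.

Lemma polarP z : exists2 t, - pi <= t <= pi & z = (normc z)%:C * cis t.
Proof.
have [->|z0] := eqVneq z 0.
  by exists 0; rewrite ?normc0 ?mul0r// oppr_le0 pi_ge0.
have nz0 : normc z != 0 by rewrite normc_eq0.
have [|t tp E] := @unit_circleP (z / (normc z)%:C).
  by rewrite normc_div normcR ger0_norm ?normc_ge0// divff.
exists t => //; rewrite -E mulrC divfK//.
by apply/eqP => /(congr1 (@complex.Re _)) /= /eqP; rewrite (negbTE nz0).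
Qed.

Lemma cexp_surj z : z != 0 -> exists l, z = cexp l.
Proof.
move=> z0; have [t _ ->] := polarP z; exists (ln (normc z) +i* t).
rewrite /cexp /= lnK ?posrE ?normc_gt0//.
by rewrite cisE.
Qed.

Lemma continuous_cis : continuous cis.
Proof.
rewrite (_ : cis = fun t => cos t +i* sin t); last by apply/funext => u; exact: cisE.
by move=> t; apply: cvg_ReIm; [exact: continuous_cos|exact: continuous_sin].
Qed.

(** The closed disk is the image of the compact rectangle [0, r] x [- pi, pi] under polar
    coordinates, where the extreme value theorem applies. *)
Lemma disk_EVT (f : C -> R) r : 0 <= r ->
  (forall z, normc z <= r -> forall e : R, 0 < e -> exists2 d : R, 0 < d &
    forall w, normc (w - z) < d -> `|f w - f z| < e) ->
  exists2 c, normc c <= r & forall z, normc z <= r -> f z <= f c.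
Proof.
move=> r0 cf; pose K := `[0, r]%classic `*` `[- pi, pi]%classic : set (R * R).
pose h (x : R * R) : C := (x.1 * cos x.2) +i* (x.1 * sin x.2).
have hE x : h x = x.1%:C * cis x.2.
  by rewrite cisE; apply: eqcP; rewrite ?ReMr ?ImMr.
have hK x : K x -> normc (h x) <= r.
  move=> Kx; have /andP[x0 xr] : 0 <= x.1 <= r by case: Kx => + _; rewrite /= in_itv.
  by rewrite hE normcM normc_cis mulr1 normcR ger0_norm.
have [|||c cK cmax] := @compact_EVT_max _ R (f \o h) K.
- exists (0, 0); rewrite /K /= !in_itv /= lexx r0 pi_ge0 oppr_le0 pi_ge0 //.
- by apply: compact_setX; exact: segment_compact.
- apply: continuous_in_subspaceT => x /set_mem Kx.
  have ch : h y @[y --> x] --> h x.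
    apply: cvg_ReIm.
      apply: cvgM; first exact: cvg_fst.
      apply: (@cvg_comp _ _ _ snd cos); first exact: cvg_snd.
      exact: continuous_cos.
    apply: cvgM; first exact: cvg_fst.
    apply: (@cvg_comp _ _ _ snd sin); first exact: cvg_snd.
    exact: continuous_sin.
  apply/cvgrPdist_lt => e e0; have [d d0 H] := cf _ (hK _ Kx) _ e0.
  by move/cvgCP: ch => /(_ d d0); apply: filterS => y /H; rewrite distrC.
exists (h c); first exact/hK/set_mem.
move=> z zr; have [t tp zE] := polarP z.
have := cmax (normc z, t); rewrite [(f \o h) (normc z, t)]/comp hE /= -zE; apply.
by apply/mem_set; rewrite /K /= !in_itv /= normc_ge0 zr tp.
Qed.

End polar.

(** * Maximum principle, Schwarz' lemma, identity theorem *)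

Section maximum_principle.
Variable R : realType.
Local Notation C := R[i].
Implicit Types (F G : C -> C) (z w a : C) (r e M : R).

Lemma geometric_small (q e M : R) : 0 <= q < 1 -> 0 < e -> 0 <= M -> exists k, M * q ^+ k < e.
Proof.
move=> /andP[q0 q1] e0 M0.
have /cvgrPdist_lt/(_ e e0)[k _ /(_ k (leqnn k))] : geometric M q n @[n --> \oo] --> 0.
  by apply: cvg_geometric; rewrite ger0_norm.
rewrite /= sub0r normrN => H; exists k; exact: le_lt_trans (ler_norm _) H.
Qed.

Lemma sqr_normcD (x y : C) :
  normc x ^+ 2 - 2 * (normc x * normc y) <= normc (x + y) ^+ 2.
Proof.
have := normc_sqr (x + y); have := normc_sqr x; have := normc_sqr y.
have := normc_Re (x * conjc y); rewrite normcM normc_conj ler_norml => /andP[+ _].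
case: x => a b; case: y => c d /=; set N1 := Num.sqrt _; set N2 := Num.sqrt _.
set N3 := Num.sqrt _ => H1 H2 H3 H4; rewrite H3 H4; nra.
Qed.

(* Averaging over [t], [i t], [- t], [- i t] kills the cross terms, as averaging over
   a circle would. *)
Lemma quadratic_sphere_sum (A B D : C) (t : R) :
  \sum_(k < 4) normc (A + B * (t%:C * 'i ^+ k) + D * (t%:C * 'i ^+ k) ^+ 2) ^+ 2 =
  4 * (normc A ^+ 2 + normc B ^+ 2 * t ^+ 2 + normc D ^+ 2 * t ^+ 4).
Proof.
rewrite !big_ord_recr big_ord0 /= !normc_sqr.
case: A => a a'; case: B => b b'; case: D => d d'.
rewrite !expr2 !exprS !expr0 /=; ring.
Qed.

(** Over the four points a + t i^k the mean of the quadratic part exceeds the value at a by at least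
    e t^2, thanks to the term e |z|^2, while the Taylor remainder costs O(t^3); so for small t one
    of the four beats a. *)
Lemma no_local_max F a e d : 0 < e -> 0 < d -> peano F a ->
  exists2 h, normc h < d &
    normc (F a) ^+ 2 + e * normc a ^+ 2
    < normc (F (a + h)) ^+ 2 + e * normc (a + h) ^+ 2.
Proof.
move=> e0 d0 pF; have [p H] := pF 3%N.
have [q [Fa pE]] : exists q : {poly C}, F a = p.[0] /\ p = (q * 'X + (p %/ 'X).[0]%:P) * 'X + p.[0]%:P.
  exists ((p %/ 'X) %/ 'X); rewrite -poly_divX -poly_divX; split=> //.
  by have := bigO_at0 H; rewrite addr0 => /eqP; rewrite subr_eq0 => /eqP.
set B := (p %/ 'X).[0] in pE; set D := q.[0].
have q0 : (q - (q.[0])%:P).[0] = 0 by rewrite hornerD hornerN hornerC subrr.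
have : bigO 3 (fun h => F (a + h) - (F a + B * h + D * h ^+ 2)).
  apply: bigO_ext (bigOD H (bigOM (bigOM (bigO_id R) (bigO_id R)) (bigO_poly1 q0))) => h.
  rewrite hornerD hornerN hornerC /=.
  have -> : p.[h] = (q.[h] * h + B) * h + p.[0].
    by rewrite {1}pE !(hornerD, hornerMX, hornerC).
  by rewrite Fa /D; ring.
case=> K0 [d1 [d10 {}H]].

pose K := `|K0| + 1; have K_gt0 : 0 < K by rewrite ltr_wpDl.
pose S := normc (F a) + normc B + normc D.
have S0 : 0 <= S by rewrite !addr_ge0 ?normc_ge0.
(* Below d and the radius d1 of the expansion, at most 1, and small enough that 2 S K t^3 < e
   t^2. *)
pose t := Num.min (Num.min d d1 / 2) (Num.min 1 (e / (2 * S * K + 1)) / 2).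
have SK0 : 0 < 2 * S * K + 1 by rewrite ltr_wpDl// !mulr_ge0// ltW.
have t0 : 0 < t by rewrite !(lt_min, divr_gt0)// ?lt_min ?d0 ?d10 ?ltr01 ?divr_gt0.
have td : t < d.
  have : t <= Num.min d d1 / 2 by rewrite ge_min lexx.
  have : Num.min d d1 <= d by rewrite ge_min lexx.
  lra.
have td1 : t < d1.
  have : t <= Num.min d d1 / 2 by rewrite ge_min lexx.
  have : Num.min d d1 <= d1 by rewrite ge_min lexx orbT.
  lra.
have t2 : t <= Num.min 1 (e / (2 * S * K + 1)) / 2 by rewrite ge_min lexx orbT.
have t1 : t <= 1.
  have : Num.min 1 (e / (2 * S * K + 1)) <= 1 by rewrite ge_min lexx.
  lra.
have te : t * (2 * S * K + 1) < e.
  have : Num.min 1 (e / (2 * S * K + 1)) <= e / (2 * S * K + 1) by rewrite ge_min lexx orbT.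
  have : 0 < e / (2 * S * K + 1) by rewrite divr_gt0.
  rewrite -ltr_pdivlMr//; lra.
pose h (k : 'I_4) : C := t%:C * 'i ^+ k.
have nh k : normc (h k) = t.
  rewrite normcM normcR normcX ger0_norm ?(ltW t0)//=.
  by rewrite expr0n /= add0r expr1n sqrtr1 expr1n mulr1.
apply: contrapT => /forall2NP nomax.
have le_max (k : 'I_4) : normc (F (a + h k)) ^+ 2 + e * normc (a + h k) ^+ 2
    <= normc (F a) ^+ 2 + e * normc a ^+ 2.
  by case: (nomax (h k)) => /negP; rewrite ?nh ?td// -leNgt.
have lower (k : 'I_4) : normc (F a + B * h k + D * h k ^+ 2) ^+ 2 - 2 * (S * (K * t ^+ 3))
    <= normc (F (a + h k)) ^+ 2.
  set Q := F a + _ + _.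
  have -> : F (a + h k) = Q + (F (a + h k) - Q) by rewrite subrKC.
  apply: le_trans (sqr_normcD _ _); rewrite lerD2l lerN2 ler_pM2l ?ltr0n//.
  apply: ler_pM; rewrite ?normc_ge0//.
    rewrite (le_trans (normcD _ _))// lerD//.
      by rewrite (le_trans (normcD _ _))// lerD// normcM nh ler_piMr// normc_ge0.
    by rewrite normcM normcX nh ler_piMr ?normc_ge0// exprn_ile1// ltW.
  have := H (h k); rewrite nh => /(_ td1) /le_trans; apply.
  rewrite ler_wpM2r ?exprn_ge0 ?(ltW t0)// /K.
  by rewrite (le_trans (ler_norm _))// lerDl.
have S1 : \sum_(k < 4) (normc (F a + B * h k + D * h k ^+ 2) ^+ 2 - 2 * (S * (K * t ^+ 3))
     + e * normc (a + h k) ^+ 2) <= \sum_(k < 4) (normc (F a) ^+ 2 + e * normc a ^+ 2).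
  by apply: ler_sum => k _; apply: le_trans (le_max k); rewrite lerD2r.
have S2 := quadratic_sphere_sum a 1 0 t.
have {}S2 : \sum_(k < 4) normc (a + h k) ^+ 2 = 4 * (normc a ^+ 2 + t ^+ 2).
  rewrite (eq_bigr (fun k : 'I_4 => normc (a + 1 * (t%:C * 'i ^+ k) + 0 * (t%:C * 'i ^+ k) ^+ 2) ^+ 2)).
    by rewrite S2 normc_1 normc0 expr1n expr0n /= mul0r mul1r addr0.
  by move=> k _; rewrite mul1r mul0r addr0.
rewrite !big_split /= quadratic_sphere_sum -mulr_sumr S2 in S1.
rewrite !sumr_const card_ord in S1.
have B2 : 0 <= normc B ^+ 2 * t ^+ 2 by rewrite mulr_ge0 ?sqr_ge0.
have D2 : 0 <= normc D ^+ 2 * t ^+ 4 by rewrite mulr_ge0 ?sqr_ge0 ?exprn_ge0// ltW.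
have t3 : 2 * S * K * t ^+ 3 < e * t ^+ 2.
  rewrite exprS mulrA ltr_pM2r ?exprn_gt0//; nra.
lra.
Qed.

Lemma peano_sqr_continuous F (z : C) : peano F z -> forall e, 0 < e -> exists2 d : R, 0 < d &
  forall w, normc (w - z) < d -> `|normc (F w) ^+ 2 - normc (F z) ^+ 2| < e.
Proof.
move=> pF e e0; set N := normc (F z).
have N0 : 0 <= N := normc_ge0 _.
pose e1 := Num.min 1 (e / (2 * N + 2)).
have N20 : 0 < 2 * N + 2 by lra.
have e10 : 0 < e1 by rewrite lt_min ltr01 divr_gt0.
have e1le : e1 <= 1 by rewrite ge_min lexx.
have e1e : e1 * (2 * N + 2) <= e by rewrite -ler_pdivlMr// ge_min lexx orbT.
have [d d0 H] := peano_continuous pF e10; exists d => // w /H wz.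
have h1 := normcB_ge (F w) (F z); have h2 := normcB_ge (F z) (F w).
rewrite normcBC in h2; rewrite -/N in h1 h2.
have w0 := normc_ge0 (F w).
rewrite ltr_norml; apply/andP; split; nra.
Qed.

(** If |F z0| > M, take e with e r^2 < |F z0|^2 - M^2: the maximum of |F|^2 + e |z|^2 over the
    closed disk then exceeds every value on the circle, so it is interior, against
    [no_local_max]. *)
Lemma max_modulus F r M : 0 < r -> (forall z, normc z <= r -> peano F z) ->
  (forall z, normc z = r -> normc (F z) <= M) ->
  forall z, normc z <= r -> normc (F z) <= M.
Proof.
move=> r0 pF bF z0 z0r; rewrite leNgt; apply/negP => MF.
have M0 : 0 <= M.
  have nr : normc (r%:C : C) = r by rewrite normcR ger0_norm// ltW.
  exact: le_trans (normc_ge0 _) (bF _ nr).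
have F0 := normc_ge0 (F z0).
pose e := (normc (F z0) ^+ 2 - M ^+ 2) / (2 * r ^+ 2).
have r2 : 0 < r ^+ 2 by rewrite exprn_gt0.
have diff0 : 0 < normc (F z0) ^+ 2 - M ^+ 2 by nra.
have e0 : 0 < e by rewrite divr_gt0// mulr_gt0.
have er : e * r ^+ 2 < normc (F z0) ^+ 2 - M ^+ 2.
  have -> : e * r ^+ 2 = (normc (F z0) ^+ 2 - M ^+ 2) / 2.
    by rewrite /e; field; rewrite gt_eqF.
  by rewrite ltr_pdivrMr// ltr_pMr// ltr1n.
have [|c cr cmax] := @disk_EVT _ (fun z => normc (F z) ^+ 2 + e * normc z ^+ 2) r (ltW r0).
  move=> z zr e1 e10; have e12 : 0 < e1 / 2 by rewrite divr_gt0.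
  have [d d0 H] := peano_sqr_continuous (pF z zr) e12.
  have e13 : 0 < e1 / 2 / e by rewrite divr_gt0.
  have [d' d'0 H'] := peano_sqr_continuous (peano_id z) e13.
  exists (Num.min d d'); first by rewrite lt_min d0.
  move=> w; rewrite lt_min => /andP[/H h1 /H' h2].
  rewrite opprD addrACA -mulrBr (le_lt_trans (ler_normD _ _))// normrM (gtr0_norm e0).
  by rewrite (splitr e1) ltrD// mulrC -ltr_pdivlMr.
have [cr'|cr'] := eqVneq (normc c) r.
  have := cmax z0 z0r; have := bF c cr'; rewrite cr' => h1.
  have h2 := normc_ge0 (F c).
  have h3 : 0 <= e * normc z0 ^+ 2 by rewrite mulr_ge0 ?sqr_ge0// ltW.
  have : normc (F c) ^+ 2 <= M ^+ 2 by rewrite lerXn2r ?nnegrE.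
  by nra.
have cr_lt : 0 < r - normc c by rewrite subr_gt0 lt_neqAle cr'.
have [h hr] := no_local_max e0 cr_lt (pF c cr).
rewrite ltNge => /negP; apply; apply: cmax.
by rewrite (le_trans (normcD _ _))//; lra.
Qed.

Lemma peano_disk_bounded F r : 0 <= r -> (forall z, normc z <= r -> peano F z) ->
  exists2 M, 0 <= M & forall z, normc z <= r -> normc (F z) <= M.
Proof.
move=> r0 pF; have [|c cr cmax] := @disk_EVT _ (fun z => normc (F z) ^+ 2) r r0.
  by move=> z zr e e0; exact: (peano_sqr_continuous (pF z zr) e0).
exists (normc (F c)); first exact: normc_ge0.
move=> z /cmax; rewrite ler_pXn2r// nnegrE; exact: normc_ge0.
Qed.

(** Induction on k: F(z)/z is again analytic, and the maximum principle on circles of radius s < r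
    bounds it by M/s; let s tend to r. *)
Lemma schwarz F (k : nat) r M : 0 < r -> (forall z, normc z < r -> peano F z) ->
  (forall z, normc z < r -> normc (F z) <= M) -> bigO k F ->
  forall z, normc z < r -> normc (F z) <= M * (normc z / r) ^+ k.
Proof.
move=> r0; elim: k F M => [|k IH] F M pF bF OF z zr; first by rewrite expr0 mulr1 bF.
have nr0 : normc (0 : C) < r by rewrite normc0.
have F0 := bigO_at0 OF.
pose G := dquot F 0.
have GE w : w * G w = F w by have := dquotE F 0 w; rewrite subr0 F0 subr0.
have pG w : normc w < r -> peano G w by move=> wr; apply: peano_dquot; exact: pF.
have bG w : normc w < r -> normc (G w) <= M / r.
  move=> wr; rewrite ler_pdivlMr//.
  apply/ler_addgt0Pr => e e0.
  set N := normc (G w); have N0 : 0 <= N := normc_ge0 _.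
  (* A circle around w so close to radius r that N s <= M implies N r <= M + e. *)
  pose s := Num.max (normc w) (r - Num.min (r / 2) (e / (N + 1))).
  have m0 : 0 < Num.min (r / 2) (e / (N + 1)) by rewrite lt_min !divr_gt0// ltr_wpDl.
  have m1 : Num.min (r / 2) (e / (N + 1)) <= r / 2 by rewrite ge_min lexx.
  have m2 : Num.min (r / 2) (e / (N + 1)) * (N + 1) <= e.
    by rewrite -ler_pdivlMr ?ltr_wpDl// ge_min lexx orbT.
  have sr : s < r by rewrite gt_max wr; lra.
  have s1 : r - Num.min (r / 2) (e / (N + 1)) <= s by rewrite le_max lexx orbT.
  have s0 : 0 < s by lra.
  have ws : normc w <= s by rewrite le_max lexx.
  have : N <= M / s.
    apply: (max_modulus s0) (ws) => u us.
      by apply: pG; exact: le_lt_trans sr.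
    rewrite ler_pdivlMr// mulrC -us -normcM GE; apply: bF; by rewrite us.
  rewrite ler_pdivlMr//; nra.
have OG : bigO k G.
  move/bigO_pos: (OF) => [K [d [K0 d0 d1 H]]].
  exists (Num.max K (normc (G 0))), d; split=> // h hd.
  have [->|h0] := eqVneq h 0.
    case: k {IH} OF H => [|k] OF H; first by rewrite expr0 mulr1 le_max lexx orbT.
    have [|_] := @bigO_derive _ F 0 0.
      by apply: bigO_ext (bigO_le (isT : (2 <= k.+2)%N) OF) => x; rewrite F0 add0r mul0r !subr0.
    by rewrite /G /dquot eqxx => ->; rewrite normc0 expr0n mulr0.
  have nh0 : 0 < normc h by rewrite normc_gt0.
  rewrite -(ler_pM2l nh0) -normcM GE (le_trans (H h hd))// exprS mulrCA ler_pM2l//.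
  by rewrite ler_wpM2r ?exprn_ge0 ?normc_ge0// le_max lexx.
have := IH G (M / r) pG bG OG z zr.
rewrite -GE normcM => H; rewrite exprS.
rewrite (le_trans (ler_wpM2l (normc_ge0 z) H))// le_eqVlt; apply/orP; left; apply/eqP.
by field; rewrite gt_eqF.
Qed.

(** A difference vanishing near 0 is O(h^k) for every k, so Schwarz' lemma bounds it by M q^k with a
    fixed q < 1. *)
Lemma identity_theorem F G r d : 0 < d -> (forall z, normc z < r -> peano F z) ->
  (forall z, normc z < r -> peano G z) -> (forall z, normc z < d -> F z = G z) ->
  forall z, normc z < r -> F z = G z.
Proof.
move=> d0 pF pG FG z zr; apply/eqP; rewrite -subr_eq0 -normc_eq0 eq_le normc_ge0 andbT.
have z0 := normc_ge0 z.
pose s := (normc z + r) / 2.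
have sr : s < r by rewrite /s; lra.
have zs : normc z < s by rewrite /s; lra.
have s0 : 0 < s by rewrite (le_lt_trans z0).
pose H w := F w - G w.
have pH w : normc w <= s -> peano H w.
  by move=> ws; apply: peanoB; [apply: pF|apply: pG]; exact: le_lt_trans sr.
have [M M0 bH] := peano_disk_bounded (ltW s0) pH.
have q1 : 0 <= normc z / s < 1 by rewrite divr_ge0 ?(ltW s0)//= ltr_pdivrMr// mul1r.
apply/ler_addgt0Pr => e e0; rewrite add0r.
have [k Mk] := geometric_small q1 e0 M0.
apply: le_trans (ltW Mk).
apply: (@schwarz H k s M) => //.
- by move=> w /ltW; exact: pH.
- by move=> w /ltW; exact: bH.
exists 0, d; split=> // h hd; rewrite /H FG// subrr normc0 mul0r; exact: lexx.
Qed.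

(** On the circle |w| = 3r/4 one has |w - y| >= r/4, so the difference quotient at y is at most
    2M/(r/4) there; the maximum principle carries this bound to x. *)
Lemma lipschitz_half F r M : 0 < r -> (forall z, normc z < r -> peano F z) ->
  (forall z, normc z < r -> normc (F z) <= M) ->
  forall x y, normc x <= r / 2 -> normc y <= r / 2 ->
  normc (F x - F y) <= 8 * M / r * normc (x - y).
Proof.
move=> r0 pF bF x y xr yr.
have r34 : 0 < 3 / 4 * r by lra.
have x34 : normc x <= 3 / 4 * r by lra.
rewrite -dquotE normcM mulrC ler_wpM2r ?normc_ge0//.
apply: (max_modulus r34) (x34) => w wr.
  by apply: peano_dquot; apply: pF; lra.
have h := normcB_ge w y.
have wy : r / 4 <= normc (w - y) by lra.
have wy0 : 0 < normc (w - y) by lra.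
have wr' : normc w < r by lra.
have yr' : normc y < r by lra.
have := normcB (F w) (F y); have := bF w wr'; have := bF y yr'.
have M0 : 0 <= M by exact: le_trans (normc_ge0 _) (bF y yr').
move=> h1 h2 h3; rewrite -(ler_pM2l wy0) -normcM dquotE.
have h4 : 8 * M / r * (r / 4) = 2 * M by field; rewrite gt_eqF.
have : 8 * M / r * (r / 4) <= 8 * M / r * normc (w - y).
  by rewrite ler_wpM2l// divr_ge0 ?mulr_ge0// ltW.
lra.
Qed.

End maximum_principle.

(** * Local inverses *)

Section local_inverse.
Variable R : realType.
Local Notation C := R[i].
Implicit Types (F G f g : C -> C) (z w a x : C) (r e M : R).

(** A factor f = O(h) makes up for the order missing in g; this gain drives the bootstrap in
    [peano_inverse]. *)
Lemma jetM_small n f g : bigO 1 f -> jet n.+1 f -> jet n g ->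
  jet n.+1 (fun h => f h * g h).
Proof.
move=> Of [p Hp] jg; have Bg := jet_bounded jg; case: jg => q Hq; exists (p * q).
have H := bigOM Hp (bigO_poly q); rewrite addn0 in H.
by apply: bigO_ext (bigOD (bigOM Of Hq) H) => h; rewrite hornerM; ring.
Qed.

Lemma jetM_small2 n f g : bigO 1 f -> jet n.+1 f -> bigO 1 g -> jet n.+1 g ->
  jet n.+2 (fun h => f h * g h).
Proof.
move=> Of [p Hp] Og [q Hq]; exists (p * q).
have Oq : bigO 1 (fun h => q.[h]).
  by apply: bigO_ext (bigOB Og (bigO_le (isT : (1 <= n.+1)%N) Hq)) => h; ring.
have H := bigOM Hp Oq; rewrite addn1 in H.
by apply: bigO_ext (bigOD (bigOM Of Hq) H) => h; rewrite hornerM; ring.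
Qed.

(** Bootstrap: the increment h of G satisfies h = (k - h^2 s(h)) / b + O(k^(n+2)) with b = F'(G w).
    As h = O(k), the term h^2 s(h) is known to one order more than h, so each round gains an order,
    starting from the Lipschitz bound. *)
Lemma peano_inverse F G w r K : 0 < r -> peano F (G w) -> F (G w) = w ->
  (forall k, normc k < r -> F (G (w + k)) = w + k) ->
  (forall k, normc k < r -> normc (G (w + k) - G w) <= K * normc k) ->
  derive1 F (G w) != 0 -> peano G w.
Proof.
move=> r0 pF FGw FG LG b0; set x := G w; set b := derive1 F x in b0.
pose h k := G (w + k) - x.
have Oh : bigO 1 h by exists K, r; split=> // k /LG; rewrite expr1.
have jh n : jet n.+1 h.
  elim: n => [|n IH]; first by exists 0; apply: bigO_ext Oh => k; rewrite horner0 subr0.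
  have [p H] := pF n.+2; have [Fx _ db] := jet_derive H.
  set s := (p %/ 'X) %/ 'X.
  have pE k : p.[k] = (s.[k] * k + b) * k + w.
    have E : p = (s * 'X + b%:P) * 'X + w%:P.
      by rewrite /b db -poly_divX -FGw Fx -poly_divX.
    by rewrite {1}E !(hornerD, hornerMX, hornerC).
  have H1 := bigO_comp H Oh.
  have H2 : bigO n.+2 (fun k => w + k - ((s.[h k] * h k + b) * h k + w)).
    by apply: bigO_eq r0 _ H1 => k /FG E; rewrite /h subrKC E -/(h k) pE.
  have jhh : jet n.+2 (fun k => h k * h k * s.[h k]).
    apply: jetM_small; [exact: (bigO_le (isT : (1 <= 1 + 1)%N) (bigOM Oh Oh))| |].
      exact: jetM_small2.
    exact: jet_hornerc.
  apply: (@jet_bigO _ _ _ (fun k => b^-1 * (k - h k * h k * s.[h k]))).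
    apply: bigO_ext (bigOMl (- b^-1) H2) => k; field; exact: b0.
  apply: jetM (jet_cst _ _) (jetD (jet_id _ _) _).
  apply: (@jet_eq _ _ (fun k => -1 * (h k * h k * s.[h k])) _ 1) => //.
    by move=> k _; rewrite mulN1r.
  exact: jetM (jet_cst _ _) jhh.
move=> n; apply: (@jet_eq _ _ (fun k => h k + x) _ 1) => //.
  by move=> k _; rewrite /h subrK.
exact: jetD (jet_le (leqnSn n) (jh n)) (jet_cst _ _).
Qed.

Lemma derive1_bigO F a c : bigO 2 (fun h => F (a + h) - F a - c * h) -> derive1 F a = c.
Proof. by case/bigO_derive. Qed.

Lemma derive1_lower_bound F a r K : 0 < r -> 0 < K -> peano F a ->
  (forall h, normc h < r -> K * normc h <= normc (F (a + h) - F a)) ->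
  derive1 F a != 0.
Proof.
move=> r0 K0 /peano_bigO2 H LF; apply/eqP => d0; move: H; rewrite d0.
move=> /bigO_pos[M [d [M0 d0' _ H]]].
pose t := Num.min (Num.min r d) (K / M) / 2.
have KM0 : 0 < K / M by rewrite divr_gt0.
have m0 : 0 < Num.min (Num.min r d) (K / M) by rewrite !lt_min r0 d0' KM0.
have t0 : 0 < t by rewrite divr_gt0.
have tm : t < Num.min (Num.min r d) (K / M) by rewrite /t; lra.
move: tm; rewrite !lt_min => /andP[/andP[tr td]]; rewrite ltr_pdivlMr// => tK.
have nt : normc (t%:C : C) = t by rewrite normcR ger0_norm// ltW.
have := H t%:C; have := LF t%:C; rewrite nt mul0r subr0 => /(_ tr) h1 /(_ td) h2.
have := le_trans h1 h2; rewrite expr2; nra.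
Qed.

(* Injectivity comes from the Lipschitz bound for [F z - F'(0) z]; a value [w]
   missed by [F] would make [1 / (F z - w)] violate the maximum principle. *)
Lemma local_inverse F r0 : 0 < r0 -> (forall z, normc z < r0 -> peano F z) ->
  F 0 = 0 -> derive1 F 0 != 0 ->
  exists r e G, [/\ 0 < r <= r0, 0 < e, G 0 = 0,
    forall w, normc w < e -> [/\ normc (G w) < r, F (G w) = w & peano G w] &
    (forall z, normc z < r -> normc (F z) < e -> G (F z) = z) /\
    (forall z, normc z < r -> derive1 F z != 0)].
Proof.
move=> r00 pF F0 a0; set a := derive1 F 0 in a0.
have na0 : 0 < normc a by rewrite normc_gt0.
have pF0 : peano F 0 by apply: pF; rewrite normc0.
have := peano_bigO2 pF0; rewrite -/a F0.
move=> /bigO_pos[K [d [K0 d0 _ H]]].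
pose g z := F z - a * z.
(* On |z| < 2 r the remainder g is at most 4 K r^2, hence Lipschitz on |z| <= r with constant 16 K r
   <= |a| / 2, half the slope of the linear part. *)
pose r := Num.min (Num.min r0 d / 4) (normc a / (32 * K)).
have aK0 : 0 < normc a / (32 * K) by rewrite divr_gt0// mulr_gt0.
have r_gt0 : 0 < r by rewrite lt_min aK0 andbT divr_gt0// lt_min r00.
have r1 : r <= r0 / 4.
  have : r <= Num.min r0 d / 4 by rewrite ge_min lexx.
  have : Num.min r0 d <= r0 by rewrite ge_min lexx.
  lra.
have r2 : r <= d / 4.
  have : r <= Num.min r0 d / 4 by rewrite ge_min lexx.
  have : Num.min r0 d <= d by rewrite ge_min lexx orbT.
  lra.
have r3 : r * (32 * K) <= normc a.
  by rewrite -ler_pdivlMr ?mulr_gt0// ge_min lexx orbT.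
have pg z : normc z < 2 * r -> peano g z.
  move=> zr; apply: peanoB; first by apply: pF; lra.
  by apply: peanoM; [exact: peano_cst|exact: peano_id].
have bg z : normc z < 2 * r -> normc (g z) <= 4 * K * r ^+ 2.
  move=> zr; have zd : normc z < d by lra.
  have := H z zd; rewrite add0r subr0 => /le_trans; apply.
  have z2 : normc z ^+ 2 <= (2 * r) ^+ 2.
    by rewrite lerXn2r ?nnegrE ?normc_ge0 ?(ltW zr)// mulr_ge0// ltW.
  rewrite (le_trans (ler_wpM2l (ltW K0) z2))// le_eqVlt; apply/orP; left.
  by apply/eqP; ring.
have r20 : 0 < 2 * r by lra.
have Fg z : F z = a * z + g z by rewrite /g subrKC.
have lowF x y : normc x <= r -> normc y <= r ->
    normc a / 2 * normc (x - y) <= normc (F x - F y).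
  move=> xr yr; have := lipschitz_half r20 pg bg (x := x) (y := y).
  have -> : 2 * r / 2 = r by lra.
  have -> : 8 * (4 * K * r ^+ 2) / (2 * r) = 16 * K * r by field; rewrite gt_eqF.
  move=> /(_ xr yr) gxy; have xy0 := normc_ge0 (x - y).
  have -> : F x - F y = a * (x - y) + (g x - g y) by rewrite !Fg; ring.
  have := normcD_ge (a * (x - y)) (g x - g y); rewrite normcM; nra.
have nr0 : normc (0 : C) <= r by rewrite normc0 ltW.
(* On |z| = r one has |F| >= |a| r / 2 = 4 e, so 1/(F - w) is at most 1/(3 e) there, but larger than
   1/e at 0. *)
pose e := normc a * r / 8.
have e0 : 0 < e by rewrite divr_gt0// mulr_gt0.
have surjF w : normc w < e -> exists x, normc x < r /\ F x = w.
  move=> we; have [w0|w0] := eqVneq w 0; first by exists 0; rewrite normc0 F0 w0.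
  apply: contrapT => nex.
  have nF x : normc x <= r -> F x - w != 0.
    move=> xr; apply/eqP => /eqP; rewrite subr_eq0 => /eqP Fx; apply: nex.
    exists x; split=> //; have := lowF x 0 xr nr0; rewrite subr0 F0 subr0 Fx => h.
    rewrite ltNge; apply/negP => rx; move: we; rewrite /e; nra.
  pose u z := (F z - w)^-1.
  have pu z : normc z <= r -> peano u z.
    move=> zr; apply: peanoV; first exact: nF.
    by apply: peanoB; [apply: pF; lra|exact: peano_cst].
  have bu z : normc z = r -> normc (u z) <= (3 * e)^-1.
    move=> zr; rewrite normcV lef_pV2 ?posrE ?mulr_gt0//; last first.
      by rewrite normc_gt0 nF// zr.
    have := lowF z 0; rewrite zr subr0 F0 subr0 => /(_ (lexx _) nr0).
    have := normcB_ge (F z) w; rewrite zr /e in we *; lra.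
  have := max_modulus r_gt0 pu bu nr0.
  rewrite /u F0 sub0r normcV normc_opp lef_pV2 ?posrE ?mulr_gt0 ?normc_gt0//.
  by lra.
have /choice[G GP] : forall w, exists x, normc w < e -> normc x < r /\ F x = w.
  move=> w; have [/surjF[x xP]|_] := ltP (normc w) e; first by exists x.
  by exists 0.
have G0 : G 0 = 0.
  have [|Gr FG0] := GP 0; first by rewrite normc0.
  have := lowF (G 0) 0 (ltW Gr) nr0; rewrite FG0 F0 !subr0 normc0 => h.
  apply/eqP; rewrite -normc_eq0 eq_le normc_ge0 andbT; nra.
have derF z : normc z < r -> derive1 F z != 0.
  move=> zr; apply: (@derive1_lower_bound _ _ (r - normc z) (normc a / 2)).
  - by rewrite subr_gt0.
  - by rewrite divr_gt0.
  - by apply: pF; lra.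
  move=> h hr; have := lowF (z + h) z; rewrite (addrC z h) addrK; apply.
    by have := normcD h z; lra.
  exact: ltW.
exists r, e, G; split=> //.
- by rewrite r_gt0; lra.
- move=> w we; have [Gr FG] := GP w we; split=> //.
  have ew0 : 0 < e - normc w by rewrite subr_gt0.
  have wk k : normc k < e - normc w -> normc (w + k) < e.
    by have := normcD w k; lra.
  have FGk k : normc k < e - normc w -> F (G (w + k)) = w + k by move=> /wk /GP[].
  have LGk k : normc k < e - normc w -> normc (G (w + k) - G w) <= 2 / normc a * normc k.
    move=> /wk /GP[Gr' FG'].
    have := lowF _ _ (ltW Gr') (ltW Gr); rewrite FG' FG (addrC w k) addrK => h.
    rewrite mulrAC ler_pdivlMr//; lra.
  have pFG : peano F (G w) by apply: pF; lra.
  exact: (peano_inverse ew0 pFG FG FGk LGk (derF _ Gr)).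
split=> // z zr Fze; have [Gr FG] := GP _ Fze.
have := lowF _ _ (ltW Gr) (ltW zr); rewrite FG subrr normc0 => h.
apply/eqP; rewrite -subr_eq0 -normc_eq0 eq_le normc_ge0 andbT; nra.
Qed.

End local_inverse.

(** * Means over roots of unity *)

Section discrete_mean_value.
Variable R : realType.
Local Notation C := R[i].
Implicit Types (F G f g : C -> C) (z w a x : C) (r e K : R).

Definition root_unity (M j : nat) : C := cis (pi *+ 2 * j%:R / M%:R).

Lemma normc_root_unity M j : normc (root_unity M j) = 1.
Proof. exact: normc_cis. Qed.

Lemma sum_root_unity M k : (0 < k < M)%N -> \sum_(j < M) root_unity M j ^+ k = 0.
Proof.
move=> /andP[k0 kM].
have M0 : (0 < M%:R :> R) by rewrite ltr0n (leq_trans _ kM).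
pose q : C := cis (pi *+ 2 * k%:R / M%:R).
have qj j : root_unity M j ^+ k = q ^+ j.
  by rewrite /q -!cisMn; congr cis; ring.
rewrite (eq_bigr (fun j : 'I_M => q ^+ j)); last by move=> j _; exact: qj.
have q1 : q != 1.
  have pi2 : 0 < pi *+ 2 :> R by rewrite pmulrn_lgt0// pi_gt0.
  apply: cis_neq1; apply/andP; split.
    by apply: divr_gt0 => //; apply: mulr_gt0; rewrite ?ltr0n.
  by rewrite ltr_pdivrMr// ltr_pM2l ?ltr_nat.
have q10 : q - 1 != 0 by rewrite subr_eq0; exact: q1.
apply: (mulfI q10); rewrite -subrX1 mulr0 -cisMn.
have -> : M%:R * (pi *+ 2 * k%:R / M%:R) = k%:R * (pi *+ 2) :> R.
  by field; rewrite gt_eqF.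
by rewrite cisMn cis_2pi expr1n subrr.
Qed.

(** The mean kills monomials of degree strictly between 0 and M, and those of degree at least M are
    O(h^M). The extra exponent k carries the induction, which strips factors X off p. *)
Lemma bigO_mean_poly (p : {poly C}) M k :
  bigO M (fun h => \sum_(j < M) p.[h * root_unity M j] * (h * root_unity M j) ^+ k
                   - if k == 0 then M%:R * p.[0] else 0).
Proof.
elim/poly_ind: p k => [|p c IH] k.
  apply: bigO_ext (bigO0 R M) => h; rewrite big1 ?horner0 ?mulr0 ?if_same ?subr0// => j _.
  by rewrite horner0 mul0r.
have Hc : bigO M (fun h => c * (\sum_(j < M) (h * root_unity M j) ^+ k)
                   - if k == 0 then M%:R * c else 0).
  have E h : \sum_(j < M) (h * root_unity M j) ^+ k = h ^+ k * \sum_(j < M) root_unity M j ^+ k.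
    by rewrite mulr_sumr; apply: eq_bigr => j _; rewrite exprMn.
  have [k0|k0] := posnP k.
    apply: bigO_ext (bigO0 R M) => h; rewrite k0 /=.
    under eq_bigr do rewrite expr0.
    by rewrite sumr_const card_ord -[1 *+ _]/(M%:R); ring.
  have [kM|Mk] := ltnP k M.
    by apply: bigO_ext (bigO0 R M) => h; rewrite E sum_root_unity ?k0// !mulr0 subrr.
  apply: (bigO_le Mk).
  have Xk : bigO k (fun h : C => h ^+ k).
    by exists 1, 1; split=> // h _; rewrite mul1r normcX.
  apply: bigO_ext (bigOMl (c * \sum_(j < M) root_unity M j ^+ k) Xk) => h.
  by rewrite E subr0; ring.
apply: bigO_ext (bigOD (IH k.+1) Hc) => h.
rewrite /= subr0 addrA; congr (_ - _); last first.
  by rewrite hornerMXaddC mulr0 add0r.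
rewrite mulr_sumr -big_split /=; apply: eq_bigr => j _.
by rewrite hornerMXaddC exprS; ring.
Qed.

(** Dilate the roots of unity by z: the error is then an analytic function of z, bounded by 2 K and
    O(z^M), and Schwarz' lemma at z = 1 gives the factor r^(-M). The rate depends on g through K and
    r only. *)
Lemma discrete_mean_value g r K M : (0 < M)%N -> 1 < r ->
  (forall w, normc w < r -> peano g w) -> (forall w, normc w < r -> normc (g w) <= K) ->
  normc (M%:R^-1 * (\sum_(j < M) g (root_unity M j)) - g 0) <= 2 * K * r^-1 ^+ M.
Proof.
move=> M0 r1 pg bg; have r0 : 0 < r by lra.
have MC0 : (M%:R : C) != 0 by rewrite pnatr_eq0 -lt0n.
pose F z := M%:R^-1 * (\sum_(j < M) g (z * root_unity M j)) - g 0.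
have zr z j : normc z < r -> normc (z * root_unity M j) < r.
  by rewrite normcM normc_root_unity mulr1.
have g0r : normc (0 : C) < r by rewrite normc0.
have K0 : 0 <= K by exact: le_trans (normc_ge0 _) (bg 0 g0r).
have pF z : normc z < r -> peano F z.
  move=> zr'; apply: peanoB; last exact: peano_cst.
  apply: peanoM; first exact: peano_cst.
  apply: peano_sum => j; apply: (@peano_comp _ g (fun z => z * root_unity M j)).
    exact/pg/zr.
  by apply: peanoM; [exact: peano_id|exact: peano_cst].
have bF z : normc z < r -> normc (F z) <= 2 * K.
  move=> zr'; rewrite (le_trans (normcB _ _))// mulr2n mulrDl !mul1r lerD ?bg//.
  rewrite normcM normcV normc_nat ler_pdivrMl ?ltr0n//.
  rewrite (le_trans (normc_sum _ _ _))//.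
  rewrite (le_trans (ler_sum _ (fun (j : 'I_M) _ => bg _ (zr z j zr'))))//.
  by rewrite sumr_const card_ord mulr_natl.
have OF : bigO M F.
  have [p H] := pg 0 g0r M.
  have p0 : g 0 = p.[0].
    have [m ME] : exists m, M = m.+1 by case: M M0 {MC0 F zr pF bF H} => // m _; exists m.
    have := H; rewrite ME => /bigO_at0; rewrite add0r => /eqP.
    by rewrite subr_eq0 => /eqP.
  have Hs : bigO M (fun h => \sum_(j < M) (g (h * root_unity M j) - p.[h * root_unity M j])).
    elim: (index_enum 'I_M) => [|j s IH].
      by apply: bigO_ext (bigO0 R M) => h; rewrite big_nil.
    have Oh : bigO 1 (fun h => h * root_unity M j).
      by apply: bigO_ext (bigOMl (root_unity M j) (bigO_id R)) => h; rewrite mulrC.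
    by apply: bigO_ext (bigOD (bigO_comp H Oh) IH) => h; rewrite big_cons add0r.
  apply: bigO_ext (bigOMl M%:R^-1 (bigOD Hs (bigO_mean_poly p M 0))) => h.
  rewrite /= /F p0 sumrB.
  have -> : \sum_(j < M) p.[h * root_unity M j] * (h * root_unity M j) ^+ 0 =
      \sum_(j < M) p.[h * root_unity M j].
    by apply: eq_bigr => j _; rewrite expr0 mulr1.
  by rewrite addrA subrK mulrBr mulrA mulVf ?mul1r.
have := schwarz r0 pF bF OF (z := 1); rewrite normc_1 => /(_ r1).
rewrite div1r /F.
by under eq_bigr do rewrite mul1r.
Qed.

End discrete_mean_value.

(** * Positive functionals on the circle and Herglotz' theorem *)

Section circle_topology.
Variable R : realType.
Local Notation C := R[i].
Local Notation T := (circle R).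
Implicit Types (x y : T) (f g : T -> R) (u v : T -> C) (z : C).

Lemma normc_circle x : normc (x : C) = 1.
Proof.
have : `|(x : C)| = 1 by case: x => z zP; exact: (set_mem zP).
by rewrite normcE_abs => /complexI.
Qed.

Lemma circle_val_inj : injective (@circle_val R).
Proof. exact: val_inj. Qed.

Lemma mem_circle t : (cis t : C) \in [set z : R[i] | `|z| = 1].
Proof. by apply/mem_set; rewrite /= normcE_abs normc_cis. Qed.

Definition circ (t : R) : T := exist _ (cis t) (mem_circle t).

Lemma circE t : circ t = cis t :> C. Proof. by []. Qed.

Lemma circP x : exists2 t, - pi <= t <= pi & x = circ t.
Proof.
have [t tp E] := unit_circleP (normc_circle x); exists t => //.
exact: circle_val_inj.
Qed.

Lemma circle_val_continuous : continuous (@circle_val R).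
Proof. exact: (@initial_continuous T C (@circle_val R)). Qed.

Lemma circ_continuous : continuous circ.
Proof.
apply: (@continuous_comp_initial T R C (@circle_val R)).
exact: continuous_cis.
Qed.

Lemma circle_compact : compact [set: T].
Proof.
have -> : [set: T] = circ @` `[- pi, pi].
  by apply/seteqP; split=> // x _; have [t tp ->] := circP x; exists t => //=; rewrite in_itv.
apply: continuous_compact; last exact: segment_compact.
by apply: continuous_subspaceT; exact: circ_continuous.
Qed.

Lemma nbhs_circle x (e : R) : 0 < e -> nbhs x [set y : T | normc ((y : C) - (x : C)) < e].
Proof.
move=> e0; apply: (@circle_val_continuous x [set z : C | normc (z - (x : C)) < e]).
by apply/nbhsCP; exists e.
Qed.

Lemma nbhs_circle_ball x (A : set T) : nbhs x A ->
  exists2 d : R, 0 < d & forall y : T, normc ((y : C) - (x : C)) < d -> A y.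
Proof.
case=> B [[V oV VE]] /= Bx BA.
have : nbhs (circle_val x) V by apply: open_nbhs_nbhs; split=> //; move: Bx; rewrite -VE.
by move=> /nbhsCP[d d0 dV]; exists d => // y yx; apply: BA; rewrite -VE; exact: dV.
Qed.

Lemma continuous_circleP f : continuous f -> forall e : R, 0 < e -> exists2 d : R, 0 < d &
  forall x y : T, normc ((y : C) - (x : C)) < d -> `|f y - f x| < e.
Proof.
move=> cf e e0; pose P (d : R) (x : T) := forall y : T, normc ((y : C) - (x : C)) < d -> `|f y - f x| < e.
have loc (x : T) : \forall x' \near x & d \near 0^'+, P d x'.
  have e2 : 0 < e / 2 by rewrite divr_gt0.
  have : nbhs x [set y | `|f y - f x| < e / 2].
    have /cvgrPdist_lt/(_ _ e2) := cf x; apply: filterS => y /=.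
    by rewrite distrC.
  move=> /nbhs_circle_ball[d d0 near_f].
  exists ([set y : T | normc ((y : C) - (x : C)) < d / 2], [set s | s < d / 2]).
    split; first by apply: nbhs_circle; rewrite divr_gt0.
    by apply: nbhs_right_lt; rewrite divr_gt0.
  move=> [y s] /= [yx sd] w wy.
  have -> : f w - f y = (f w - f x) - (f y - f x) by ring.
  rewrite (le_lt_trans (ler_normB _ _))// (splitr e) ltrD// near_f//; last by lra.
  have -> : (w : C) - (x : C) = ((w : C) - (y : C)) + ((y : C) - (x : C)) by ring.
  by rewrite (le_lt_trans (normcD _ _))//; lra.
have /compact_near_coveringP/(_ R 0^'+ P _ (fun x _ => loc x)) near_all := circle_compact.
have [d d0 dP] : exists2 d : R, 0 < d & forall x y : T, normc ((y : C) - (x : C)) < d -> `|f y - f x| < e.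
  near (0 : R)^'+ => d; exists d => // x y.
  by have : setT `<=` P d; [near: d | move=> /(_ x I); exact].
by exists d.
Unshelve. all: by end_near. Qed.

Lemma continuous_circle_bounded f : continuous f ->
  exists2 M, 0 <= M & forall x, `|f x| <= M.
Proof.
move=> cf; have cn : continuous (fun x => `|f x|).
  by move=> x; exact: (cvg_norm (cf x)).
have [|||c _ H] := @compact_EVT_max _ R (fun x => `|f x|) [set: T].
- by exists (circle1 R).
- exact: circle_compact.
- exact: continuous_subspaceT.
by exists `|f c| => // x; apply: H; rewrite inE.
Qed.

Lemma continuous_Rec u : continuous u -> continuous (fun x => complex.Re (u x)).
Proof. by move=> cu x; exact: (cvg_Re _ (cu x)). Qed.
Lemma continuous_Imc u : continuous u -> continuous (fun x => complex.Im (u x)).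
Proof. by move=> cu x; exact: (cvg_Im _ (cu x)). Qed.

Lemma continuous_cstc (c : C) : continuous (fun _ : T => c).
Proof. exact: cst_continuous. Qed.

Lemma continuousDc u v : continuous u -> continuous v -> continuous (fun x => u x + v x).
Proof. by move=> cu cv x; exact: (cvgD (cu x) (cv x)). Qed.

Lemma continuousMc u v : continuous u -> continuous v -> continuous (fun x => u x * v x).
Proof. by move=> cu cv x; exact: (cvgM (cu x) (cv x)). Qed.

Lemma continuousNc u : continuous u -> continuous (fun x => - u x).
Proof. by move=> cu x; exact: (cvgN (cu x)). Qed.

Lemma continuousVc u : continuous u -> (forall x, u x != 0) -> continuous (fun x => (u x)^-1).
Proof. by move=> cu u0 x; exact: (cvgV (u0 x) (cu x)). Qed.

Lemma one_sub_circle_neq0 z x : normc z < 1 -> 1 - (x : C) * z != 0.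
Proof.
move=> z1; apply/eqP => /eqP; rewrite subr_eq0 => /eqP/(congr1 (@normc R)).
by rewrite normc_1 normcM normc_circle mul1r => E; move: z1; rewrite -E ltxx.
Qed.

Lemma continuous_cauchy_kernel u z : continuous u -> normc z < 1 ->
  continuous (fun x => u x / (1 - (x : C) * z)).
Proof.
move=> cu z1.
have cxz := continuousMc circle_val_continuous (@continuous_cstc z).
have cd := continuousDc (@continuous_cstc 1) (continuousNc cxz).
exact: (continuousMc cu (continuousVc cd (fun x => one_sub_circle_neq0 x z1))).
Qed.

End circle_topology.

(** * Positive functionals, Cauchy and Herglotz transforms *)

Section positive_functionals.
Variable R : realType.
Local Notation C := R[i].
Local Notation T := (circle R).
Implicit Types (x y : T) (f g : T -> R) (u v : T -> C) (z c : C).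
Implicit Types (I J : (T -> R) -> R).

(** Values at discontinuous functions are left free, so that integrals and ultralimits both
    qualify. *)
Definition pos_functional I := [/\
  forall f g, continuous f -> continuous g -> I (fun x => f x + g x) = I f + I g,
  forall a f, continuous f -> I (fun x => a * f x) = a * I f &
  forall f, continuous f -> (forall x, 0 <= f x) -> 0 <= I f].

Definition cfun I u : C := I (fun x => complex.Re (u x)) +i* I (fun x => complex.Im (u x)).

Variable I : (T -> R) -> R.
Hypothesis Ipos : pos_functional I.

Lemma functionalD f g : continuous f -> continuous g ->
  I (fun x => f x + g x) = I f + I g.
Proof. by case: Ipos => + _ _; exact. Qed.
Lemma functionalZ a f : continuous f -> I (fun x => a * f x) = a * I f.
Proof. by case: Ipos => _ + _; exact. Qed.
Lemma functional_ge0 f : continuous f -> (forall x, 0 <= f x) -> 0 <= I f.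
Proof. by case: Ipos => _ _; exact. Qed.

Lemma functional_cst a : I (fun=> a) = a * I (fun=> 1).
Proof.
rewrite -functionalZ; last exact: cst_continuous.
by congr I; apply/funext => x; rewrite mulr1.
Qed.

Lemma functionalN f : continuous f -> I (fun x => - f x) = - I f.
Proof.
by move=> cf; rewrite -mulN1r -(functionalZ _ cf); congr I; apply/funext => x; rewrite mulN1r.
Qed.

Lemma functionalB f g : continuous f -> continuous g ->
  I (fun x => f x - g x) = I f - I g.
Proof.
move=> cf cg; have cNg : continuous (fun x => - g x) by move=> x; exact: (cvgN (cg x)).
by rewrite -(functionalN cg) -(functionalD cf cNg).
Qed.

Lemma functional_mono f g : continuous f -> continuous g ->
  (forall x, f x <= g x) -> I f <= I g.
Proof.
move=> cf cg fg; rewrite -subr_ge0 -(functionalB cg cf); apply: functional_ge0.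
  by move=> x; exact: (cvgB (cg x) (cf x)).
by move=> x; rewrite subr_ge0.
Qed.

Lemma functional_mass_ge0 : 0 <= I (fun=> 1).
Proof. by apply: functional_ge0 => //; exact: cst_continuous. Qed.

Lemma functional_le_norm f M : continuous f -> (forall x, `|f x| <= M) ->
  `|I f| <= M * I (fun=> 1).
Proof.
move=> cf fM; have cM a : continuous (fun _ : T => a : R) by exact: cst_continuous.
rewrite -functional_cst ler_norml -(functionalN (cM M)); apply/andP; split.
  by apply: (functional_mono (cM (- M)) cf) => x; have := fM x; rewrite ler_norml => /andP[].
by apply: (functional_mono cf (cM M)) => x; have := fM x; rewrite ler_norml => /andP[].
Qed.

Lemma functional_sum (K : Type) (s : seq K) (F : K -> T -> R) :
  (forall k, continuous (F k)) ->
  I (fun x => \sum_(k <- s) F k x) = \sum_(k <- s) I (F k).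
Proof.
move=> cF; elim: s => [|k s IH].
  rewrite big_nil -[RHS](mul0r (I (fun=> 1))) -functional_cst.
  by congr I; apply/funext => x; rewrite big_nil.
have cs : continuous (fun x => \sum_(k <- s) F k x).
  elim: s {IH} => [|l s IH].
    rewrite (_ : (fun x => _) = fun=> 0); first exact: cst_continuous.
    by apply/funext => x; rewrite big_nil.
  rewrite (_ : (fun x => _) = (fun x => F l x + \sum_(k <- s) F k x)).
    by move=> x; exact: (cvgD (cF l x) (IH x)).
  by apply/funext => x; rewrite big_cons.
rewrite big_cons -IH -(functionalD (cF k) cs).
by congr I; apply/funext => x; rewrite big_cons.
Qed.

Lemma cfunD u v : continuous u -> continuous v ->
  cfun I (fun x => u x + v x) = cfun I u + cfun I v.
Proof.
move=> cu cv; rewrite /cfun.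
rewrite (_ : (fun x => complex.Re (u x + v x)) = fun x => complex.Re (u x) + complex.Re (v x)); last by apply/funext => x; rewrite ReD.
rewrite (_ : (fun x => complex.Im (u x + v x)) = fun x => complex.Im (u x) + complex.Im (v x)); last by apply/funext => x; rewrite ImD.
rewrite (functionalD (continuous_Rec cu) (continuous_Rec cv)).
by rewrite (functionalD (continuous_Imc cu) (continuous_Imc cv)).
Qed.

Lemma cfunZ c u : continuous u -> cfun I (fun x => c * u x) = c * cfun I u.
Proof.
move=> cu; rewrite /cfun; have cR := continuous_Rec cu; have cI := continuous_Imc cu.
have cZ a f : continuous f -> continuous (fun x : T => a * f x).
  by move=> cf x; exact: (cvgM (cvg_cst a) (cf x)).
rewrite (_ : (fun x => complex.Re (c * u x)) = fun x => complex.Re c * complex.Re (u x) - complex.Im c * complex.Im (u x)); last by apply/funext => x; rewrite ReM.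
rewrite (_ : (fun x => complex.Im (c * u x)) = fun x => complex.Re c * complex.Im (u x) + complex.Im c * complex.Re (u x)); last by apply/funext => x; rewrite ImM.
rewrite (functionalB (cZ _ _ cR) (cZ _ _ cI)) (functionalD (cZ _ _ cI) (cZ _ _ cR)).
rewrite !(functionalZ _ cR) !(functionalZ _ cI).
by case: c => a b; apply: eqcP.
Qed.

Lemma cfun_cst c : cfun I (fun=> c) = c * (I (fun=> 1))%:C.
Proof.
rewrite /cfun (functional_cst (complex.Re c)) (functional_cst (complex.Im c)); case: c => a b /=.
by apply: eqcP => /=; ring.
Qed.

Lemma cfunN u : continuous u -> cfun I (fun x => - u x) = - cfun I u.
Proof.
by move=> cu; rewrite -mulN1r -(cfunZ _ cu); congr cfun; apply/funext => x; rewrite mulN1r.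
Qed.

Lemma cfunB u v : continuous u -> continuous v ->
  cfun I (fun x => u x - v x) = cfun I u - cfun I v.
Proof.
by move=> cu cv; rewrite -(cfunN cv) -(cfunD cu (continuousNc cv)).
Qed.

(** The factor 2 comes from bounding real and imaginary parts separately. *)
Lemma cfun_le_norm u (M : R) : continuous u -> (forall x, normc (u x) <= M) ->
  normc (cfun I u) <= 2 * M * I (fun=> 1).
Proof.
move=> cu uM; rewrite (le_trans (normc_le_ReIm _))//= mulr2n !mulrDl mul1r.
apply: lerD; apply: functional_le_norm.
- exact: continuous_Rec.
- by move=> x; exact: le_trans (normc_Re _) (uM x).
- exact: continuous_Imc.
- by move=> x; exact: le_trans (normc_Im _) (uM x).
Qed.

Definition cauchyT u z := cfun I (fun x => u x / (1 - (x : C) * z)).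

Lemma cauchy_kernel_lb x z : 1 - normc z <= normc (1 - (x : C) * z).
Proof.
have := normcB_ge 1 ((x : C) * z); by rewrite normc_1 normcM normc_circle mul1r.
Qed.

(** Induction on the order for all u at once: the increment from z to z + h is h times the Cauchy
    transform at z + h of u x / (1 - x z), and the factor h gains an order. *)
Lemma peano_cauchyT u z : continuous u -> normc z < 1 -> peano (cauchyT u) z.
Proof.
move=> cu z1; have z10 : 0 < (1 - normc z) / 2 by lra.
have hz h : normc h < (1 - normc z) / 2 -> normc (z + h) < 1.
  by move=> hz; have := normcD z h; lra.
move=> n; elim: n u cu => [|n IH] u cu.
  exists 0; have [M M0 uM] := continuous_circle_bounded (continuous_Rec cu).
  have [M' M'0 uM'] := continuous_circle_bounded (continuous_Imc cu).
  exists (2 * ((M + M') / ((1 - normc z) / 2)) * I (fun=> 1)), ((1 - normc z) / 2).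
  split=> // h hh; rewrite horner0 subr0 expr0 mulr1.
  apply: (cfun_le_norm (continuous_cauchy_kernel cu (hz h hh))).
  move=> x; have lb := cauchy_kernel_lb x (z + h).
  have := normcD z h => H.
  have lb' : (1 - normc z) / 2 <= normc (1 - (x : C) * (z + h)) by lra.
  rewrite normc_div ler_pM ?normc_ge0 ?invr_ge0 ?normc_ge0//.
    by rewrite (le_trans (normc_le_ReIm _))// lerD.
  by rewrite lef_pV2 ?posrE// (lt_le_trans z10).
pose v x := u x * (x : C) / (1 - (x : C) * z).
have cv : continuous v.
  apply: continuous_cauchy_kernel z1; exact: (continuousMc cu (@circle_val_continuous R)).
apply: (@jet_eq _ _ (fun h => cauchyT u z + h * cauchyT v (z + h)) _ _ z10).
  move=> h hh; rewrite /cauchyT.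
  have c1 := continuous_cauchy_kernel cu z1.
  have c2 := continuous_cauchy_kernel cv (hz h hh).
  rewrite -(cfunZ h c2) -(cfunD c1 (continuousMc (@continuous_cstc R h) c2)).
  congr cfun; apply/funext => x; rewrite /v.
  have d1 := one_sub_circle_neq0 x z1; have d2 := one_sub_circle_neq0 x (hz h hh).
  field; by rewrite d1 d2.
by apply: jetD (jet_cst _ _) (jetMX (IH v cv)).
Qed.

Definition herg z := cfun I (fun x => (1 + (x : C) * z) / (1 - (x : C) * z)).

Lemma herg_cauchyT z : normc z < 1 -> herg z = 2 * cauchyT (fun=> 1) z - (I (fun=> 1))%:C.
Proof.
move=> z1; rewrite -[_%:C]mul1r -cfun_cst /herg /cauchyT.
have c1 := continuous_cauchy_kernel (@continuous_cstc R 1) z1.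
rewrite -(cfunZ 2 c1) -(cfunB (continuousMc (@continuous_cstc R 2) c1) (@continuous_cstc R 1)).
congr cfun; apply/funext => x; have d1 := one_sub_circle_neq0 x z1; by field.
Qed.

Lemma peano_herg z : normc z < 1 -> peano herg z.
Proof.
move=> z1; have d : 0 < 1 - normc z by lra.
apply: (@peano_eq _ (fun z => 2 * cauchyT (fun=> 1) z - (I (fun=> 1))%:C) _ _ _ d).
  move=> w wz; rewrite herg_cauchyT//.
  have -> : w = (w - z) + z by ring.
  by have := normcD (w - z) z; lra.
apply: peanoB; last exact: peano_cst.
apply: peanoM; first exact: peano_cst.
by apply: peano_cauchyT => //; exact: continuous_cstc.
Qed.

Lemma herg0 : herg 0 = (I (fun=> 1))%:C.
Proof.
rewrite /herg -[RHS]mul1r -cfun_cst; congr cfun; apply/funext => x.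
by rewrite mulr0 addr0 subr0 divr1.
Qed.

Lemma Re_herg_kernel x z : normc z < 1 ->
  complex.Re ((1 + (x : C) * z) / (1 - (x : C) * z))
  = (1 - normc z ^+ 2) / normc (1 - (x : C) * z) ^+ 2.
Proof.
move=> z1; have d1 := one_sub_circle_neq0 x z1.
have nd1 : normc (1 - (x : C) * z) ^+ 2 != 0 by rewrite expf_neq0// normc_eq0.
apply: (mulIf nd1); rewrite mulfVK// mulrC -ReMr -mulc_conj.
set w := (x : C) * z.
have nw : normc z = normc w by rewrite normcM normc_circle mul1r.
rewrite nw normc_sqr.
have -> : (1 - w) * conjc (1 - w) * ((1 + w) / (1 - w)) = (1 + w) * conjc (1 - w).
  by move: d1; rewrite -/w => d1; field.
case: w {d1 nd1 nw} => a b /=; ring.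
Qed.

Lemma Re_herg_ge0 z : normc z < 1 -> 0 <= complex.Re (herg z).
Proof.
move=> z1; rewrite /herg /=; apply: functional_ge0.
  apply: continuous_Rec; apply: (continuous_cauchy_kernel _ z1).
  have cxz := continuousMc (@circle_val_continuous R) (@continuous_cstc R z).
  exact: (continuousDc (@continuous_cstc R 1) cxz).
move=> x; rewrite Re_herg_kernel// divr_ge0// ?sqr_ge0//.
by rewrite subr_ge0 exprn_ile1 ?normc_ge0// ltW.
Qed.

End positive_functionals.

(** * Integration against finite measures *)

Section measures_as_functionals.
Variable R : realType.
Local Notation C := R[i].
Local Notation T := (circle R).

Lemma continuous_measurable_circle (f : T -> R) : continuous f ->
  measurable_fun [set: borel_circle R] (f : borel_circle R -> R).
Proof.
move=> /continuousP cf; apply: (measurability _ (measurable_realfun.RGenOpens.measurableE R)).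
move=> _ [_ [a [b ->] <-]]; rewrite setTI.
by apply: sub_sigma_algebra; exact/cf/interval_open.
Qed.

Variable m : {finite_measure set (borel_circle R) -> \bar R}.

Lemma continuous_circle_integrable (f : T -> R) : continuous f ->
  m.-integrable [set: borel_circle R] (EFin \o f).
Proof.
move=> cf; apply: measurable_bounded_integrable => //.
- by rewrite -ge0_fin_numE//; exact: fin_num_measure.
- exact: continuous_measurable_circle.
have [M M0 fM] := continuous_circle_bounded cf.
exists M; split; first exact: num_real.
by move=> y /ltW My x _ /=; rewrite (le_trans (fM x)).
Qed.

Definition integral_functional (f : T -> R) : R := \int[m]_x f x.

Lemma integral_functional_pos : pos_functional integral_functional.
Proof.
split=> [f g cf cg|a f cf|f cf f0].
- by apply: RintegralD => //; exact: continuous_circle_integrable.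
- by apply: RintegralZl => //; exact: continuous_circle_integrable.
- by apply: Rintegral_ge0 => x _; exact: f0.
Qed.

Lemma integral_functional_mass : integral_functional (fun=> 1) = fine (m [set: borel_circle R]).
Proof. by rewrite /integral_functional Rintegral_cst// mul1r. Qed.

End measures_as_functionals.

(** * Limits along ultrafilters *)

Section ultralimits.
Variable R : realType.
Local Notation C := R[i].
Local Notation T := (circle R).

Lemma ultra_limit_bounded (S : Type) (U : set_system S) (UU : UltraFilter U) (a : S -> R) (K : R) :
  (\forall s \near U, `|a s| <= K) -> exists l : R, a s @[s --> U] --> l.
Proof.
move=> aK; have FA : (a s @[s --> U]) `[- K, K]%classic.
  by apply: filterS aK => s; rewrite /= in_itv /= ler_norml.
have [l [_ cl]] := @segment_compact R (- K) K _ _ FA.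
exists l => A lA; have [//|UnA] := in_ultra_setVsetC (a @^-1` A) UU.
by have [y [nAy Ay]] := cl (~` A) A UnA lA.
Qed.

(** If a neighbourhood A of l were missed, F restricted to the points sent outside A would be a
    proper filter, and an ultrafilter above it would both converge to l and avoid A. *)
Lemma cvg_ultra (S : Type) (F : set_system S) (FF : ProperFilter F) (V : topologicalType)
    (a : S -> V) (l : V) :
  (forall U, UltraFilter U -> F `<=` U -> a s @[s --> U] --> l) -> a s @[s --> F] --> l.
Proof.
move=> ul A lA; apply: contrapT => nFA.
have GF : ProperFilter (within (~` (a @^-1` A)) F).
  apply: Build_ProperFilter_ex => B; rewrite /within /= => FB.
  apply: contrapT => nB; apply: nFA; apply: filterS FB => s nAs.
  by apply: contrapT => nA; apply: nB; exists s; exact: nAs.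
have [U [UU GU]] := ultraFilterLemma GF.
have FU : F `<=` U by move=> B FB; apply: GU; apply: filterS FB => s Bs _.
have UnA : U (~` (a @^-1` A)) by apply: GU; apply: nearW.
have UA : U (a @^-1` A) by exact: ul FU _ lA.
by have [s []] := filter_ex (filterI UA UnA).
Qed.

(** Weak compactness in the form used below: each bounded family [J s f] converges along U, and
    linearity and positivity pass to the pointwise limit. *)
Lemma ultra_functional (S : Type) (U : set_system S) (UU : UltraFilter U)
    (J : S -> (T -> R) -> R) (W : R) : (forall s, pos_functional (J s)) ->
  (\forall s \near U, J s (fun=> 1) <= W) ->
  exists2 I, pos_functional I & forall f, continuous f -> J s f @[s --> U] --> I f.
Proof.
move=> Jpos JW.
have /choice[I IP] : forall f : T -> R, exists l : R, continuous f -> J s f @[s --> U] --> l.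
  move=> f; have [cf|ncf] := pselect (continuous f); last by exists 0.
  have [M M0 fM] := continuous_circle_bounded cf.
  have [|l lP] := @ultra_limit_bounded _ U UU (J ^~ f) (M * W); last by exists l.
  apply: filterS JW => s JsW.
  by rewrite (le_trans (functional_le_norm (Jpos s) cf fM))// ler_wpM2l.
exists I; last exact: IP.
have uniq (a : S -> R) (l l' : R) : a s @[s --> U] --> l -> a s @[s --> U] --> l' -> l = l'.
  exact: cvg_unique.
split=> [f g cf cg|a f cf|f cf f0].
- have cfg : continuous (fun x => f x + g x) by move=> x; exact: (cvgD (cf x) (cg x)).
  apply: (uniq _ _ _ (IP _ cfg)).
  under eq_fun do rewrite (functionalD (Jpos _) cf cg).
  exact: cvgD (IP _ cf) (IP _ cg).
- have cfg : continuous (fun x => a * f x) by move=> x; exact: (cvgM (cvg_cst a) (cf x)).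
  apply: (uniq _ _ _ (IP _ cfg)).
  under eq_fun do rewrite (functionalZ (Jpos _) _ cf).
  exact: cvgM (cvg_cst a) (IP _ cf).
- rewrite -(cvg_lim (@Rhausdorff R) (IP f cf)); apply: limr_ge; first exact: cvgP (IP f cf).
  by apply: nearW => s; exact: (functional_ge0 (Jpos s) cf f0).
Qed.

Lemma cvg_cfun (S : Type) (F : set_system S) (FF : Filter F) (J : S -> (T -> R) -> R) I
    (u : T -> C) : (forall f, continuous f -> J s f @[s --> F] --> I f) -> continuous u ->
  cfun (J s) u @[s --> F] --> cfun I u.
Proof.
move=> JI cu; apply: cvg_ReIm; apply: JI; [exact: continuous_Rec|exact: continuous_Imc].
Qed.

Lemma continuous_herg_kernel (z : C) : normc z < 1 ->
  continuous (fun x : T => (1 + (x : C) * z) / (1 - (x : C) * z)).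
Proof.
move=> z1; have cxz := continuousMc (@circle_val_continuous R) (@continuous_cstc R z).
exact: continuous_cauchy_kernel (continuousDc (@continuous_cstc R 1) cxz) z1.
Qed.

Lemma cvg_herg (S : Type) (F : set_system S) (FF : Filter F) (J : S -> (T -> R) -> R) I z :
  (forall f, continuous f -> J s f @[s --> F] --> I f) -> normc z < 1 ->
  herg (J s) z @[s --> F] --> herg I z.
Proof. by move=> JI z1; apply: cvg_cfun => //; exact: continuous_herg_kernel. Qed.

End ultralimits.

(** * Herglotz' theorem by discrete means *)

Section herglotz.
Variable R : realType.
Local Notation C := R[i].
Local Notation T := (circle R).
Implicit Types (z w : C) (r : R).

Definition discrete_functional n (wt : nat -> R) (p : nat -> T) (f : T -> R) : R :=
  \sum_(j < n) wt j * f (p j).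

Lemma discrete_functional_pos n wt p : (forall j, 0 <= wt j) ->
  pos_functional (discrete_functional n wt p).
Proof.
move=> w0; split=> [f g _ _|a f _|f _ f0]; rewrite /discrete_functional.
- by rewrite -big_split /=; apply: eq_bigr => j _; rewrite mulrDr.
- by rewrite mulr_sumr; apply: eq_bigr => j _; rewrite mulrCA.
- by apply: sumr_ge0 => j _; rewrite mulr_ge0.
Qed.

Lemma cfun_discrete n wt p u :
  cfun (discrete_functional n wt p) u = \sum_(j < n) (wt j)%:C * u (p j).
Proof.
rewrite /cfun /discrete_functional; apply: eqcP => /=.
  by rewrite Re_sum; apply: eq_bigr => j _; rewrite ReMr.
rewrite -[RHS]/(complex.Im _); elim/big_rec2: _ => // j x y _ ->.
by rewrite ImD ImMr.
Qed.

Definition mean n (g : C -> C) : C := n.+1%:R^-1 * \sum_(j < n.+1) g (root_unity R n.+1 j).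

Lemma cvg_mean g r : 1 < r -> (forall w, normc w < r -> peano g w) ->
  mean n g @[n --> \oo] --> g 0.
Proof.
move=> r1 pg; pose s := (1 + r) / 2; have s1 : 1 < s by rewrite /s; lra.
have sr : s < r by rewrite /s; lra.
have s0 : 0 < s by lra.
have pgs w : normc w <= s -> peano g w by move=> ws; apply: pg; lra.
have [K K0 bg] := peano_disk_bounded (ltW s0) pgs.
apply/cvgCP => e e0; have s1' : `|s^-1| < 1 by rewrite ger0_norm ?invr_ge0 ?(ltW s0)// invf_lt1.
have /cvgrPdist_lt/(_ e e0) := cvg_geometric (2 * K) s1'.
case=> N _ H; exists N => // n /= Nn.
apply: le_lt_trans (H n.+1 (leq_trans Nn (leqnSn n))).
rewrite sub0r normrN.
apply: le_trans (ler_norm _).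
apply: (discrete_mean_value (ltn0Sn n) s1) => w ws; [apply: pgs|apply: bg]; exact: ltW.
Qed.

Lemma meanD n g1 g2 : mean n (fun w => g1 w + g2 w) = mean n g1 + mean n g2.
Proof. by rewrite /mean big_split mulrDr. Qed.

Lemma meanZ n c g : mean n (fun w => c * g w) = c * mean n g.
Proof. by rewrite /mean -mulr_sumr mulrCA. Qed.

Lemma mean_conj n g : mean n (fun w => conjc (g w)) = conjc (mean n g).
Proof.
rewrite /mean rmorphM rmorph_sum /=; congr (_ * _).
by rewrite fmorphV rmorph_nat.
Qed.

Lemma mean_eq n g1 g2 : (forall w, normc w = 1 -> g1 w = g2 w) -> mean n g1 = mean n g2.
Proof.
by move=> g12; congr (_ * _); apply: eq_bigr => j _; apply: g12; exact: normc_root_unity.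
Qed.

Lemma conjc_inv_unit (w : C) : normc w = 1 -> conjc w = w^-1.
Proof.
move=> w1; have w0 : w != 0 by rewrite -normc_gt0 w1.
by apply: (mulfI w0); rewrite mulc_conj w1 expr1n divff.
Qed.

Lemma cvg_conjc (S : Type) (F : set_system S) (FF : Filter F) (f : S -> C) l :
  f x @[x --> F] --> l -> conjc (f x) @[x --> F] --> conjc l.
Proof.
move=> /cvgCP fl; apply/cvgCP => // e /fl; apply: filterS => x.
by rewrite -rmorphB /= normc_conj.
Qed.

(** On the unit circle conj(w) = 1/w, so the integrand combines functions analytic beyond the circle
    with conjugates of such functions, and each mean tends to the value at 0. The term g(w)/(1 -
    z/w) has a pole at z; splitting off g(z)/(1 - z/w), a multiple of a conjugate, leaves w times a
    difference quotient. *)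
Lemma cvg_mean_herglotz g r z : 1 < r -> (forall w, normc w < r -> peano g w) ->
  normc z < 1 ->
  mean n (fun w => (complex.Re (g w))%:C * ((1 + conjc w * z) / (1 - conjc w * z)))
    @[n --> \oo] --> g z - 'i * (complex.Im (g 0))%:C.
Proof.
move=> r1 pg z1.
have [s s1 szr] : exists2 s, 1 < s & s * normc z < 1.
  exists (2 / (1 + normc z)); have := normc_ge0 z => z0.
    by rewrite ltr_pdivlMr; lra.
  by rewrite mulrAC ltr_pdivrMr; lra.
have s0 : 0 < s by lra.
have d0 w : normc w < s -> 1 - conjc z * w != 0.
  move=> ws; rewrite -normc_gt0; have := normcB_ge 1 (conjc z * w).
  rewrite normc_1 normcM normc_conj.
  have : normc z * normc w <= s * normc z by rewrite mulrC ler_wpM2r ?normc_ge0// ltW.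
  lra.
have pk w : normc w < s -> peano (fun w => (1 - conjc z * w)^-1) w.
  move=> ws; apply: peanoV; first exact: d0.
  apply: peanoB; first exact: peano_cst.
  by apply: peanoM; [exact: peano_cst|exact: peano_id].
pose t := Num.min r s; have t1 : 1 < t by rewrite lt_min r1.
have tr : t <= r by rewrite ge_min lexx.
have ts : t <= s by rewrite ge_min lexx orbT.
have c1 : mean n (fun w => (1 - conjc z * w)^-1) @[n --> \oo] --> (1 : C).
  have := cvg_mean s1 pk; by rewrite mulr0 subr0 invr1.
have c2 : mean n (fun w => w * dquot g z w) @[n --> \oo] --> (0 : C).
  have := @cvg_mean (fun w => w * dquot g z w) r r1; rewrite mul0r; apply.
  move=> w wr; apply: peanoM; first exact: peano_id.
  by apply: peano_dquot; apply: pg => //; lra.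
have c3 : mean n (fun w => g w * (1 - conjc z * w)^-1) @[n --> \oo] --> g 0.
  have := @cvg_mean (fun w => g w * (1 - conjc z * w)^-1) t t1; rewrite mulr0 subr0 invr1 mulr1; apply.
  by move=> w wt; apply: peanoM; [apply: pg|apply: pk]; lra.
have c4 : mean n g @[n --> \oo] --> g 0 by exact: cvg_mean pg.
have -> : g z - 'i * (complex.Im (g 0))%:C =
  (0 + g z * conjc 1) + conjc (g 0) + (- 2^-1) * (g 0 + conjc (g 0)).
  rewrite conjc1 mulr1 add0r.
  have -> : conjc (g 0) = g 0 - 2 * ('i * (complex.Im (g 0))%:C).
    by case: (g 0) => a b; apply: eqcP => /=; ring.
  by field.
have E n : mean n (fun w => (complex.Re (g w))%:C * ((1 + conjc w * z) / (1 - conjc w * z))) =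
  (mean n (fun w => w * dquot g z w) + g z * conjc (mean n (fun w => (1 - conjc z * w)^-1)))
  + conjc (mean n (fun w => g w * (1 - conjc z * w)^-1))
  + (- 2^-1) * (mean n g + conjc (mean n g)).
  rewrite -!mean_conj -!meanZ -!meanD -meanZ -!meanD; apply: mean_eq => w w1.
  have w0 : w != 0 by rewrite -normc_gt0 w1.
  have wz : w - z != 0.
    by rewrite subr_eq0; apply: contraTneq z1 => <-; rewrite w1 ltxx.
  have dE : w * dquot g z w = (g w - g z) / (1 - w^-1 * z).
    rewrite /dquot; case: eqP => [/eqP|_]; first by rewrite -subr_eq0 (negbTE wz).
    by field; rewrite w0 wz.
  have cE : conjc (1 - conjc z * w)^-1 = (1 - w^-1 * z)^-1.
    rewrite fmorphV rmorphB rmorphM rmorph1 /= conjcK conjc_inv_unit//.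
    by rewrite (mulrC z).
  rewrite [conjc (g w * _)]rmorphM /= cE dE conjc_inv_unit//.
  have -> : (complex.Re (g w))%:C = (g w + conjc (g w)) / 2 by exact: ReJ_add.
  have dd : 1 - w^-1 * z != 0.
    by rewrite -(mulVf w0) -mulrBr mulf_neq0// invr_eq0.
  move: (conjc (g w)) (g w) (g z) => a b c.
  by field; rewrite w0 wz.
under eq_fun do rewrite E.
exact: (cvgD (cvgD (cvgD c2 (cvgM (@cvg_cst C (g z) nat \oo _) (cvg_conjc _ c1)))
  (cvg_conjc _ c3)) (cvgM (@cvg_cst C (- 2^-1) nat \oo _) (cvgD c4 (cvg_conjc _ c4)))).
Qed.

End herglotz.

Section herglotz_theorem.
Variable R : realType.
Local Notation C := R[i].
Local Notation T := (circle R).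
Implicit Types (z w : C) (r : R) (I J : (T -> R) -> R).

Lemma realcM (a b : R) : (a * b)%:C = a%:C * b%:C.
Proof. by apply: eqcP; rewrite /= ?mulr0 ?mul0r ?subr0 ?addr0. Qed.

Lemma realcV (a : R) : (a^-1)%:C = (a%:C)^-1.
Proof.
have [->|a0] := eqVneq a 0; first by rewrite !invr0.
have ac0 : a%:C != 0 by apply: contra_neq a0 => /(congr1 (@complex.Re R)).
by apply: (mulfI ac0); rewrite -realcM !divff.
Qed.

Lemma realc_nat n : (n%:R : R)%:C = n%:R.
Proof. exact: (rmorph_nat (real_complex R)). Qed.

Lemma cvgC_unique (S : Type) (F : set_system S) (FF : ProperFilter F) (f : S -> C) (a b : C) :
  f x @[x --> F] --> a -> f x @[x --> F] --> b -> a = b.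
Proof.
move=> /cvgCP fa /cvgCP fb; apply/eqP; rewrite -subr_eq0 -normc_eq0 eq_le normc_ge0 andbT.
apply/ler_addgt0Pr => e e0; rewrite add0r.
have e2 : 0 < e / 2 by rewrite divr_gt0.
have [x [xa xb]] := filter_ex (filterI (fa _ e2) (fb _ e2)).
have -> : a - b = (f x - b) - (f x - a) by ring.
have := normcB (f x - b) (f x - a); lra.
Qed.

Lemma herg0_mass I : pos_functional I -> I (fun=> 1) = complex.Re (herg I 0).
Proof. by move=> Ipos; rewrite herg0. Qed.

Lemma near_mass_le (S : Type) (F : set_system S) (FF : Filter F)
    (J : S -> (T -> R) -> R) (H : C) : (forall s, pos_functional (J s)) ->
  herg (J s) 0 @[s --> F] --> H ->
  \forall s \near F, J s (fun=> 1) <= complex.Re H + 1.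
Proof.
move=> Jpos /cvgCP/(_ 1 ltr01); apply: filterS => s Hs; rewrite herg0_mass//.
have := le_lt_trans (normc_Re _) Hs; rewrite ReB ltr_norml => /andP[_]; lra.
Qed.

Lemma functional_limit (S : Type) (F : set_system S) (FF : ProperFilter F)
    (J : S -> (T -> R) -> R) (H : C -> C) : (forall s, pos_functional (J s)) ->
  (forall z, normc z < 1 -> herg (J s) z @[s --> F] --> H z) ->
  exists2 I, pos_functional I & forall z, normc z < 1 -> herg I z = H z.
Proof.
move=> Jpos JH; have [U [UU FU]] := ultraFilterLemma FF.
have c0 : normc (0 : C) < 1 by rewrite normc0.
have [I Ipos IP] := ultra_functional UU Jpos (FU _ (near_mass_le FF Jpos (JH 0 c0))).
exists I => // z z1; apply: (@cvgC_unique _ U _ (fun s => herg (J s) z)).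
  exact: cvg_herg IP z1.
by move=> A /(JH z z1) FA; apply: FU.
Qed.

(** The dilates h(r w) are analytic beyond the unit circle, and sampling their real parts at roots
    of unity gives positive discrete functionals with the right limit transform. A second limit lets
    r tend to 1. *)
Theorem herglotz (h : C -> C) : (forall z, normc z < 1 -> peano h z) ->
  (forall z, normc z < 1 -> 0 <= complex.Re (h z)) ->
  exists2 I, pos_functional I &
    forall z, normc z < 1 -> herg I z = h z - 'i * (complex.Im (h 0))%:C.
Proof.
move=> ph h0.
have dil r : 0 < r < 1 -> exists2 I, pos_functional I &
    forall z, normc z < 1 -> herg I z = h (r%:C * z) - 'i * (complex.Im (h 0))%:C.
  move=> /andP[r0 r1]; pose g w := h (r%:C * w).
  have nr w : normc (r%:C * w) = r * normc w by rewrite normcM normcR gtr0_norm.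
  have pg w : normc w < r^-1 -> peano g w.
    move=> wr; apply: (@peano_comp _ h (fun w => r%:C * w)).
      by apply: ph; rewrite nr -ltr_pdivlMl// mulr1.
    by apply: peanoM; [exact: peano_cst|exact: peano_id].
  have r1' : 1 < r^-1 by rewrite invf_gt1.
  (* The minus sign puts the masses at conjugates of roots of unity: [herg] has x z where the mean
     has conj(w) z. *)
  pose node n j : T := circ (- (pi *+ 2 * j%:R / n.+1%:R)).
  pose wt n j := n.+1%:R^-1 * complex.Re (g (root_unity R n.+1 j)).
  have wt0 n j : 0 <= wt n j.
    by rewrite mulr_ge0// ?invr_ge0// h0// nr normc_root_unity mulr1.
  have nodeE n j : node n j = conjc (root_unity R n.+1 j) :> C.
    by rewrite circE cisE /root_unity cisE cosN sinN.
  have g0 : g 0 = h 0 by rewrite /g mulr0.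
  apply: (@functional_limit nat \oo _ (fun n => discrete_functional n.+1 (wt n) (node n))).
    by move=> n; exact: discrete_functional_pos.
  move=> z z1; have := cvg_mean_herglotz r1' pg z1; rewrite g0; apply: cvg_trans.
  apply: near_eq_cvg; apply: nearW => n; rewrite /herg cfun_discrete /mean mulr_sumr.
  apply: eq_bigr => j _; rewrite nodeE /wt realcM realcV realc_nat.
  by rewrite -mulrA.
pose rn (n : nat) : R := 1 - n.+2%:R^-1.
have rn01 n : 0 < rn n < 1.
  have n2 : (0 : R) < n.+2%:R^-1 by rewrite invr_gt0.
  have : (n.+2%:R^-1 : R) < 1 by rewrite invf_lt1// ltr1n.
  by rewrite /rn => n1; rewrite subr_gt0 gtrBl n1 n2.
have /choice[J JP] : forall n, exists I, pos_functional I /\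
    forall z, normc z < 1 -> herg I z = h ((rn n)%:C * z) - 'i * (complex.Im (h 0))%:C.
  by move=> n; have [I Ip IH] := dil _ (rn01 n); exists I.
apply: (@functional_limit nat \oo _ J); first by move=> n; case: (JP n).
move=> z z1; apply/cvgCP => e e0.
have [d d0 H] := peano_continuous (ph z z1) e0.
have d1 : 0 < d / (normc z + 1) by rewrite divr_gt0// ltr_wpDl ?normc_ge0.
have /cvgrPdist_lt/(_ _ d1) : (n.+2%:R^-1 : R) @[n --> \oo] --> (0 : R).
  have := @cvg_harmonic R; rewrite -(cvg_shiftS (@harmonic R)); exact.
apply: filterS => n; rewrite sub0r normrN ger0_norm ?invr_ge0// => nd.
case: (JP n) => _ /(_ z z1) ->.
have -> : h ((rn n)%:C * z) - 'i * (complex.Im (h 0))%:C - (h z - 'i * (complex.Im (h 0))%:C)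
  = h ((rn n)%:C * z) - h z by ring.
apply: H; have -> : (rn n)%:C * z - z = - (n.+2%:R^-1%:C * z).
  by rewrite /rn rmorphB rmorph1; ring.
rewrite normc_opp normcM normcR ger0_norm ?invr_ge0//.
move: nd; rewrite ltr_pdivlMr ?ltr_wpDl ?normc_ge0//; apply: le_lt_trans.
by rewrite ler_wpM2l ?invr_ge0// lerDl.
Qed.

(* For [w] on the unit circle this is the Poisson kernel at [r * conjc w]. *)
Definition poisson r w (x : T) : R :=
  complex.Re ((1 + (x : C) * (r%:C * conjc w)) / (1 - (x : C) * (r%:C * conjc w))).

Lemma poissonE r w x : 0 <= r < 1 -> normc w = 1 ->
  poisson r w x = (1 - r ^+ 2) / normc (1 - r%:C * ((x : C) * conjc w)) ^+ 2.
Proof.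
move=> /andP[r0 r1] w1; have n1 : normc (r%:C * conjc w) = r.
  by rewrite normcM normc_conj w1 mulr1 normcR ger0_norm.
rewrite /poisson Re_herg_kernel ?n1//; congr (_ / normc (1 - _) ^+ 2); ring.
Qed.

(** For each x the Poisson kernel is, on |w| = 1, the real part of a function of w that is analytic
    on |w| < s and bounded there by K. Neither s > 1 nor K depends on x, whence a uniform error. *)
Lemma cvg_mean_poisson r (e : R) : 0 <= r < 1 -> 0 < e ->
  \forall n \near \oo, forall x : T,
   `|n.+1%:R^-1 * \sum_(j < n.+1) poisson r (root_unity R n.+1 j) x - 1| < e.
Proof.
move=> /andP[r0 r1] e0; pose s := 2 / (1 + r).
have s1 : 1 < s by rewrite /s ltr_pdivlMr; lra.
have sr : s * r < 1 by rewrite /s mulrAC ltr_pdivrMr; lra.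
have s0 : 0 < s by lra.
pose g (x : T) w := (1 + conjc x * (r%:C * w)) / (1 - conjc x * (r%:C * w)).
pose K := 2 / (1 - s * r).
have nx (x : T) w : normc w < s -> normc (conjc x * (r%:C * w)) <= s * r.
  move=> ws; rewrite !normcM normc_conj normc_circle mul1r normcR ger0_norm// mulrC.
  by rewrite ler_wpM2r// ltW.
have dx (x : T) w : normc w < s -> 1 - s * r <= normc (1 - conjc x * (r%:C * w)).
  by move=> /(nx x); have := normcB_ge 1 (conjc x * (r%:C * w)); rewrite normc_1; lra.
have d0 (x : T) w : normc w < s -> 1 - conjc x * (r%:C * w) != 0.
  by move=> /(dx x) H; rewrite -normc_gt0; lra.
have pg x w : normc w < s -> peano (g x) w.
  move=> ws; have p1 : peano (fun w => conjc x * (r%:C * w)) w.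
    by do 2!(apply: peanoM; first exact: peano_cst); exact: peano_id.
  by apply: peano_div; [exact: d0|apply: peanoD|apply: peanoB] => //; exact: peano_cst.
have bg x w : normc w < s -> normc (g x w) <= K.
  move=> ws; rewrite normc_div /K ler_pM ?normc_ge0 ?invr_ge0 ?normc_ge0//.
    have := normcD 1 (conjc x * (r%:C * w)); have := nx x w ws; rewrite normc_1; lra.
  by rewrite lef_pV2 ?posrE ?(lt_le_trans _ (dx x w ws))//; [exact: dx|lra|lra].
have s1' : `|s^-1| < 1 by rewrite ger0_norm ?invr_ge0 ?(ltW s0)// invf_lt1.
have /cvgrPdist_lt/(_ e e0) := cvg_geometric (2 * K) s1'.
case=> N _ H; exists N => // n /= Nn x.
apply: le_lt_trans (H n.+1 (leq_trans Nn (leqnSn n))).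
rewrite sub0r normrN; apply: le_trans (ler_norm _).
apply: le_trans (discrete_mean_value (ltn0Sn n) s1 (pg x) (bg x)).
apply: le_trans (normc_Re _); rewrite ReB /g mulr0 mulr0 addr0 subr0 divr1 /=.
rewrite -realc_nat -realcV ReMr Re_sum.
suff E (j : 'I_n.+1) : poisson r (root_unity R n.+1 j) x =
    complex.Re ((1 + conjc x * (r%:C * root_unity R n.+1 j)) /
                (1 - conjc x * (r%:C * root_unity R n.+1 j))).
  by rewrite (eq_bigr _ (fun j _ => E j)).
move: (root_unity _ _ _) => w.
have -> : (1 + conjc x * (r%:C * w)) / (1 - conjc x * (r%:C * w)) =
    conjc ((1 + (x : C) * (r%:C * conjc w)) / (1 - (x : C) * (r%:C * conjc w))).
  by rewrite rmorphM fmorphV rmorphB rmorphD !rmorphM rmorph1 /= conjcK oppr0.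
by rewrite /poisson; case: (_ / _).
Qed.

End herglotz_theorem.

(** * Uniqueness and convergence from Herglotz transforms *)

Section determination_by_herglotz_transform.
Variable R : realType.
Local Notation C := R[i].
Local Notation T := (circle R).
Implicit Types (z w : C) (r e : R) (I J : (T -> R) -> R).

Lemma normc_real_conj r w : 0 <= r -> normc w = 1 -> normc (r%:C * conjc w) = r.
Proof. by move=> r0 w1; rewrite normcM normc_conj w1 mulr1 normcR ger0_norm. Qed.

Lemma continuous_poisson r w : 0 <= r < 1 -> normc w = 1 ->
  continuous (@poisson R r w).
Proof.
move=> /andP[r0 r1] w1; have z1 : normc (r%:C * conjc w) < 1 by rewrite normc_real_conj.
exact: (continuous_Rec (continuous_herg_kernel z1)).
Qed.

Lemma poisson_ge0 r w x : 0 <= r < 1 -> normc w = 1 -> 0 <= @poisson R r w x.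
Proof.
move=> /[dup] /andP[r0 r1] r01 w1; rewrite poissonE// divr_ge0 ?sqr_ge0//.
by rewrite subr_ge0 exprn_ile1// ltW.
Qed.

(** The denominator |1 - r x conj(w)| stays above d - (1 - r) >= d/2, and 1 - r^2 <= 2 (1 - r). *)
Lemma poisson_far r w (x : T) (d : R) : 0 <= r < 1 -> normc w = 1 -> 0 < d -> 1 - r <= d / 2 ->
  d <= normc (w - (x : C)) -> poisson r w x <= 8 * (1 - r) / d ^+ 2.
Proof.
move=> /[dup] /andP[r0 r1] r01 w1 d0 rd wx; rewrite poissonE//.
have w0 : w != 0 by rewrite -normc_gt0 w1.
set u := (x : C) * conjc w; have nu : normc u = 1.
  by rewrite normcM normc_conj w1 mulr1 normc_circle.
have d1 : d <= normc (1 - u).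
  have -> : 1 - u = (w - (x : C)) * conjc w.
    rewrite mulrBl mulc_conj w1 expr1n //.
  by rewrite normcM normc_conj w1 mulr1.
have lb : d / 2 <= normc (1 - r%:C * u).
  have -> : 1 - r%:C * u = (1 - u) + (1 - r%:C) * u by ring.
  have := normcD_ge (1 - u) ((1 - r%:C) * u); rewrite normcM nu mulr1.
  rewrite -(rmorph1 (real_complex R)) -rmorphB normcR ger0_norm ?subr_ge0 ?(ltW r1)//.
  by rewrite rmorph1; lra.
have d20 : 0 < d / 2 by rewrite divr_gt0.
have n0 : 0 < normc (1 - r%:C * u) by exact: lt_le_trans lb.
rewrite ler_pdivrMr ?exprn_gt0//.
have sq : (d / 2) ^+ 2 <= normc (1 - r%:C * u) ^+ 2.
  by rewrite lerXn2r ?nnegrE ?(ltW d20) ?(ltW n0).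
have q0 : 0 <= 8 * (1 - r) / d ^+ 2 by rewrite divr_ge0 ?sqr_ge0// mulr_ge0// subr_ge0 ltW.
apply: le_trans (ler_wpM2l q0 sq).
have -> : 8 * (1 - r) / d ^+ 2 * (d / 2) ^+ 2 = 2 * (1 - r) by field; rewrite gt_eqF.
nra.
Qed.

Definition poisson_average r n (f : T -> R) (x : T) : R := n.+1%:R^-1 *
  \sum_(j < n.+1) f (circ (pi *+ 2 * j%:R / n.+1%:R)) * poisson r (root_unity R n.+1 j) x.

(** Poisson summability with a finite mean for the integral: nodes within d of x contribute the
    oscillation e/4, the others at most 2 B q, and the total weight is 1 up to e1. Poisson kernels
    are useful here because a functional takes values on them that [herg] determines. *)
Lemma poisson_approximation (f : T -> R) e : continuous f -> 0 < e ->
  exists2 r, 0 <= r < 1 & exists n, forall x, `|f x - poisson_average r n f x| <= e.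
Proof.
move=> cf e0; have [B B0 fB] := continuous_circle_bounded cf.
have e4 : 0 < e / 4 by rewrite divr_gt0.
have [d d0 fd] := continuous_circleP cf e4.
(* This is 1 - r. The first bound serves [poisson_far]; the last makes 2 B q = 16 B eta / d^2 at
   most e/4. *)
pose eta := Num.min (Num.min (d / 2) 2^-1) (e * d ^+ 2 / (64 * (B + 1))).
have B1 : 0 < 64 * (B + 1) by rewrite mulr_gt0// ltr_wpDl.
have d2 : 0 < d ^+ 2 by rewrite exprn_gt0.
have ed2 : 0 < e * d ^+ 2 by rewrite mulr_gt0.
have eta0 : 0 < eta by rewrite !lt_min !(divr_gt0, invr_gt0, d0, ed2, B1, ltr0n).
have eta1 : eta <= d / 2 by rewrite !ge_min lexx.
have eta2 : eta <= 2^-1 by rewrite !ge_min lexx orbT.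
have eta3 : eta * (64 * (B + 1)) <= e * d ^+ 2.
  by rewrite -ler_pdivlMr// ge_min lexx orbT.
pose r := 1 - eta; have r01 : 0 <= r < 1 by rewrite /r; apply/andP; split; lra.
have r1 : 1 - r = eta by rewrite /r; ring.
pose e1 := Num.min 1 (e / (4 * (B + 1))).
have e10 : 0 < e1 by rewrite lt_min ltr01 divr_gt0// mulr_gt0// ltr_wpDl.
have e11 : e1 <= 1 by rewrite ge_min lexx.
have e12 : e1 * (4 * (B + 1)) <= e.
  by rewrite -ler_pdivlMr ?mulr_gt0 ?ltr_wpDl// ge_min lexx orbT.
have [n _ /(_ n (leqnn n)) /= avgP] : \forall n \near \oo, forall x : T,
    `|n.+1%:R^-1 * \sum_(j < n.+1) poisson r (root_unity R n.+1 j) x - 1| < e1.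
  exact: cvg_mean_poisson.
exists r => //; exists n => x; rewrite /poisson_average.
have nV : 0 < (n.+1%:R : R)^-1 by rewrite invr_gt0.
pose P j := poisson r (root_unity R n.+1 j) x.
pose y j : T := circ (pi *+ 2 * j%:R / n.+1%:R).
set A := n.+1%:R^-1 * _.
pose avg := n.+1%:R^-1 * \sum_(j < n.+1) P j.
have avg1 : `|avg - 1| < e1 by exact: avgP.
have -> : f x - A = - (f x * (avg - 1)) + n.+1%:R^-1 * \sum_(j < n.+1) (f x - f (y j)) * P j.
  rewrite (eq_bigr (fun j : 'I_n.+1 => f x * P j - f (y j) * P j)); last first.
    by move=> j _; rewrite mulrBl.
  rewrite sumrB -mulr_sumr /A /avg -/P; rewrite mulrBr; ring.
have t1 : `|- (f x * (avg - 1))| <= e / 4.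
  rewrite normrN normrM; have := fB x; have := normr_ge0 (f x).
  have := normr_ge0 (avg - 1); nra.
pose q := 8 * eta / d ^+ 2.
have q0 : 0 <= q by rewrite /q divr_ge0 ?(ltW d2)// mulr_ge0// ltW.
have qB : 2 * B * q <= e / 4.
  have h : q * d ^+ 2 = 8 * eta by rewrite /q; field; rewrite gt_eqF.
  rewrite -(ler_pM2r d2); nra.
have P0 j : 0 <= P j by apply: poisson_ge0 => //; exact: normc_root_unity.
have tj j : `|(f x - f (y j)) * P j| <= e / 4 * P j + 2 * B * q.
  rewrite normrM (ger0_norm (P0 j)).
  have [xy|xy] := ltP (normc ((y j : C) - (x : C))) d.
    have h := ler_wpM2r (P0 j) (ltW (fd x (y j) xy)); rewrite distrC.
    by apply: (le_trans h); rewrite lerDl; apply: mulr_ge0 => //; apply: mulr_ge0.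
  have : P j <= q by rewrite /q -r1; apply: poisson_far => //; [exact: normc_root_unity|rewrite r1].
  have : `|f x - f (y j)| <= 2 * B.
    by rewrite (le_trans (ler_normB _ _))// mulr2n mulrDl mul1r lerD.
  have := normr_ge0 (f x - f (y j)); have := P0 j; nra.
have t2 : `|n.+1%:R^-1 * \sum_(j < n.+1) (f x - f (y j)) * P j| <= e / 4 * avg + 2 * B * q.
  rewrite normrM (gtr0_norm nV).
  apply: (le_trans (ler_wpM2l (ltW nV) (ler_norm_sum _ _ _))).
  have st : \sum_(j < n.+1) `|(f x - f (y j)) * P j| <= \sum_(j < n.+1) (e / 4 * P j + 2 * B * q).
    by apply: ler_sum => j _; exact: tj.
  apply: (le_trans (ler_wpM2l (ltW nV) st)).
  rewrite big_split /= -mulr_sumr sumr_const card_ord mulrDr.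
  by rewrite -[(2 * B * q) *+ n.+1]mulr_natl mulKf ?pnatr_eq0// mulrCA lexx.
have avg2 : avg <= 2 by move: avg1; rewrite ltr_norml => /andP[_]; lra.
apply: (le_trans (ler_normD _ _)); nra.
Qed.

Lemma continuous_poisson_average r n f : 0 <= r < 1 -> continuous (poisson_average r n f).
Proof.
move=> r01; rewrite /poisson_average.
have cs (s : seq 'I_n.+1) : continuous (fun x => \sum_(j <- s)
    f (circ (pi *+ 2 * j%:R / n.+1%:R)) * poisson r (root_unity R n.+1 j) x).
  elim: s => [|j s IH].
    rewrite (_ : (fun x => _) = fun=> 0); first exact: cst_continuous.
    by apply/funext => x; rewrite big_nil.
  rewrite (_ : (fun x => _) = fun x => f (circ (pi *+ 2 * j%:R / n.+1%:R)) *
      poisson r (root_unity R n.+1 j) x + \sum_(j <- s)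
    f (circ (pi *+ 2 * j%:R / n.+1%:R)) * poisson r (root_unity R n.+1 j) x).
    have cj := continuous_poisson r01 (normc_root_unity R n.+1 j).
    by move=> x; exact: (cvgD (cvgM (cvg_cst _) (cj x)) (IH x)).
  by apply/funext => x; rewrite big_cons.
move=> x; exact: (cvgM (cvg_cst _) (cs _ x)).
Qed.

Lemma functional_poisson_average I r n f : pos_functional I -> 0 <= r < 1 ->
  I (poisson_average r n f) = n.+1%:R^-1 * \sum_(j < n.+1)
    f (circ (pi *+ 2 * j%:R / n.+1%:R)) *
    complex.Re (herg I (r%:C * conjc (root_unity R n.+1 j))).
Proof.
move=> Ipos r01.
have cj (j : 'I_n.+1) := continuous_poisson r01 (normc_root_unity R n.+1 j).
have cfj (j : 'I_n.+1) : continuous (fun x => f (circ (pi *+ 2 * j%:R / n.+1%:R)) *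
    poisson r (root_unity R n.+1 j) x).
  by move=> x; exact: (cvgM (cvg_cst _) (cj j x)).
have -> : poisson_average r n f = fun x => \sum_(j < n.+1) n.+1%:R^-1 *
    (f (circ (pi *+ 2 * j%:R / n.+1%:R)) * poisson r (root_unity R n.+1 j) x).
  by apply/funext => x; rewrite /poisson_average mulr_sumr.
rewrite (functional_sum Ipos); last first.
  by move=> j x; exact: (cvgM (cvg_cst _) (cfj j x)).
rewrite mulr_sumr; apply: eq_bigr => j _.
by rewrite (functionalZ Ipos _ (cfj j)) (functionalZ Ipos _ (cj j)).
Qed.

(** Both functionals agree on Poisson averages of f, which approximate f uniformly; the error is
    controlled by the total masses. *)
Theorem herg_unique I J : pos_functional I -> pos_functional J ->
  (forall z, normc z < 1 -> herg I z = herg J z) ->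
  forall f, continuous f -> I f = J f.
Proof.
move=> Ipos Jpos IJ f cf; apply/eqP; rewrite -subr_eq0 -normr_eq0 eq_le normr_ge0 andbT.
apply/ler_addgt0Pr => e e0; rewrite add0r.
pose W := I (fun=> 1) + J (fun=> 1) + 1.
have I1 := functional_mass_ge0 Ipos; have J1 := functional_mass_ge0 Jpos.
have W0 : 0 < W by rewrite /W; lra.
have eW : 0 < e / W by rewrite divr_gt0.
have [r r01 [n approx]] := poisson_approximation cf eW.
have cp := @continuous_poisson_average r n f r01.
have cfp : continuous (fun x => f x - poisson_average r n f x).
  by move=> x; exact: (cvgB (cf x) (cp x)).
have hI := functional_le_norm Ipos cfp approx.
have hJ := functional_le_norm Jpos cfp approx.
rewrite (functionalB Ipos cf cp) in hI; rewrite (functionalB Jpos cf cp) in hJ.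
have IJp : I (poisson_average r n f) = J (poisson_average r n f).
  rewrite !functional_poisson_average//; congr (_ * _); apply: eq_bigr => j _.
  rewrite IJ// normc_real_conj ?normc_root_unity//; by case/andP: r01.
rewrite IJp in hI; set p := J _ in hI hJ.
have -> : I f - J f = (I f - p) - (J f - p) by ring.
apply: (le_trans (ler_normB _ _)).
have hW : e / W * W = e by rewrite divfK ?gt_eqF.
have eW' := ltW eW; rewrite /W in hW hI hJ *; nra.
Qed.

(** The values at z = 0 bound the masses, so every ultrafilter above F has a limit functional. Its
    transform agrees with that of I on |z| < r, hence on the whole disk by the identity theorem, and
    uniqueness identifies the limit. *)
Theorem functional_cvg (S : Type) (F : set_system S) (FF : ProperFilter F)
    (J : S -> (T -> R) -> R) I r : 0 < r ->
  (forall s, pos_functional (J s)) -> pos_functional I ->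
  (forall z, normc z < r -> herg (J s) z @[s --> F] --> herg I z) ->
  forall f, continuous f -> J s f @[s --> F] --> I f.
Proof.
move=> r0 Jpos Ipos JI f cf; apply: cvg_ultra => U UU FU.
have n0 : normc (0 : C) < r by rewrite normc0.
have [I' I'pos IP] := ultra_functional UU Jpos (FU _ (near_mass_le _ Jpos (JI 0 n0))).
suff -> : I f = I' f by exact: IP.
apply: herg_unique cf => // z z1.
have r1 : 0 < Num.min r 1 by rewrite lt_min r0 ltr01.
apply: (identity_theorem r1 (r := 1) _ _ _ z1) => w w1; try exact: peano_herg.
move: w1; rewrite lt_min => /andP[wr w1].
apply: (@cvgC_unique _ _ U _ (fun s => herg (J s) w)).
  by move=> A /(JI w wr) FA; exact: FU.
exact: cvg_herg IP w1.
Qed.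

End determination_by_herglotz_transform.

(** * Riesz representation on the circle *)

Section uniform_law.
Variable R : realType.

(** Probability measures on the circle are built below as laws of functions of this one uniform
    variable, which turns limits of measures into pointwise limits of quantile functions. *)
Definition unif : probability (measurableTypeR R) R := uniform_prob (@ltr01 R).

Lemma unif_itv (a b : R) : 0 <= a -> a <= b -> b <= 1 -> unif `[a, b[%classic = (b - a)%:E.
Proof.
move=> a0 ab b1; rewrite /unif /= /uniform_prob.
rewrite (eq_integral (fun=> 1%E)); last first.
  move=> x; rewrite inE /= in_itv /= => /andP[ax xb].
  by rewrite /uniform_pdf (le_trans a0 ax) (ltW (lt_le_trans xb b1)) /= subr0 invr1.
rewrite integral_cst//= mul1e lebesgue_measure_itv /= lte_fin.
case: ltP => // ba; have -> : a = b by apply/eqP; rewrite eq_le ab ba.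
by rewrite subrr.
Qed.

Definition bounded_measurable (g : R -> R) := measurable_fun [set: R] g /\
  exists M, forall t, `|g t| <= M.

Definition expect (g : R -> R) : R := \int[unif]_t g t.

Lemma bm_integrable g : bounded_measurable g -> unif.-integrable [set: R] (EFin \o g).
Proof.
move=> [mg [M gM]]; apply: measurable_bounded_integrable => //.
  by rewrite -ge0_fin_numE//; exact: fin_num_measure.
exists M; split; first exact: num_real.
by move=> y /ltW My x _ /=; rewrite (le_trans (gM x)).
Qed.

Lemma bm_cst c : bounded_measurable (fun=> c).
Proof. by split; [exact: measurable_cst|exists `|c|]. Qed.

Lemma bmD f g : bounded_measurable f -> bounded_measurable g ->
  bounded_measurable (fun t => f t + g t).
Proof.
move=> [mf [M fM]] [mg [N gN]]; split; first exact: (measurable_realfun.measurable_funD mf mg).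
by exists (M + N) => t; rewrite (le_trans (ler_normD _ _))// lerD.
Qed.

Lemma bmZ c f : bounded_measurable f -> bounded_measurable (fun t => c * f t).
Proof.
move=> [mf [M fM]]; split; first exact: (measurable_realfun.measurable_funM (measurable_cst c) mf).
by exists (`|c| * M) => t; rewrite normrM ler_wpM2l.
Qed.

Lemma bm_indic (A : set (measurableTypeR R)) : measurable A -> bounded_measurable (\1_A).
Proof.
move=> mA; split; first exact: measurable_indic.
by exists 1 => t; rewrite indicE; case: (t \in A); rewrite ?normr0 ?normr1.
Qed.

Lemma expectD f g : bounded_measurable f -> bounded_measurable g ->
  expect (fun t => f t + g t) = expect f + expect g.
Proof. by move=> bf bg; apply: RintegralD => //; exact: bm_integrable. Qed.

Lemma expectZ c f : bounded_measurable f -> expect (fun t => c * f t) = c * expect f.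
Proof. by move=> bf; apply: RintegralZl => //; exact: bm_integrable. Qed.

Lemma expect_mono f g : bounded_measurable f -> bounded_measurable g ->
  (forall t, f t <= g t) -> expect f <= expect g.
Proof. by move=> bf bg fg; apply: le_Rintegral => //; exact: bm_integrable. Qed.

Lemma expect_cst c : expect (fun=> c) = c.
Proof.
rewrite /expect Rintegral_cst// [X in fine X](_ : _ = 1%E) ?mulr1//.
exact: (probability_setT unif).
Qed.

Lemma expect_indic (A : set (measurableTypeR R)) : measurable A -> expect (\1_A) = fine (unif A).
Proof. by move=> mA; rewrite /expect /Rintegral integral_indic// setIT. Qed.

Lemma bm_sum n (F : nat -> R -> R) : (forall i, (i < n)%N -> bounded_measurable (F i)) ->
  bounded_measurable (fun t => \sum_(i < n) F i t) /\
  expect (fun t => \sum_(i < n) F i t) = \sum_(i < n) expect (F i).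
Proof.
elim: n => [|n IH] bF.
  rewrite big_ord0 (_ : (fun t => _) = fun=> 0); last by apply/funext => t; rewrite big_ord0.
  by split; [exact: bm_cst|rewrite expect_cst].
have [b1 E1] := IH (fun i ni => bF i (ltnW ni)).
rewrite (_ : (fun t => _) = fun t => \sum_(i < n) F i t + F n t); last first.
  by apply/funext => t; rewrite big_ord_recr.
split; first exact: bmD b1 (bF n (ltnSn n)).
by rewrite (expectD b1 (bF n (ltnSn n))) E1 big_ord_recr.
Qed.

Lemma law_exists (X : R -> circle R) :
  measurable_fun [set: measurableTypeR R] (X : R -> borel_circle R) ->
  exists P : prob_circle R, forall f : circle R -> R, continuous f ->
    \int[P]_x f x = expect (fun t => f (X t)).
Proof.
move=> mX; pose X' : {mfun measurableTypeR R >-> borel_circle R} :=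
  MeasurableFun.Pack (MeasurableFun.Class (isMeasurableFun.Build _ _
    (measurableTypeR R) (borel_circle R) X mX)).
exists (distribution unif X') => f cf.
have mf := continuous_measurable_circle cf.
have [M M0 fM] := continuous_circle_bounded cf.
have bf : bounded_measurable (fun t => f (X t)).
  by split; [exact: measurableT_comp mf mX|exists M].
rewrite /Rintegral /distribution integral_pushforward //.
- exact/measurable_EFinP.
- exact: bm_integrable bf.
Qed.

End uniform_law.

(** * Step functions and quantile functions *)

Section riesz.
Variable R : realType.
Local Notation C := R[i].
Local Notation T := (circle R).

Definition outside : set (measurableTypeR R) := ~` `[0, 1[%classic.

Lemma measurable_outside : measurable outside.
Proof. by apply: measurableC; exact: measurable_itv. Qed.

Lemma expect_outside : expect (\1_outside) = 0 :> R.
Proof.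
rewrite (expect_indic measurable_outside).
have H := @probability_setC _ _ _ (@unif R) `[0, 1[%classic (measurable_itv _).
by rewrite [X in fine X]H (unif_itv (lexx 0) ler01 (lexx 1)) subr0 subee.
Qed.

(** The complement of [0, 1[ has probability 0; adding M + N times its indicator to g makes the
    comparison hold everywhere. *)
Lemma expect_le01 (f g : R -> R) : bounded_measurable f -> bounded_measurable g ->
  (forall t, 0 <= t < 1 -> f t <= g t) -> expect f <= expect g.
Proof.
move=> bf bg fg; have [_ [M fM]] := bf; have [_ [N gN]] := bg.
have bo := bm_indic measurable_outside.
have bZ := bmZ (M + N) bo; have bgo := bmD bg bZ.
have -> : expect g = expect (fun t => g t + (M + N) * \1_outside t).
  by rewrite (expectD bg bZ) (expectZ _ bo) expect_outside mulr0 addr0.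
apply: (expect_mono bf bgo) => t; rewrite indicE.
have [t01|nt01] := boolP (0 <= t < 1).
  by rewrite memNset ?mulr0 ?addr0 ?fg// /outside /= in_itv /= => /negP; apply.
rewrite mem_set ?mulr1; last by rewrite /outside /= in_itv /=; exact/negP.
have := fM t; have := gN t; rewrite !ler_norml => /andP[+ _] /andP[_].
lra.
Qed.

Lemma expect_dist01 (f g D : R -> R) : bounded_measurable f -> bounded_measurable g ->
  bounded_measurable D -> (forall t, 0 <= t < 1 -> `|f t - g t| <= D t) ->
  `|expect f - expect g| <= expect D.
Proof.
move=> bf bg bD fgD; have := expect_le01 (f := f) (g := fun t => g t + D t) bf (bmD bg bD).
have := expect_le01 (f := g) (g := fun t => f t + D t) bg (bmD bf bD).
rewrite (expectD bf bD) (expectD bg bD) => h1 h2.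
have {}h1 : expect g <= expect f + expect D.
  by apply: h1 => t /fgD; rewrite ler_norml => /andP[+ _]; lra.
have {}h2 : expect f <= expect g + expect D.
  by apply: h2 => t /fgD; rewrite ler_norml => /andP[_]; lra.
by rewrite ler_norml; apply/andP; split; lra.
Qed.

Definition step n (s : nat -> R) (c : nat -> R) (t : R) : R :=
  \sum_(i < n) c i * \1_(`[s i, s i.+1[%classic : set (measurableTypeR R)) t.

Lemma partition_index n (s : nat -> R) t : s 0%N <= t -> t < s n ->
  exists2 j, (j < n)%N & s j <= t < s j.+1.
Proof.
move=> s0; elim: n => [|n IH]; first by move=> t0; have := lt_le_trans t0 s0; rewrite ltxx.
have [/IH[j jn jP] _|nt tn] := ltP t (s n); first by exists j => //; exact: ltnW.
by exists n => //; rewrite nt tn.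
Qed.

Lemma stepE n s c t j : {homo s : i j / (i <= j)%N >-> i <= j} -> (j < n)%N ->
  s j <= t < s j.+1 -> step n s c t = c j.
Proof.
move=> sm jn /andP[sj sj1]; rewrite /step (bigD1 (Ordinal jn)) //= big1 ?addr0.
  by rewrite indicE mem_set ?mulr1//= in_itv /= sj.
move=> i; rewrite -val_eqE /= => ij; rewrite indicE memNset ?mulr0//= in_itv /=.
move/andP=> [si si1]; case: (ltngtP i j) ij => // [ij|ij] _.
  by have := lt_le_trans si1 (le_trans (sm _ _ ij) sj); rewrite ltxx.
by have := lt_le_trans sj1 (le_trans (sm _ _ ij) si); rewrite ltxx.
Qed.

Lemma bm_step n s c : bounded_measurable (step n s c).
Proof.
have bF i : (i < n)%N ->
    bounded_measurable (fun t => c i * \1_(`[s i, s i.+1[%classic : set (measurableTypeR R)) t).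
  by move=> _; exact: (bmZ (c i) (bm_indic (measurable_itv _))).
exact: (proj1 (bm_sum bF)).
Qed.

Lemma expect_step n s c : {homo s : i j / (i <= j)%N >-> i <= j} ->
  0 <= s 0%N -> s n <= 1 ->
  expect (step n s c) = \sum_(i < n) c i * (s i.+1 - s i).
Proof.
move=> sm s0 sn.
have mi i : measurable (`[s i, s i.+1[%classic : set (measurableTypeR R)) by exact: measurable_itv.
have bF i : (i < n)%N ->
    bounded_measurable (fun t => c i * \1_(`[s i, s i.+1[%classic : set (measurableTypeR R)) t).
  by move=> _; exact: (bmZ (c i) (bm_indic (mi i))).
rewrite (proj2 (bm_sum bF)); apply: eq_bigr => i _; rewrite (expectZ _ (bm_indic (mi i))) (expect_indic (mi i)).
rewrite unif_itv//; [exact: le_trans s0 (sm _ _ _)|exact: sm|].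
by apply: le_trans sn; apply: sm.
Qed.

(** One-sided continuity is left out so that the class is closed under pointwise limits. *)
Definition quantile (q : R -> R) :=
  {homo q : s t / s <= t} /\ forall t, 0 <= q t <= 1.

Lemma bm_comp_quantile q (G : R -> R) : quantile q -> continuous G ->
  (exists M, forall t, `|G t| <= M) -> bounded_measurable (fun t => G (q t)).
Proof.
move=> [qm _] cG [M GM]; split; last by exists M.
apply: (measurableT_comp (continuous_measurable_fun cG)).
exact: nondecreasing_measurable.
Qed.

(** By monotonicity the oscillations of q over the K + 1 subintervals telescope to at most 1, so the
    error does not depend on q. *)
Lemma riemann_sum_quantile q (G : R -> R) L K : quantile q -> continuous G ->
  (exists M, forall t, `|G t| <= M) -> 0 <= L ->
  (forall x y, 0 <= x <= 1 -> 0 <= y <= 1 -> `|G x - G y| <= L * `|x - y|) ->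
  `|expect (fun t => G (q t)) - K.+1%:R^-1 * \sum_(i < K.+1) G (q (i%:R / K.+1%:R))|
    <= L / K.+1%:R.
Proof.
move=> qq cG bG L0 GL; have [qm q01] := qq.
have K0 : 0 < K.+1%:R :> R by rewrite ltr0n.
pose s i : R := i%:R / K.+1%:R.
have sm : {homo s : i j / (i <= j)%N >-> i <= j}.
  by move=> i j ij; rewrite ler_pM2r ?invr_gt0// ler_nat.
have s0 : s 0%N = 0 by rewrite /s mul0r.
have sn : s K.+1 = 1 by rewrite /s divff// gt_eqF.
have ds i : s i.+1 - s i = K.+1%:R^-1.
  by rewrite /s -mulrBl -[X in X - _]natr1 [X in X * _]addrC addKr mul1r.
have E1 : K.+1%:R^-1 * \sum_(i < K.+1) G (q (i%:R / K.+1%:R)) =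
    expect (step K.+1 s (fun i => G (q (s i)))).
  rewrite expect_step ?s0 ?sn// mulr_sumr; apply: eq_bigr => i _.
  by rewrite ds mulrC.
have E2 : expect (step K.+1 s (fun i => L * (q (s i.+1) - q (s i)))) <= L / K.+1%:R.
  rewrite expect_step ?s0 ?sn// (eq_bigr (fun i : 'I_K.+1 => L / K.+1%:R * (q (s i.+1) - q (s i)))).
    rewrite -mulr_sumr -(big_mkord xpredT (fun i => q (s i.+1) - q (s i))) telescope_sumr//.
    rewrite ler_piMr ?divr_ge0// s0 sn.
    by have := q01 0; have := q01 1; move=> /andP[_ h1] /andP[h0 _]; lra.
  by move=> i _; rewrite ds mulrAC.
rewrite E1; apply: le_trans E2.
apply: expect_dist01; [exact: bm_comp_quantile|exact: bm_step|exact: bm_step|].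
move=> t /andP[t0 t1].
have [j jn jt] := @partition_index K.+1 s t (eq_ind_r (fun x => x <= t) t0 s0) (eq_ind_r (fun x => t < x) t1 sn).
rewrite !(stepE _ sm jn jt) (le_trans (GL _ _ (q01 _) (q01 _)))//.
case/andP: jt => sjt tsj; have h1 := qm _ _ sjt; have h2 := qm _ _ (ltW tsj).
by rewrite ler_wpM2l// ger0_norm; lra.
Qed.

(** Let s j be the partial sums of w. For t in [s j, s j.+1[, an interval of length w j, exactly the
    sums s 1, ..., s j are at most t, so counting them gives j. *)
Lemma discrete_quantile N (w : nat -> R) : (forall j, 0 <= w j) -> \sum_(j < N.+1) w j = 1 ->
  exists2 q, quantile q & forall G : R -> R, continuous G -> (exists M, forall t, `|G t| <= M) ->
    expect (fun t => G (q t)) = \sum_(j < N.+1) w j * G (j%:R / N.+1%:R).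
Proof.
move=> w0 w1; pose s j : R := \sum_(i < j) w i.
have sm : {homo s : i j / (i <= j)%N >-> i <= j}.
  apply: homo_leq => [x|y x z|i]; [exact: lexx|exact: le_trans|].
  by rewrite /s big_ord_recr /= lerDl.
have s0 : s 0%N = 0 by rewrite /s big_ord0.
have N0 : 0 < N.+1%:R :> R by rewrite ltr0n.
pose cnt (t : R) : nat := (\sum_(j < N.+1) (s j.+1 <= t)%R)%N.
pose q t : R := (cnt t)%:R / N.+1%:R.
have cntN t : (cnt t <= N.+1)%N.
  have : (cnt t <= \sum_(j < N.+1) 1)%N by apply: leq_sum => j _; exact: leq_b1.
  by rewrite sum_nat_const card_ord muln1.
have qq : quantile q.
  split=> [t u tu|t]; last by rewrite divr_ge0//= ler_pdivrMr// mul1r ler_nat.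
  rewrite ler_pM2r ?invr_gt0// ler_nat; apply: leq_sum => j _.
  by case: (leP (s j.+1) t) => //= h; rewrite (le_trans h tu).
exists q => // G cG bG.
have -> : \sum_(j < N.+1) w j * G (j%:R / N.+1%:R) =
    expect (step N.+1 s (fun j => G (j%:R / N.+1%:R))).
  rewrite expect_step ?s0 /s ?w1//; apply: eq_bigr => j _.
  by rewrite big_ord_recr /= addrAC subrr add0r mulrC.
apply/eqP; rewrite -subr_eq0 -normr_eq0 eq_le normr_ge0 andbT.
rewrite -[leRHS](@expect_cst R 0).
apply: expect_dist01; [exact: bm_comp_quantile|exact: bm_step|exact: bm_cst|].
move=> t /andP[t0 t1].
have [j jn jt] := @partition_index N.+1 s t (eq_ind_r (fun x => x <= t) t0 s0) (eq_ind_r (fun x => t < x) t1 w1).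
rewrite (stepE _ sm jn jt).
suff -> : q t = j%:R / N.+1%:R by rewrite subrr normr0.
congr (_%:R / _); rewrite /cnt.
have jN : (j <= N.+1)%N by exact: ltnW.
rewrite (eq_bigr (fun i : 'I_N.+1 => (i < j)%N : nat)).
  rewrite -(big_mkord xpredT (fun i => (i < j)%N : nat)) (big_cat_nat _ jN) //=.
  rewrite big_nat_cond (eq_bigr (fun=> 1%N)); last first.
    by move=> i /andP[/andP[_ ->]].
  rewrite -big_nat_cond sum_nat_const_nat subn0 muln1.
  rewrite big_nat_cond big1 ?addn0// => i /andP[/andP[ji _] _].
  by rewrite ltnNge ji.
move=> i _; congr nat_of_bool; case/andP: jt => sjt tsj.
case: (ltnP i j) => ij; first by rewrite (le_trans (sm _ _ ij) sjt).
by apply/negbTE; rewrite -ltNge (lt_le_trans tsj)// sm.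
Qed.

End riesz.

(** * Riesz' theorem on the circle *)

Section riesz_circle.
Variable R : realType.
Local Notation C := R[i].
Local Notation T := (circle R).

(** The circle is run through clockwise, so that j/n goes to the conjugate of a root of unity, the
    node required by the Herglotz kernel. *)
Definition turn (x : R) : T := circ (- (pi *+ 2 * x)).

Lemma turn_continuous : continuous turn.
Proof.
move=> x; have cm : continuous (fun x : R => - (pi *+ 2 * x)).
  move=> y; apply: (@cvgN R R); apply: cvgM; [exact: cvg_cst|exact: cvg_id].
exact: (continuous_comp (cm x) (@circ_continuous R _)).
Qed.

Lemma turn_lipschitz : exists2 L : R, 0 <= L & forall x y, 0 <= x <= 1 -> 0 <= y <= 1 ->
  normc ((turn x : C) - (turn y : C)) <= L * `|x - y|.
Proof.
have pi2 : 0 < pi *+ 2 :> R by rewrite pmulrn_lgt0// pi_gt0.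
(* Half of r is 2 pi, so [lipschitz_half] covers all the angles in use. *)
pose r : R := 2 * (pi *+ 2); have r0 : 0 < r by rewrite mulr_gt0.
have bE (z : C) : normc z < r -> normc (cexp z) <= expR r.
  by move=> zr; rewrite normc_cexp ler_expR; have := normc_Re z; rewrite ler_norml => /andP[_]; lra.
have H := lipschitz_half r0 (fun z _ => peano_cexp z) bE.
exists (8 * expR r / r * (pi *+ 2)).
  by rewrite mulr_ge0 ?(ltW pi2)// divr_ge0 ?(ltW r0)// mulr_ge0// expR_ge0.
have nI (t : R) : normc (0 +i* t : C) = `|t| by rewrite /= expr0n /= add0r sqrtr_sqr.
have r2 : r / 2 = pi *+ 2 by rewrite /r; field.
move=> x y x01 y01; rewrite !circE /cis.
have nle (u : R) : 0 <= u <= 1 -> normc (0 +i* - (pi *+ 2 * u) : C) <= r / 2.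
  move=> /andP[u0 u1]; rewrite nI normrN ger0_norm ?r2 ?mulr_ge0 ?(ltW pi2)//.
  by rewrite ler_piMr// ltW.
apply: le_trans (H _ _ (nle _ x01) (nle _ y01)) _.
have -> : (0 +i* - (pi *+ 2 * x) : C) - (0 +i* - (pi *+ 2 * y)) = 0 +i* (pi *+ 2 * (y - x)).
  by apply: eqcP => /=; ring.
by rewrite nI normrM (gtr0_norm pi2) distrC mulrA.
Qed.

Lemma herg_kernel_lipschitz (z : C) (x y : T) : normc z < 1 ->
  normc ((1 + (x : C) * z) / (1 - (x : C) * z) - (1 + (y : C) * z) / (1 - (y : C) * z))
  <= 2 / (1 - normc z) ^+ 2 * normc ((x : C) - (y : C)).
Proof.
move=> z1; have d1 := one_sub_circle_neq0 x z1; have d2 := one_sub_circle_neq0 y z1.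
have -> : (1 + (x : C) * z) / (1 - (x : C) * z) - (1 + (y : C) * z) / (1 - (y : C) * z) =
   2 * z * ((x : C) - (y : C)) / ((1 - (x : C) * z) * (1 - (y : C) * z)).
  by field; rewrite d1 d2.
have l1 := cauchy_kernel_lb x z; have l2 := cauchy_kernel_lb y z.
have z0 : 0 < 1 - normc z by lra.
rewrite normc_div !normcM normc_nat mulrAC ler_wpM2r ?normc_ge0//.
rewrite ler_pM ?mulr_ge0 ?invr_ge0 ?mulr_ge0 ?normc_ge0//; first by lra.
rewrite lef_pV2 ?posrE ?mulr_gt0 ?(lt_le_trans z0)// expr2 ler_pM ?(ltW z0)//.
Qed.

Definition qfun (q : R -> R) (f : T -> R) : R := expect (fun t => f (turn (q t))).

Lemma quantile_law q : quantile q -> exists P : prob_circle R, forall f : T -> R,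
  continuous f -> \int[P]_x f x = qfun q f.
Proof.
move=> [qm q01]; apply: (law_exists (X := fun t => turn (q t))).
have mt : measurable_fun [set: measurableTypeR R] (turn : measurableTypeR R -> borel_circle R).
  apply: (@measurability _ _ (measurableTypeR R) (borel_circle R) setT turn (@open T) erefl).
  move=> _ [A oA <-]; rewrite setTI; apply: open_measurable.
  by move/continuousP: turn_continuous; exact.
have mq : measurable_fun [set: measurableTypeR R] (q : measurableTypeR R -> measurableTypeR R).
  exact: nondecreasing_measurable.
exact: (measurableT_comp mt mq).
Qed.

Lemma qfun_pos q : quantile q -> pos_functional (qfun q).
Proof.
move=> /quantile_law[P PE]; have [a b c] := integral_functional_pos P.
split=> [f g cf cg|k f cf|f cf f0].
- by rewrite -!PE//; [exact: a|move=> x; exact: (cvgD (cf x) (cg x))].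
- by rewrite -!PE//; [exact: b|move=> x; exact: (cvgM (cvg_cst _) (cf x))].
- by rewrite -PE//; exact: c.
Qed.

Lemma continuous_turn_bounded (f : T -> R) : continuous f ->
  continuous (fun x => f (turn x)) /\ exists M, forall t, `|f (turn t)| <= M.
Proof.
move=> cf; split; last by have [M _ fM] := continuous_circle_bounded cf; exists M.
move=> x; exact: (@continuous_comp R T R turn f x (@turn_continuous x) (cf (turn x))).
Qed.

Definition lipschitz_circle (f : T -> R) := exists2 L, 0 <= L & forall x y : T,
  `|f x - f y| <= L * normc ((x : C) - (y : C)).

Lemma helly_quantile (S : Type) (U : set_system S) (UU : UltraFilter U) (q : S -> R -> R) :
  (forall s, quantile (q s)) -> exists2 q0, quantile q0 &
  forall f, continuous f -> lipschitz_circle f -> qfun (q s) f @[s --> U] --> qfun q0 f.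
Proof.
move=> qq.
have /choice[q0 q0P] : forall t, exists l : R, q s t @[s --> U] --> l.
  move=> t; apply: (@ultra_limit_bounded _ _ _ UU _ 1); apply: nearW => s.
  by have [_ /(_ t)/andP[h0 h1]] := qq s; rewrite ger0_norm.
have q0q : quantile q0.
  split=> [t u tu|t].
    rewrite -subr_ge0; apply: (cvgr_to_ge (cvgB (q0P u) (q0P t))); apply: nearW => s.
    by rewrite subr_ge0; have [qm _] := qq s; exact: qm.
  apply/andP; split.
    by apply: (cvgr_to_ge (q0P t)); apply: nearW => s; have [_ /(_ t)/andP[]] := qq s.
  by apply: (cvgr_to_le (q0P t)); apply: nearW => s; have [_ /(_ t)/andP[]] := qq s.
exists q0 => // f cf [L L0 fL].
have [cG bG] := continuous_turn_bounded cf; set G := fun x => f (turn x) in cG bG.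
have [L' L'0 tL] := turn_lipschitz.
have GL x y : 0 <= x <= 1 -> 0 <= y <= 1 -> `|G x - G y| <= L * L' * `|x - y|.
  move=> x01 y01; apply: le_trans (fL _ _) _; rewrite -mulrA ler_wpM2l//; exact: tL.
have LL0 : 0 <= L * L' by rewrite mulr_ge0.
apply/cvgrPdist_lt => e e0; have e3 : 0 < e / 3 by rewrite divr_gt0.
have [K HK] : exists K, L * L' / K.+1%:R < e / 3.
  have L1 : 0 < e / 3 / (L * L' + 1) by rewrite divr_gt0// ltr_wpDl.
  have /cvgrPdist_lt/(_ _ L1)[K _ /(_ K (leqnn K))] := @cvg_harmonic R.
  rewrite /= sub0r normrN ger0_norm ?invr_ge0// ltr_pdivlMr ?ltr_wpDl// => H.
  exists K; apply: le_lt_trans H; rewrite mulrC ler_wpM2l ?invr_ge0// lerDl //.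
pose RS (q : R -> R) := K.+1%:R^-1 * \sum_(i < K.+1) G (q (i%:R / K.+1%:R)).
have cRS : RS (q s) @[s --> U] --> RS q0.
  apply: (cvgM (@cvg_cst R _ _ _ _)).
  elim: (index_enum _) => [|i r IH].
    rewrite big_nil (_ : (fun s => _) = fun=> 0); first exact: (@cvg_cst R).
    by apply/funext => s; rewrite big_nil.
  rewrite big_cons.
  rewrite (_ : (fun s => _) = fun s => G (q s (i%:R / K.+1%:R)) + \sum_(i <- r) G (q s (i%:R / K.+1%:R))).
    apply: (cvgD _ IH).
    exact: (cvg_comp _ _ (q0P _) (cG _)).
  by apply/funext => s; rewrite big_cons.
have RSq q' : quantile q' -> `|qfun q' f - RS q'| < e / 3.
  move=> q'q; apply: le_lt_trans HK; exact: (riemann_sum_quantile K q'q cG bG LL0 GL).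
have /cvgrPdist_lt/(_ _ e3) := cRS; apply: filterS => s Hs.
have h1 := RSq _ q0q; have h2 := RSq _ (qq s).
move: Hs h1 h2; rewrite !ltr_norml => /andP[a b] /andP[c d] /andP[k l].
apply/andP; split; lra.
Qed.

Lemma lipschitz_herg_Re (z : C) : normc z < 1 ->
  lipschitz_circle (fun x : T => complex.Re ((1 + (x : C) * z) / (1 - (x : C) * z))).
Proof.
move=> z1; exists (2 / (1 - normc z) ^+ 2); first by rewrite divr_ge0// sqr_ge0.
by move=> x y; rewrite -ReB; apply: le_trans (normc_Re _) (herg_kernel_lipschitz x y z1).
Qed.

Lemma lipschitz_herg_Im (z : C) : normc z < 1 ->
  lipschitz_circle (fun x : T => complex.Im ((1 + (x : C) * z) / (1 - (x : C) * z))).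
Proof.
move=> z1; exists (2 / (1 - normc z) ^+ 2); first by rewrite divr_ge0// sqr_ge0.
by move=> x y; rewrite -ImB; apply: le_trans (normc_Im _) (herg_kernel_lipschitz x y z1).
Qed.

Lemma helly_herg (S : Type) (F : set_system S) (FF : ProperFilter F) (q : S -> R -> R)
    (H : C -> C) : (forall s, quantile (q s)) ->
  (forall z, normc z < 1 -> herg (qfun (q s)) z @[s --> F] --> H z) ->
  exists2 q0, quantile q0 & forall z, normc z < 1 -> herg (qfun q0) z = H z.
Proof.
move=> qq qH; have [U [UU FU]] := ultraFilterLemma FF.
have [q0 q0q q0P] := helly_quantile UU qq.
exists q0 => // z z1; apply: (@cvgC_unique _ _ U _ (fun s => herg (qfun (q s)) z)).
  have ck := continuous_herg_kernel z1.
  apply: cvg_ReIm.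
    exact: (q0P _ (continuous_Rec ck) (lipschitz_herg_Re z1)).
  exact: (q0P _ (continuous_Imc ck) (lipschitz_herg_Im z1)).
by move=> A /(qH z z1) FA; exact: FU.
Qed.

(** Since [herg] determines a functional, it is enough to find a quantile function whose law has the
    transform h of I. As in [herglotz], the dilates of h are discretized; Helly's selection keeps
    the limits within laws of quantile functions. *)
Theorem riesz_circle (I : (T -> R) -> R) : pos_functional I -> I (fun=> 1) = 1 ->
  exists P : prob_circle R, forall f, continuous f -> \int[P]_x f x = I f.
Proof.
move=> Ipos I1; pose h := herg I.
have h0 : h 0 = 1 by rewrite /h herg0// I1.
have ph z : normc z < 1 -> peano h z by exact: peano_herg.
have dil r : 0 < r < 1 -> exists2 q, quantile q &
    forall z, normc z < 1 -> herg (qfun q) z = h (r%:C * z).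
  move=> /andP[r0 r1]; pose g w := h (r%:C * w).
  have nr w : normc (r%:C * w) = r * normc w by rewrite normcM normcR gtr0_norm.
  have pg w : normc w < r^-1 -> peano g w.
    move=> wr; apply: (@peano_comp _ h (fun w => r%:C * w)).
      by apply: ph; rewrite nr -ltr_pdivlMl// mulr1.
    by apply: peanoM; [exact: peano_cst|exact: peano_id].
  have r1' : 1 < r^-1 by rewrite invf_gt1.
  pose wt n j := n.+1%:R^-1 * complex.Re (g (root_unity R n.+1 j)).
  have wt0 n j : 0 <= wt n j.
    rewrite mulr_ge0// ?invr_ge0//; apply: (Re_herg_ge0 Ipos).
    by rewrite nr normc_root_unity mulr1.
  pose W n := \sum_(j < n.+1) wt n j.
  (* The total weight W n only tends to h(0) = 1, hence the normalization. The default, a unit mass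
     at node 0, occurs for finitely many n only. *)
  pose w' n j := if 0 < W n then wt n j / W n else (j == 0%N)%:R.
  have w'0 n j : 0 <= w' n j.
    by rewrite /w'; case: ifP => // W0; rewrite divr_ge0// ltW.
  have w'1 n : \sum_(j < n.+1) w' n j = 1.
    rewrite /w'; have [W0|W0] := boolP (0 < W n); first by rewrite -mulr_suml divff// gt_eqF.
    by rewrite big_ord_recl big1 ?addr0.
  have node n j : turn (j%:R / n.+1%:R) = conjc (root_unity R n.+1 j) :> C.
    by rewrite circE cisE /root_unity cisE cosN sinN mulrA.
  have /choice[q qP] : forall n, exists q, quantile q /\ forall f, continuous f ->
      qfun q f = \sum_(j < n.+1) w' n j * f (turn (j%:R / n.+1%:R)).
    move=> n; have [q qq qE] := discrete_quantile (w'0 n) (w'1 n).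
    by exists q; split=> // f /continuous_turn_bounded[cG bG]; exact: qE cG bG.
  have hE n z : normc z < 1 -> 0 < W n -> (W n)%:C * herg (qfun (q n)) z =
      mean n (fun w => (complex.Re (g w))%:C * ((1 + conjc w * z) / (1 - conjc w * z))).
    move=> z1 W0; have ck := continuous_herg_kernel z1; have [_ qE] := qP n.
    have -> : herg (qfun (q n)) z =
        cfun (discrete_functional n.+1 (w' n) (fun j => turn (j%:R / n.+1%:R)))
          (fun x => (1 + (x : C) * z) / (1 - (x : C) * z)).
      by rewrite /herg /cfun (qE _ (continuous_Rec ck)) (qE _ (continuous_Imc ck)).
    rewrite cfun_discrete /mean !mulr_sumr; apply: eq_bigr => j _.
    rewrite node /w' W0 /wt mulrA -realcM (mulrC (W n)) divfK ?gt_eqF//.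
    by rewrite realcM realcV realc_nat -mulrA.
  have cH z : normc z < 1 ->
      mean n (fun w => (complex.Re (g w))%:C * ((1 + conjc w * z) / (1 - conjc w * z)))
      @[n --> \oo] --> h (r%:C * z).
    by move=> z1; have := cvg_mean_herglotz r1' pg z1; rewrite /g mulr0 h0 mulr0 subr0.
  have c0 : normc (0 : C) < 1 by rewrite normc0.
  have WE n : (W n)%:C = mean n (fun w => (complex.Re (g w))%:C *
      ((1 + conjc w * 0) / (1 - conjc w * 0))).
    rewrite /mean mulr_sumr rmorph_sum; apply: eq_bigr => j _.
    by rewrite -[LHS]/((wt n j)%:C) /wt realcM realcV realc_nat !mulr0 addr0 subr0 divr1 mulr1.
  have cW : W n @[n --> \oo] --> (1 : R).
    have E0 : W = fun n => complex.Re (mean n (fun w => (complex.Re (g w))%:C *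
      ((1 + conjc w * 0) / (1 - conjc w * 0)))) by apply/funext => n; rewrite -WE.
    by rewrite E0; have := cvg_Re _ (cH 0 c0); rewrite mulr0 h0; exact.
  apply: (@helly_herg nat \oo _ q); first by move=> n; case: (qP n).
  move=> z z1.
  have Wpos : \forall n \near \oo, 0 < W n.
    by have /cvgrPdist_lt/(_ _ ltr01) := cW; apply: filterS => n; rewrite ltr_norml => /andP[_]; lra.
  have cWC : (W n)%:C @[n --> \oo] --> (1 : C).
    by have := cH 0 c0; rewrite mulr0 h0; under eq_fun do rewrite -WE.
  have cWV : ((W n)%:C)^-1 @[n --> \oo] --> (1 : C)^-1 by exact: (cvgV (oner_neq0 C) cWC).
  have H : ((W n)%:C)^-1 * mean n (fun w => (complex.Re (g w))%:C *
      ((1 + conjc w * z) / (1 - conjc w * z))) @[n --> \oo] --> (1 : C)^-1 * h (r%:C * z).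
    exact: (cvgM cWV (cH z z1)).
  rewrite invr1 mul1r in H; apply: cvg_trans H.
  apply: near_eq_cvg; apply: filterS Wpos => n W0 /=; rewrite -hE// mulKf//.
  by apply: contraTneq W0 => /(congr1 (@complex.Re R)) /= ->; rewrite ltxx.
pose rn (n : nat) : R := 1 - n.+2%:R^-1.
have rn01 n : 0 < rn n < 1.
  have n2 : (0 : R) < n.+2%:R^-1 by rewrite invr_gt0.
  have : (n.+2%:R^-1 : R) < 1 by rewrite invf_lt1// ltr1n.
  by rewrite /rn => n1; rewrite subr_gt0 gtrBl n1 n2.
have /choice[q qP] : forall n, exists q, quantile q /\
    forall z, normc z < 1 -> herg (qfun q) z = h ((rn n)%:C * z).
  by move=> n; have [q qq qH] := dil _ (rn01 n); exists q.
have [|z z1|q0 q0q q0H] := @helly_herg nat \oo _ q h; first by move=> n; case: (qP n).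
  apply/cvgCP => e e0; have [d d0 H] := peano_continuous (ph z z1) e0.
  have d1 : 0 < d by [].
  have /cvgrPdist_lt/(_ _ d1) : (n.+2%:R^-1 : R) @[n --> \oo] --> (0 : R).
    have := @cvg_harmonic R; rewrite -(cvg_shiftS (@harmonic R)); exact.
  apply: filterS => n; rewrite sub0r normrN ger0_norm ?invr_ge0// => nd.
  case: (qP n) => _ /(_ z z1) ->.
  apply: H; have -> : (rn n)%:C * z - z = - (n.+2%:R^-1%:C * z).
    by rewrite /rn rmorphB rmorph1; ring.
  rewrite normc_opp normcM normcR ger0_norm ?invr_ge0//.
  by rewrite (le_lt_trans _ nd)// ler_piMr ?invr_ge0// ltW.
have [P PE] := quantile_law q0q.
exists P => f cf; rewrite (PE _ cf); exact: (herg_unique (qfun_pos q0q) Ipos q0H cf).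
Qed.

End riesz_circle.

Section finite_riesz.
Variable R : realType.
Local Notation C := R[i].
Local Notation T := (circle R).

Theorem riesz_circle_finite (I : (T -> R) -> R) : pos_functional I ->
  exists sigma : {finite_measure set (borel_circle R) -> \bar R},
    forall f, continuous f -> \int[sigma]_x f x = I f.
Proof.
move=> Ipos; pose W := I (fun=> 1); have W0 : 0 <= W := functional_mass_ge0 Ipos.
have [P PE] : exists P : prob_circle R, forall f : T -> R, continuous f -> W * (\int[P]_x f x) = I f.
  (* A functional of mass 0 vanishes, so any probability will do; the one of point evaluation is
     taken. *)
  have [W00|Wn0] := eqVneq W 0.
    have [J [Jpos J1]] : exists J : (T -> R) -> R, pos_functional J /\ J (fun=> 1) = 1.
      by exists (fun f => f (circle1 R)); split=> //; split.
    have [P _] := riesz_circle Jpos J1; exists P => f cf.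
    have [M M0 fM] := continuous_circle_bounded cf.
    have := functional_le_norm Ipos cf fM; rewrite -/W W00 mulr0 mul0r.
    by move=> h; apply/esym/eqP; rewrite -normr_eq0 eq_le h normr_ge0.
  have Jpos : pos_functional (fun f => W^-1 * I f).
    split=> [f g cf cg|k f cf|f cf f0].
    - by rewrite (functionalD Ipos cf cg) mulrDr.
    - by rewrite (functionalZ Ipos k cf) mulrCA.
    - by rewrite mulr_ge0 ?invr_ge0// (functional_ge0 Ipos cf f0).
  have J1 : W^-1 * I (fun=> 1) = 1 by rewrite mulVf.
  have [P PE] := riesz_circle Jpos J1.
  by exists P => f cf; rewrite (PE f cf) mulVKf.
pose sigma : {finite_measure set (borel_circle R) -> \bar R} := mscale (NngNum W0) P.
exists sigma => f cf; rewrite -(PE f cf).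
(* The scaling rule is applied to nonnegative integrands; f is recovered from f + M and the constant
   M. *)
have ge0E (g : T -> R) : continuous g -> (forall x, 0 <= g x) ->
    \int[sigma]_x g x = W * \int[P]_x g x.
  move=> cg g0; rewrite /Rintegral ge0_integral_mscale//=; last first.
  - by move=> x _; rewrite lee_fin.
  - by apply/measurable_EFinP; exact: continuous_measurable_circle.
  rewrite fineM//; apply: integrable_fin_num => //.
  exact: (continuous_circle_integrable P cg).
have [M M0 fM] := continuous_circle_bounded cf.
have cM : continuous (fun _ : T => M) by exact: cst_continuous.
have cg : continuous (fun x => f x + M) by move=> x; exact: (cvgD (cf x) (cM x)).
have sp := integral_functional_pos sigma; have Pp := integral_functional_pos P.
have := ge0E _ cg (fun x => _ : 0 <= f x + M).
have g0 x : 0 <= f x + M by have := fM x; rewrite ler_norml => /andP[+ _]; lra.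
move=> /(_ g0); rewrite [LHS](functionalD sp cf cM) [X in W * X](functionalD Pp cf cM) mulrDr.
rewrite -[integral_functional P (fun=> M)]/(\int[P]_x M) -(ge0E _ cM (fun=> M0)).
by move=> /addIr.
Qed.

Lemma eq_measure_Rintegral (m1 m2 : {measure set (borel_circle R) -> \bar R}) (f : T -> R) :
  Defs.eq_measure m1 m2 -> \int[m1]_x f x = \int[m2]_x f x.
Proof.
by move=> m12; rewrite /Rintegral (eq_measure_integral m2)// => A mA _; exact: m12.
Qed.

End finite_riesz.

(** * Transforms of probability measures *)

Section eta_transform.
Variable R : realType.
Local Notation C := R[i].
Local Notation T := (circle R).
Implicit Types (mu nu : prob_circle R) (z w : C).

Definition lawf mu : (T -> R) -> R := integral_functional mu.

Lemma lawf_pos mu : pos_functional (lawf mu).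
Proof. exact: (integral_functional_pos mu). Qed.

Lemma lawf1 mu : lawf mu (fun=> 1) = 1.
Proof. by rewrite /lawf integral_functional_mass [X in fine X](probability_setT mu). Qed.

Definition mean_of mu : C := cintegral mu (fun x => (x : C)).

Lemma moment_funE mu z : normc z < 1 -> moment_fun mu z = cauchyT (lawf mu) (fun=> 1) z - 1.
Proof.
move=> z1; have Lp := lawf_pos mu.
have E : cfun (lawf mu) (fun=> 1) = 1 by rewrite (cfun_cst Lp) lawf1 mul1r.
have c1 := continuous_cauchy_kernel (@continuous_cstc R 1) z1.
rewrite -[X in _ - X]E /cauchyT -(cfunB Lp c1 (@continuous_cstc R 1)) /moment_fun.
rewrite -[LHS]/(cfun (lawf mu) _); congr cfun; apply/funext => x.
have d1 := one_sub_circle_neq0 x z1; have d2 : 1 - z * (x : C) != 0 by rewrite mulrC.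
by field; exact: d1.
Qed.

Lemma herg_moment mu z : normc z < 1 -> herg (lawf mu) z = 1 + 2 * moment_fun mu z.
Proof.
move=> z1; rewrite (herg_cauchyT (lawf_pos mu) z1) (moment_funE _ z1) lawf1 rmorph1; ring.
Qed.

Lemma peano_moment mu z : normc z < 1 -> peano (moment_fun mu) z.
Proof.
move=> z1; have d : 0 < 1 - normc z by lra.
apply: (@peano_eq _ (fun z => cauchyT (lawf mu) (fun=> 1) z - 1) _ _ _ d).
  move=> w wz; rewrite moment_funE//.
  have -> : w = (w - z) + z by ring.
  by have := normcD (w - z) z; lra.
apply: peanoB; last exact: peano_cst.
exact: (peano_cauchyT (lawf_pos mu) (@continuous_cstc R 1) z1).
Qed.

Lemma moment_fun0 mu : moment_fun mu 0 = 0.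
Proof.
have n0 : normc (0 : C) < 1 by rewrite normc0.
have := herg_moment mu n0; rewrite (herg0 (lawf_pos mu)) lawf1 => /eqP.
by rewrite rmorph1 eq_sym -subr_eq0 addrC addKr mulf_eq0 pnatr_eq0 /= => /eqP.
Qed.

(** After the linear term, the remainder is h^2 times the Cauchy transform of x^2. *)
Lemma derive1_moment mu : derive1 (moment_fun mu) 0 = mean_of mu.
Proof.
apply: derive1_bigO; rewrite moment_fun0.
have Lp := lawf_pos mu.
pose u (x : T) : C := (x : C) * (x : C).
have cu : continuous u by exact: (continuousMc (@circle_val_continuous R) (@circle_val_continuous R)).
have n0 : normc (0 : C) < 1 by rewrite normc0.
have [p Hp] := peano_cauchyT Lp cu n0 0.
have B0 : bigO 0 (fun h => cauchyT (lawf mu) u (0 + h)).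
  by apply: bigO_ext (bigOD Hp (bigO_poly p)) => h; ring.
apply: (@bigO_eq _ _ (fun h => (h * h) * cauchyT (lawf mu) u (0 + h)) _ 1) => //; last first.
  by have := bigOM (bigOM (bigO_id R) (bigO_id R)) B0; rewrite addn0.
move=> h h1; rewrite !add0r.
have cc := continuous_cauchy_kernel cu h1.
have ci := @circle_val_continuous R.
rewrite subr0 /cauchyT -(cfunZ Lp (h * h) cc) /mean_of -[cintegral mu _]/(cfun (lawf mu) _).
rewrite [cfun _ _ * h]mulrC -(cfunZ Lp h ci).
have ck : continuous (fun x : T => h * (x : C) / (1 - (x : C) * h)).
  exact: (continuous_cauchy_kernel (continuousMc (@continuous_cstc R h) ci) h1).
have -> : moment_fun mu h = cfun (lawf mu) (fun x : T => h * (x : C) / (1 - (x : C) * h)).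
  by rewrite /moment_fun -[LHS]/(cfun (lawf mu) _); congr cfun; apply/funext => x; rewrite (mulrC _ h).
rewrite -(cfunB Lp ck (continuousMc (@continuous_cstc R h) ci)); congr cfun; apply/funext => x.
by rewrite /u; have d1 := one_sub_circle_neq0 x h1; field.
Qed.

Lemma moment_Re mu z : normc z < 1 -> 0 <= 1 + 2 * complex.Re (moment_fun mu z).
Proof.
move=> z1; have := Re_herg_ge0 (lawf_pos mu) z1; rewrite (herg_moment _ z1).
by rewrite ReD -(realc_nat R 2) ReMr.
Qed.

Lemma moment_neq mu z : normc z < 1 -> 1 + moment_fun mu z != 0.
Proof.
move=> z1; have := moment_Re mu z1; apply: contraTneq => /(congr1 (@complex.Re R)).
by rewrite ReD /= => H; rewrite -ltNge; lra.
Qed.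

Definition eta_fun mu z : C := moment_fun mu z / (1 + moment_fun mu z).

Definition B_fun mu : C -> C := dquot (eta_fun mu) 0.

Lemma eta_fun0 mu : eta_fun mu 0 = 0.
Proof. by rewrite /eta_fun moment_fun0 mul0r. Qed.

Lemma B_funE mu z : z * B_fun mu z = eta_fun mu z.
Proof. by have := dquotE (eta_fun mu) 0 z; rewrite eta_fun0 !subr0. Qed.

Lemma peano_eta mu z : normc z < 1 -> peano (eta_fun mu) z.
Proof.
move=> z1; apply: peano_div; [exact: moment_neq|exact: peano_moment|].
by apply: peanoD; [exact: peano_cst|exact: peano_moment].
Qed.

Lemma peano_B mu z : normc z < 1 -> peano (B_fun mu) z.
Proof.
move=> z1; apply: peano_dquot; last exact: peano_eta.
by apply: peano_eta; rewrite normc0.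
Qed.

(** Re m >= - 1/2 says that m is at least as close to 0 as to - 1. *)
Lemma eta_le1 mu z : normc z < 1 -> normc (eta_fun mu z) <= 1.
Proof.
move=> z1; rewrite normc_div ler_pdivrMr ?mul1r ?normc_gt0 ?moment_neq//.
rewrite -(@ler_pXn2r _ 2)// ?nnegrE ?normc_ge0// !normc_sqr.
have := moment_Re mu z1; case: (moment_fun mu z) => a b /=; nra.
Qed.

Lemma eta_le mu z : normc z < 1 -> normc (eta_fun mu z) <= normc z.
Proof.
move=> z1; have n0 : normc (0 : C) < 1 by rewrite normc0.
have O1 : bigO 1 (eta_fun mu).
  have := @jet_bigO1 R 0 (fun h => eta_fun mu (0 + h)) (peano_eta mu n0 1).
  by rewrite addr0 eta_fun0 => /(_ erefl); apply: bigO_ext => h; rewrite add0r.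
have := schwarz ltr01 (fun z => @peano_eta mu z) (fun z => @eta_le1 mu z) O1 z1.
by rewrite divr1 mul1r expr1.
Qed.

Lemma B_le1 mu z : normc z < 1 -> normc (B_fun mu z) <= 1.
Proof.
have nz w : normc w < 1 -> w != 0 -> normc (B_fun mu w) <= 1.
  move=> w1 w0; have nw : 0 < normc w by rewrite normc_gt0.
  by rewrite -(ler_pM2l nw) mulr1 -normcM B_funE eta_le.
move=> z1; have [->|] := eqVneq z 0; last exact: nz.
have r0 : 0 < 2^-1 :> R by rewrite invr_gt0.
have r1 : 2^-1 < 1 :> R by rewrite invf_lt1// ltr1n.
apply: (max_modulus r0); rewrite ?normc0 ?(ltW r0)//.
  by move=> w wr; apply: peano_B; exact: le_lt_trans r1.
by move=> w wr; apply: nz; rewrite ?wr// -normc_gt0 wr.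
Qed.

Lemma peano_eq_at (F G : C -> C) a (d : R) : 0 < d -> peano F a -> peano G a ->
  (forall z, z != a -> normc (z - a) < d -> F z = G z) -> F a = G a.
Proof.
move=> d0 pF pG FG; apply/eqP; rewrite -subr_eq0 -normc_eq0 eq_le normc_ge0 andbT.
apply/ler_addgt0Pr => e e0; rewrite add0r.
have e2 : 0 < e / 2 by rewrite divr_gt0.
have [d1 d10 H1] := peano_continuous pF e2; have [d2 d20 H2] := peano_continuous pG e2.
pose t := Num.min d (Num.min d1 d2) / 2.
have m0 : 0 < Num.min d (Num.min d1 d2) by rewrite !lt_min d0 d10.
have t0 : 0 < t by rewrite divr_gt0.
have tm : t < Num.min d (Num.min d1 d2) by rewrite /t; lra.
move: tm; rewrite !lt_min => /andP[td /andP[td1 td2]].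
have nt : normc ((a + t%:C) - a) = t by rewrite addrC addKr normcR gtr0_norm.
have za : a + t%:C != a by rewrite -subr_eq0 -normc_gt0 nt.
have := H1 (a + t%:C); have := H2 (a + t%:C); have := FG (a + t%:C) za; rewrite nt.
move=> /(_ td) E /(_ td2) h2 /(_ td1) h1; rewrite E in h1.
have -> : F a - G a = (G (a + t%:C) - G a) - (G (a + t%:C) - F a) by ring.
by have := normcB (G (a + t%:C) - G a) (G (a + t%:C) - F a); lra.
Qed.

Lemma Re_cayley (w : C) : normc w < 1 -> 0 <= complex.Re ((1 + w) / (1 - w)).
Proof.
move=> w1; have := @Re_herg_kernel R (circle1 R) w w1; rewrite mul1r => ->.
by rewrite divr_ge0 ?sqr_ge0// subr_ge0 exprn_ile1 ?normc_ge0// ltW.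
Qed.

(* Herglotz' theorem applied to the Cayley transform of [z * b z] *)
Theorem schur_measure (b : C -> C) : (forall z, normc z < 1 -> peano b z) ->
  (forall z, normc z < 1 -> normc (b z) <= 1) ->
  exists mu, forall z, normc z < 1 -> B_fun mu z = b z.
Proof.
move=> pb bb.
have zb z : normc z < 1 -> normc (z * b z) < 1.
  by move=> z1; rewrite normcM; have := bb z z1; have := normc_ge0 z; have := normc_ge0 (b z); nra.
have d0 z : normc z < 1 -> 1 - z * b z != 0.
  by move=> /zb H; rewrite subr_eq0; apply: contraTneq H => <-; rewrite normc_1 ltxx.
pose h z := (1 + z * b z) / (1 - z * b z).
have ph z : normc z < 1 -> peano h z.
  move=> z1; have pz : peano (fun z => z * b z) z by apply: peanoM; [exact: peano_id|exact: pb].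
  by apply: peano_div; [exact: d0|apply: peanoD|apply: peanoB] => //; exact: peano_cst.
have rh z : normc z < 1 -> 0 <= complex.Re (h z) by move=> /zb; exact: Re_cayley.
have h0 : h 0 = 1 by rewrite /h mul0r addr0 subr0 divr1.
have n0 : normc (0 : C) < 1 by rewrite normc0.
have [I Ipos IH] := herglotz ph rh.
have I1 : I (fun=> 1) = 1 by rewrite (herg0_mass Ipos) (IH 0 n0) h0 ReB ReM /=; ring.
have [mu muE] := riesz_circle Ipos I1.
exists mu.
have mE z : normc z < 1 -> eta_fun mu z = z * b z.
  move=> z1; have ck := continuous_herg_kernel z1.
  have hE : herg (lawf mu) z = h z.
    have -> : h z = herg I z by rewrite IH// h0 /= mulr0 subr0.
    rewrite /herg /cfun; congr (_ +i* _); apply: muE.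
      exact: (continuous_Rec ck).
    exact: (continuous_Imc ck).
  have := herg_moment mu z1; rewrite hE /h => E.
  have d := d0 z z1; have m := moment_neq mu z1; rewrite /eta_fun.
  have -> : moment_fun mu z = z * b z / (1 - z * b z).
    have n2 : (2 : C) != 0 by rewrite pnatr_eq0.
    apply: (mulfI n2); have -> : 2 * moment_fun mu z = (1 + z * b z) / (1 - z * b z) - 1.
      by rewrite E; ring.
    by field.
  by field; rewrite d /= subrK oner_neq0.
have zE z : z != 0 -> normc z < 1 -> B_fun mu z = b z.
  by move=> z0 z1; apply: (mulfI z0); rewrite B_funE mE.
move=> z z1; have [->|z0] := eqVneq z 0; last exact: zE.
apply: (@peano_eq_at _ _ 0 1); rewrite ?ltr01//; [exact: peano_B|exact: pb|].
by move=> w w0; rewrite subr0; exact: zE.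
Qed.

End eta_transform.

(** * Germs of the T-transforms *)

Section transform_germs.
Variable R : realType.
Local Notation C := R[i].
Implicit Types (mu nu : prob_circle R) (z w u : C) (F G : C -> C).

Lemma near0_ball (d : R) : 0 < d -> \forall z \near (0 : C), normc z < d.
Proof. by move=> d0; apply/near0CP; exists d. Qed.

Lemma near0_comp (phi : C -> C) (P : C -> Prop) : peano phi 0 -> phi 0 = 0 ->
  (\forall z \near (0 : C), P z) -> \forall w \near (0 : C), P (phi w).
Proof.
move=> pphi phi0 /near0CP[d d0 dP].
have [e e0 H] := peano_continuous pphi d0.
apply/near0CP; exists e => // w we; apply: dP.
by have := H w; rewrite phi0 !subr0; apply.
Qed.

Lemma near0_at (P : C -> Prop) : (\forall z \near (0 : C), P z) -> P 0.
Proof. by move=> /near0CP[d d0]; apply; rewrite normc0. Qed.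

Lemma near0_peano_eq F G : (\forall z \near (0 : C), F z = G z) ->
  (\forall z \near (0 : C), peano G z) -> \forall z \near (0 : C), peano F z.
Proof.
move=> /near0CP[d d0 FG] /near0CP[e e0 pG].
apply/near0CP; exists (Num.min d e); first by rewrite lt_min d0.
move=> z; rewrite lt_min => /andP[zd ze].
have dz : 0 < d - normc z by rewrite subr_gt0.
apply: (peano_eq dz _ (pG z ze)) => w wz; apply/esym/FG.
have -> : w = (w - z) + z by ring.
by have := normcD (w - z) z; lra.
Qed.

Lemma near0_peano_inj F G : peano F 0 -> peano G 0 ->
  (\forall z \near (0 : C), z != 0 -> F z = G z) -> F 0 = G 0.
Proof.
move=> pF pG /near0CP[d d0 FG]; apply: (peano_eq_at d0 pF pG) => z z0.
by rewrite subr0 => /FG; exact.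
Qed.

Lemma near0_analytic F : (\forall z \near (0 : C), peano F z) -> analytic0 F.
Proof. by apply: filterS => z; exact: peano_derivable. Qed.

Lemma dquot_div_id F z : F 0 = 0 -> div_id F z = dquot F 0 z.
Proof. by move=> F0; rewrite /div_id /dquot F0 !subr0. Qed.

Definition germ_inverse nu (chi : C -> C) := [/\ chi 0 = 0,
  \forall w \near (0 : C), [/\ normc (chi w) < 1, moment_fun nu (chi w) = w & peano chi w] &
  \forall u \near (0 : C), chi (moment_fun nu u) = u].

(** The derivative of the moment function at 0 is the mean. *)
Lemma germ_inverse_exists nu : nonzero_mean nu -> exists chi, germ_inverse nu chi.
Proof.
move=> m0; have [|r [e [chi [/andP[r0 r1] e0 chi0 H [H1 _]]]]] :=
    local_inverse ltr01 (fun z => @peano_moment R nu z) (moment_fun0 nu).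
  by rewrite derive1_moment.
exists chi; split=> //.
  apply: filterS (near0_ball e0) => w /H[h1 h2 h3]; split=> //; exact: lt_le_trans r1.
have n0 : normc (0 : C) < 1 by rewrite normc0.
apply: filterS2 (near0_ball r0) (near0_comp (peano_moment nu n0) (moment_fun0 nu) (near0_ball e0)).
by move=> u; exact: H1.
Qed.

Section pair.
Variables (mu nu : prob_circle R) (chi : C -> C).
Hypotheses (nu0 : nonzero_mean nu) (chiP : germ_inverse nu chi).

Let n0 : normc (0 : C) < 1. Proof. by rewrite normc0. Qed.
Let m := moment_fun nu.
Let f u := u * (1 + m u).

Let pf u : normc u < 1 -> peano f u.
Proof.
move=> u1; apply: peanoM; first exact: peano_id.
by apply: peanoD; [exact: peano_cst|exact: peano_moment].
Qed.

Let f0 : f 0 = 0. Proof. by rewrite /f mul0r. Qed.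

Let df0 : derive1 f 0 = 1.
Proof.
apply: derive1_bigO; rewrite f0.
have O1 : bigO 1 m.
  have := @jet_bigO1 R 0 (fun h => m (0 + h)) (peano_moment nu n0 1).
  by rewrite addr0 /m moment_fun0 => /(_ erefl); apply: bigO_ext => h; rewrite add0r.
by apply: bigO_ext (bigOM (bigO_id R) O1) => h; rewrite /f add0r; ring.
Qed.

Let Ginv : exists G, [/\ G 0 = 0, \forall z \near (0 : C), [/\ normc (G z) < 1, f (G z) = z & peano G z] &
  \forall u \near (0 : C), G (f u) = u].
Proof.
have [|r [e [G [/andP[r0 r1] e0 G0 H [H1 _]]]]] := local_inverse ltr01 pf f0.
  by rewrite df0 oner_neq0.
exists G; split=> //.
  apply: filterS (near0_ball e0) => w /H[h1 h2 h3]; split=> //; exact: lt_le_trans r1.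
apply: filterS2 (near0_ball r0) (near0_comp (pf n0) f0 (near0_ball e0)).
by move=> u; exact: H1.
Qed.

(* The germs behind [R_transform] and [cR_transform] exist and are unique because
   [f u = u * (1 + m u)] is locally invertible. *)
Let transfer (Q : C -> C -> Prop) (h : C -> C) :
  (forall u, normc u < 1 -> peano h u) ->
  (forall u, normc u < 1 -> forall y, Q u y <-> y = h u) ->
  let F := xget (fun=> 0) [set F | analytic0 F /\ \forall u \near (0 : C), Q u (F (f u))] in
  (\forall u \near (0 : C), F (f u) = h u) /\ (\forall z \near (0 : C), peano F z).
Proof.
move=> ph Qh F; have [G [G0 GP Gf]] := Ginv.
have pG0 : peano G 0 by case: (near0_at GP).
have [aF FP] : analytic0 F /\ \forall u \near (0 : C), Q u (F (f u)).
  apply: (@xgetPex _ (fun=> 0) [set F | analytic0 F /\ \forall u \near (0 : C), Q u (F (f u))]).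
  exists (fun z => h (G z)); split.
    apply: near0_analytic; apply: filterS GP => z [G1 _ pG].
    by apply: peano_comp => //; exact: ph.
  apply: filterS2 Gf (near0_ball ltr01) => u Gfu u1.
  by apply/Qh => //; rewrite Gfu.
have Fh : \forall u \near (0 : C), F (f u) = h u.
  by apply: filterS2 FP (near0_ball ltr01) => u Qu u1; apply/Qh.
split=> //.
apply: (@near0_peano_eq _ (fun z => h (G z))).
  apply: filterS2 GP (near0_comp pG0 G0 Fh) => z [_ fG _] E.
  by rewrite -E fG.
by apply: filterS GP => z [G1 _ pG]; apply: peano_comp => //; exact: ph.
Qed.

Let R_near : (\forall u \near (0 : C), R_transform nu (f u) = m u) /\
  (\forall z \near (0 : C), peano (R_transform nu) z).
Proof.
apply: (transfer (Q := fun u y => y = moment_fun nu u)) => // u u1.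
exact: peano_moment.
Qed.

Let h1 u := m u.
Let hc u := eta_fun mu u * (1 + m u).

Let cR_near : (\forall u \near (0 : C), cR_transform mu nu (f u) = hc u) /\
  (\forall z \near (0 : C), peano (cR_transform mu nu) z).
Proof.
apply: (transfer (Q := fun u y => y * (1 + moment_fun mu u) = moment_fun mu u * (1 + moment_fun nu u))).
  move=> u u1; apply: peanoM; first exact: peano_eta.
  by apply: peanoD; [exact: peano_cst|exact: peano_moment].
move=> u u1 y; have d := moment_neq mu u1; rewrite /hc /eta_fun /m; split.
  by move=> E; apply: (mulIf d); rewrite E; field.
by move=> ->; field.
Qed.

Let peano_chi0 : peano chi 0. Proof. by case: chiP => _ /near0_at[]. Qed.
Let chi0 : chi 0 = 0. Proof. by case: chiP. Qed.

Let fchi w := f (chi w).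
Let fchi0 : fchi 0 = 0. Proof. by rewrite /fchi chi0 f0. Qed.
Let peano_fchi : \forall w \near (0 : C), peano fchi w.
Proof.
case: chiP => _ H _; apply: filterS H => w [c1 _ pc]; apply: peano_comp => //.
exact: pf.
Qed.

(** R o f = m and m o chi = id, so f o chi inverts R; the chosen representative inverts R too and
    must agree with it near 0. *)
Let inv0_near : \forall w \near (0 : C), Defs.inv0 (R_transform nu) w = fchi w.
Proof.
have [RP pR] := R_near; have [_ chiP2 chiP3] := chiP; have [G [G0 GP Gf]] := Ginv.
have pG0 : peano G 0 by case: (near0_at GP).
have R0 : R_transform nu 0 = 0 by have := near0_at RP; rewrite f0 /m moment_fun0.
have pf0 : peano fchi 0 by exact: (near0_at peano_fchi).
have RK : \forall w \near (0 : C), R_transform nu (fchi w) = w.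
  apply: filterS2 chiP2 (near0_comp peano_chi0 chi0 RP) => w [_ mc _] E.
  by rewrite /fchi E.
have [|aK K0 RK' KR] := @xgetPex _ (fun=> 0) [set K : C -> C | [/\ analytic0 K, K 0 = 0,
  \forall z \near (0 : C), R_transform nu (K z) = z & \forall z \near (0 : C), K (R_transform nu z) = z]].
  exists fchi; split=> //; first exact: near0_analytic.
  have GE := near0_comp pG0 G0 RP.
  apply: filterS3 GP GE (near0_comp pG0 G0 chiP3) => z [_ fG _] RG cG.
  by move: RG; rewrite fG => ->; rewrite /fchi cG fG.
apply: filterS2 RK (near0_comp pf0 fchi0 KR) => w E E'.
by rewrite E in E'.
Qed.

(** R o f = u (1 + m) B_nu and cR o f = u (1 + m) B_mu, where u (1 + m) is f itself: dividing by f
    and substituting chi leaves B_nu o chi and B_mu o chi. At w = 0 the quotient is a derivative,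
    and continuity decides. *)
Lemma transform_germ : \forall w \near (0 : C),
  [/\ T_transform nu w = B_fun nu (chi w), cT_transform mu nu w = B_fun mu (chi w),
      peano (T_transform nu) w & peano (cT_transform mu nu) w].
Proof.
have [RP pR] := R_near; have [cRP pcR] := cR_near; have [_ chiP2 chiP3] := chiP.
have R0 : R_transform nu 0 = 0 by have := near0_at RP; rewrite f0 /m moment_fun0.
have cR0 : cR_transform mu nu 0 = 0.
  by have := near0_at cRP; rewrite f0 /hc eta_fun0 mul0r.
have pf0 : peano fchi 0 by exact: (near0_at peano_fchi).
have main (F : C -> C) (h : C -> C) (rho : prob_circle R) : F 0 = 0 ->
    (\forall z \near (0 : C), peano F z) ->
    (\forall u \near (0 : C), F (f u) = u * (1 + m u) * B_fun rho u) ->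
    \forall w \near (0 : C), div_id F (Defs.inv0 (R_transform nu) w) = B_fun rho (chi w) /\
      peano (fun w => div_id F (Defs.inv0 (R_transform nu) w)) w.
  move=> F0 pF FP.
  have E : \forall w \near (0 : C), div_id F (Defs.inv0 (R_transform nu) w) = dquot F 0 (fchi w).
    by apply: filterS inv0_near => w ->; exact: dquot_div_id.
  have pF0 := near0_at pF.
  have pD : \forall w \near (0 : C), peano (fun w => dquot F 0 (fchi w)) w.
    apply: filterS2 peano_fchi (near0_comp pf0 fchi0 pF) => w pw pFw.
    by apply: peano_comp => //; exact: peano_dquot.
  have EB : \forall w \near (0 : C), w != 0 -> dquot F 0 (fchi w) = B_fun rho (chi w).
    apply: filterS2 chiP2 (near0_comp peano_chi0 chi0 FP) => w [c1 mc pc] Fw w0.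
    have cw0 : chi w != 0.
      by apply: contra_neq w0 => c0; rewrite -mc c0 moment_fun0.
    have f0' : fchi w != 0 by rewrite mulf_neq0// moment_neq.
    by apply: (mulfI f0'); have := dquotE F 0 (fchi w); rewrite F0 !subr0 => ->; exact: Fw.
  have EB0 : dquot F 0 (fchi 0) = B_fun rho (chi 0).
    apply: (@near0_peano_inj (fun w => dquot F 0 (fchi w)) (fun w => B_fun rho (chi w))) => //.
      exact: (near0_at pD).
    by apply: peano_comp => //; rewrite chi0; exact: peano_B.
  have pE := near0_peano_eq E pD.
  apply: filterS3 E EB pE => w -> H pw; split=> //.
  by have [->|/H] := eqVneq w 0.
have TP := main _ h1 nu R0 pR.
have cTP := main _ hc mu cR0 pcR.
have t1 : \forall u \near (0 : C), R_transform nu (f u) = u * (1 + m u) * B_fun nu u.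
  apply: filterS2 RP (near0_ball ltr01) => u -> u1; rewrite mulrAC B_funE /eta_fun.
  by rewrite -/m mulfVK//; exact: moment_neq.
have t2 : \forall u \near (0 : C), cR_transform mu nu (f u) = u * (1 + m u) * B_fun mu u.
  by apply: filterS cRP => u ->; rewrite mulrAC B_funE.
by apply: filterS2 (TP t1) (cTP t2) => w [? ?] [? ?]; split.
Qed.

End pair.

End transform_germs.

(** * Inverting the moment function; logarithms and roots of germs *)

Section psi_germs.
Variable R : realType.
Local Notation C := R[i].
Implicit Types (mu nu : prob_circle R) (z w u : C) (F G : C -> C).

Lemma near0_neq F : peano F 0 -> F 0 != 0 -> \forall w \near (0 : C), F w != 0.
Proof.
move=> pF F0; have n0 : 0 < normc (F 0) by rewrite normc_gt0.
have [d d0 H] := peano_continuous pF n0; apply/near0CP; exists d => // w wd.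
have := H w; rewrite subr0 => /(_ wd); apply: contraTneq => ->.
by rewrite sub0r normc_opp ltxx.
Qed.

(* For the T-transform [T], [psi T w] is the point where the moment function
   takes the value [w]. *)
Definition psi (tau : C -> C) (w : C) : C := w / ((1 + w) * tau w).

Lemma psi0 tau : psi tau 0 = 0. Proof. by rewrite /psi mul0r. Qed.

Lemma addr1_neq0 w : normc w < 1 -> 1 + w != 0.
Proof.
move=> w1; rewrite -normc_gt0; have := normcD_ge 1 w; rewrite normc_1; lra.
Qed.

Lemma oner_sub_neq0 w : normc w < 1 -> 1 - w != 0.
Proof. by move=> w1; apply: addr1_neq0; rewrite normc_opp. Qed.

Lemma peano_moebius w : normc w < 1 -> peano (fun w => w / (1 + w)) w.
Proof.
move=> w1; apply: peano_div; [exact: addr1_neq0|exact: peano_id|].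
by apply: peanoD; [exact: peano_cst|exact: peano_id].
Qed.

Lemma near0_moebius (P : C -> Prop) : (\forall z \near (0 : C), P z) ->
  \forall w \near (0 : C), P (w / (1 + w)).
Proof.
apply: (@near0_comp R (fun w => w / (1 + w))); last by rewrite mul0r.
by apply: peano_moebius; rewrite normc0.
Qed.

Lemma near0_moebius_inv (P : C -> Prop) : (\forall z \near (0 : C), P z) ->
  \forall z \near (0 : C), P (z / (1 - z)).
Proof.
apply: (@near0_comp R (fun z => z / (1 - z))); last by rewrite mul0r.
apply: peano_div; [by rewrite subr0 oner_neq0|exact: peano_id|].
by apply: peanoB; [exact: peano_cst|exact: peano_id].
Qed.

Lemma peano_psi tau w : normc w < 1 -> tau w != 0 -> peano tau w -> peano (psi tau) w.
Proof.
move=> w1 t0 pt; apply: peano_div; [|exact: peano_id|].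
  by rewrite mulf_neq0// addr1_neq0.
by apply: peanoM => //; apply: peanoD; [exact: peano_cst|exact: peano_id].
Qed.

(** eta = m - m^2/(1 + m) with m = O(h), so eta and m have the same derivative at 0. *)
Lemma B_fun0 nu : B_fun nu 0 = mean_of nu.
Proof.
rewrite /B_fun /dquot eqxx; apply: derive1_bigO; rewrite eta_fun0.
have n0 : normc (0 : C) < 1 by rewrite normc0.
have := peano_bigO2 (peano_moment nu n0); rewrite moment_fun0 derive1_moment => Om.
have O1 : bigO 1 (moment_fun nu).
  have := @jet_bigO1 R 0 (fun h => moment_fun nu (0 + h)) (peano_moment nu n0 1).
  by rewrite addr0 moment_fun0 => /(_ erefl); apply: bigO_ext => h; rewrite add0r.
have B0 : bigO 0 (fun h => (1 + moment_fun nu h)^-1).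
  have pV : peano (fun h => (1 + moment_fun nu h)^-1) 0.
    apply: peanoV; first exact: moment_neq.
    by apply: peanoD; [exact: peano_cst|exact: peano_moment].
  have [p Hp] := pV 0.
  by apply: bigO_ext (bigOD Hp (bigO_poly p)) => h; rewrite add0r; ring.
have O2 := bigOM (bigOM O1 O1) B0; rewrite addn0 in O2.
apply: (@bigO_eq _ _ (fun h => (moment_fun nu (0 + h) - 0 - mean_of nu * h) -
   (moment_fun nu h * moment_fun nu h) * (1 + moment_fun nu h)^-1) _ 1) => //.
  move=> h h1; rewrite !add0r /eta_fun; have := moment_neq nu h1.
  by move: (moment_fun nu h) => a a0; field.
exact: bigOB Om O2.
Qed.

Lemma transform_psi mu nu : nonzero_mean nu -> \forall w \near (0 : C),
  [/\ T_transform nu w != 0, moment_fun nu (psi (T_transform nu) w) = w &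
      B_fun mu (psi (T_transform nu) w) = cT_transform mu nu w].
Proof.
move=> nu0; have [chi chiP] := germ_inverse_exists nu0.
have tg := transform_germ mu chiP; have [chi0 chiP2 _] := chiP.
have [T0 _ pT _] := near0_at tg.
have Tn0 : \forall w \near (0 : C), T_transform nu w != 0.
  by apply: near0_neq => //; rewrite T0 chi0 B_fun0.
apply: filterS2 (filterI Tn0 (near0_ball ltr01)) (filterI tg chiP2) => w [Tw0 w1].
move=> [[Tw cTw _ _] [c1 mc _]].
have E : psi (T_transform nu) w = chi w.
  have w10 := addr1_neq0 w1; rewrite /psi.
  have : chi w * B_fun nu (chi w) = w / (1 + w) by rewrite B_funE /eta_fun mc.
  rewrite -Tw => H; apply: (mulIf Tw0); rewrite H.
  by move: (T_transform nu w) Tw0 => t t0; field; rewrite t0 w10.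
by rewrite E.
Qed.

(** A local inverse of exp - 1 is applied to F/F(0) - 1; the prescribed value l selects the
    branch. *)
Lemma log_germ F l : (\forall z \near (0 : C), peano F z) -> cexp l = F 0 ->
  exists lam : C -> C, [/\ lam 0 = l, \forall w \near (0 : C), peano lam w &
    \forall w \near (0 : C), F w = cexp (lam w)].
Proof.
move=> pF Fl; have F0 : F 0 != 0 by rewrite -Fl cexp_neq0.
pose E (z : C) := cexp z - 1.
have pE z : normc z < 1 -> peano E z.
  by move=> _; apply: peanoB; [exact: peano_cexp|exact: peano_cst].
have E0 : E 0 = 0 by rewrite /E cexp0 subrr.
have dE : derive1 E 0 != 0.
  rewrite (_ : derive1 E 0 = 1) ?oner_neq0//; apply: derive1_bigO.
  have := peano_bigO2 (peano_cexp (0 : C)); rewrite derive1_cexp0 cexp0.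
  by apply: bigO_ext => h; rewrite /E cexp0; ring.
have [r [e [L [r0 e0 L0 H _]]]] := local_inverse ltr01 pE E0 dE.
pose v w := F w / F 0 - 1.
have pv : \forall w \near (0 : C), peano v w.
  apply: filterS pF => w pw; apply: peanoB; last exact: peano_cst.
  by apply: peanoM => //; exact: peano_cst.
have v0 : v 0 = 0 by rewrite /v divff// subrr.
have pv0 : peano v 0 by exact: (near0_at pv).
have ve := near0_comp pv0 v0 (near0_ball e0).
exists (fun w => l + L (v w)); split.
- by rewrite v0 L0 addr0.
- apply: filterS2 pv ve => w pw /H[_ _ pL]; apply: peanoD; first exact: peano_cst.
  exact: peano_comp.
- apply: filterS ve => w /H[_ EL _]; rewrite cexpD Fl.
  have -> : cexp (L (v w)) = 1 + v w by move: EL => /(congr1 (fun x => 1 + x)) <-; rewrite /E subrKC.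
  by rewrite /v subrKC mulrC divfK.
Qed.

(** With q = F/G and c = q(0), q^n - c^n = (q - c) S vanishes near 0, and S(0) = n c^(n-1) is not
    0. *)
Lemma root_germ F G n : (0 < n)%N -> peano F 0 -> peano G 0 -> G 0 != 0 ->
  (\forall w \near (0 : C), F w ^+ n = G w ^+ n) ->
  exists c, c ^+ n = 1 /\ \forall w \near (0 : C), F w = c * G w.
Proof.
move=> n0 pF pG G0 FG; pose q w := F w / G w.
have pq : peano q 0 by exact: peano_div.
have qn : \forall w \near (0 : C), q w ^+ n = 1.
  apply: filterS2 FG (near0_neq pG G0) => w E Gw.
  by rewrite /q expr_div_n E divff// expf_neq0.
pose c := q 0; have cn : c ^+ n = 1 by exact: (near0_at qn).
have c0 : c != 0.
  by apply: contra_eq_neq cn => ->; rewrite expr0n gtn_eqF// eq_sym oner_neq0.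
pose S w := \sum_(i < n) q w ^+ (n.-1 - i) * c ^+ i.
have pS : peano S 0.
  by apply: peano_sum => i; apply: peanoM; [exact: peanoX|exact: peano_cst].
have S0 : S 0 != 0.
  rewrite /S (eq_bigr (fun=> c ^+ n.-1)); last first.
    by move=> i _; rewrite -/c -exprD subnK// -ltnS prednK.
  by rewrite sumr_const card_ord -mulr_natl mulf_neq0 ?expf_neq0// pnatr_eq0 -lt0n.
exists c; split=> //.
apply: filterS3 qn (near0_neq pS S0) (near0_neq pG G0) => w qw Sw Gw.
have : (q w - c) * S w = 0 by rewrite /S -subrXX qw cn subrr.
move=> /eqP; rewrite mulf_eq0 (negbTE Sw) orbF subr_eq0 => /eqP <-.
by rewrite /q divfK.
Qed.

Lemma normc_root_unit (c : C) n : (0 < n)%N -> c ^+ n = 1 -> normc c = 1.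
Proof.
move=> n0 /(congr1 (@normc R)); rewrite normcX normc_1 => /eqP.
by rewrite pexpr_eq1 ?normc_ge0// => /eqP.
Qed.

Lemma herg_lipschitz (I : (circle R -> R) -> R) (r : R) (z w : C) : pos_functional I ->
  0 <= r < 1 -> normc z <= r -> normc w <= r ->
  normc (herg I z - herg I w) <= 4 / (1 - r) ^+ 2 * I (fun=> 1) * normc (z - w).
Proof.
move=> Ipos /andP[r0 r1] zr wr; have z1 : normc z < 1 by lra.
have w1 : normc w < 1 by lra.
have cz := continuous_herg_kernel z1; have cw := continuous_herg_kernel w1.
rewrite /herg -(cfunB Ipos cz cw).
have cB := continuousDc cz (continuousNc cw).
have -> : 4 / (1 - r) ^+ 2 * I (fun=> 1) * normc (z - w) =
  2 * (2 / (1 - r) ^+ 2 * normc (z - w)) * I (fun=> 1) by ring.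
apply: (cfun_le_norm Ipos cB) => x.
have d1 := one_sub_circle_neq0 x z1; have d2 := one_sub_circle_neq0 x w1.
have -> : (1 + (x : C) * z) / (1 - (x : C) * z) - (1 + (x : C) * w) / (1 - (x : C) * w) =
   2 * (x : C) * (z - w) / ((1 - (x : C) * z) * (1 - (x : C) * w)).
  by field; rewrite d1 d2.
have l1 := cauchy_kernel_lb x z; have l2 := cauchy_kernel_lb x w.
have r10 : 0 < 1 - r by lra.
have k1 : 1 - r <= normc (1 - (x : C) * z) by lra.
have k2 : 1 - r <= normc (1 - (x : C) * w) by lra.
rewrite normc_div !normcM normc_nat normc_circle mulr1 mulrAC ler_wpM2r ?normc_ge0//.
rewrite ler_wpM2l// lef_pV2 ?posrE ?mulr_gt0 ?exprn_gt0 ?(lt_le_trans r10)//.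
by rewrite expr2 ler_pM ?(ltW r10).
Qed.

Lemma cvg_exp_scaled (S : Type) (F : set_system S) (FF : Filter F) (a : S -> R) (k : C) :
  a s @[s --> F] --> (0 : R) -> (\forall s \near F, a s != 0) ->
  (1 - cexp ((a s)%:C * k)) / (a s)%:C @[s --> F] --> - k.
Proof.
move=> a0 an0; have := peano_bigO2 (peano_cexp (0 : C)); rewrite derive1_cexp0 cexp0.
move=> /bigO_pos[K [d [K0 d0 _ H]]].
apply/cvgCP => e e0; set N := normc k; have N0 : 0 <= N := normc_ge0 _.
have N1 : 0 < N + 1 by lra.
have m0 : 0 < Num.min (d / (N + 1)) (e / (K * (N + 1) ^+ 2)).
  by rewrite lt_min !divr_gt0// mulr_gt0// exprn_gt0.
have /cvgrPdist_lt/(_ _ m0) := a0; apply: filterS2 an0 => s as0.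
rewrite sub0r normrN lt_min => /andP[].
rewrite !ltr_pdivlMr ?mulr_gt0 ?exprn_gt0// => h1 h2.
have ac0 : (a s)%:C != 0 :> C by apply: contra_neq as0 => /(congr1 (@complex.Re R)).
have nak : normc ((a s)%:C * k) = `|a s| * N by rewrite normcM normcR.
have akd : normc ((a s)%:C * k) < d.
  by rewrite nak; apply: le_lt_trans h1; rewrite ler_wpM2l// lerDl.
have := H _ akd; rewrite add0r mul1r nak => h3.
have -> : (1 - cexp ((a s)%:C * k)) / (a s)%:C - - k =
   - ((cexp ((a s)%:C * k) - 1 - (a s)%:C * k) / (a s)%:C) by field.
have na : 0 < `|a s| by rewrite normr_gt0.
rewrite normc_opp normc_div normcR ltr_pdivrMr//; apply: le_lt_trans h3 _.
have e1 : `|a s| * (K * N ^+ 2) < e.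
  apply: le_lt_trans h2; rewrite ler_wpM2l// ler_wpM2l ?(ltW K0)//.
  by rewrite lerXn2r ?nnegrE ?(ltW N1)// lerDl.
by rewrite exprMn; nra.
Qed.

End psi_germs.

(** * Infinitely divisible pairs and semigroups *)

Section levy_khintchine.
Variable R : realType.
Local Notation C := R[i].
Implicit Types (mu nu : prob_circle R) (z w u : C) (tau kap : C -> C) (s d : R).

(** If exp(s tau) is the T-transform of a measure, this is where its moment function takes the value
    w. *)
Definition psie tau s : C -> C := psi (fun w => cexp (s%:C * tau w)).

Lemma psie0 tau s : psie tau s 0 = 0. Proof. exact: psi0. Qed.

Lemma peano_psie tau s w : normc w < 1 -> peano tau w -> peano (psie tau s) w.
Proof.
move=> w1 pt; apply: peano_psi => //; first exact: cexp_neq0.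
apply: (@peano_comp _ (@cexp R) (fun w => s%:C * tau w)); first exact: peano_cexp.
by apply: peanoM => //; exact: peano_cst.
Qed.

(* On the disk of radius [d] all the functions [psie tau s], [0 <= s <= S], are
   analytic and take values in the disk of radius 1/2. *)
Definition good_radius tau kap (S d : R) := [/\ 0 < d, d <= 2^-1,
  forall w, normc w < d -> peano tau w /\ peano kap w &
  forall s w, 0 <= s <= S -> normc w < d -> normc (psie tau s w) <= 2^-1].

Lemma good_radius_exists tau kap S : 0 <= S ->
  (\forall w \near (0 : C), peano tau w) -> (\forall w \near (0 : C), peano kap w) ->
  exists d, good_radius tau kap S d.
Proof.
move=> S0 pt pk; have pt0 := near0_at pt.
have [d2 d20 H2] := peano_continuous pt0 ltr01.
have /near0CP[d1 d10 H1] : \forall w \near (0 : C), peano tau w /\ peano kap w.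
  by apply: filterS2 pt pk.
pose M := normc (tau 0) + 1; have M0 : 0 < M by rewrite ltr_wpDl ?normc_ge0.
(* For |w| < d one has |tau w| <= M, hence |exp(s tau)| >= exp(- S M), and |1 + w| >= 1/2; the
   factor 1/4 then leaves 1/2 for the quotient. *)
pose d := Num.min (Num.min d1 d2) (Num.min 2^-1 ((expR (S * M))^-1 / 4)).
have d0 : 0 < d by rewrite !lt_min d10 d20 invr_gt0 divr_gt0 ?invr_gt0 ?expR_gt0//= ltr0n.
have dd1 : d <= d1 by rewrite !ge_min lexx.
have dd2 : d <= d2 by rewrite !ge_min lexx orbT.
have dd3 : d <= 2^-1 by rewrite !ge_min lexx orbT.
have dd4 : d <= (expR (S * M))^-1 / 4 by rewrite !ge_min lexx !orbT.
exists d; split=> // [w wd|s w /andP[s0 sS] wd]; first by apply: H1; exact: lt_le_trans dd1.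
have tM : normc (tau w) <= M.
  have := H2 w; rewrite subr0 => /(_ (lt_le_trans wd dd2)) h.
  have -> : tau w = tau 0 + (tau w - tau 0) by ring.
  by have := normcD (tau 0) (tau w - tau 0); rewrite /M; lra.
have w12 : 2^-1 <= normc (1 + w) by have := normcD_ge 1 w; rewrite normc_1; lra.
have w0 := normc_ge0 w.
have SM : 0 <= S * M by rewrite mulr_ge0 // ltW.
set E := normc (cexp (s%:C * tau w)).
have El : (expR (S * M))^-1 <= E.
  rewrite /E normc_cexp ReMr -expRN ler_expR.
  have := normc_Re (tau w); rewrite ler_norml => /andP[h _]; nra.
have E0 : 0 < E by rewrite normc_gt0 cexp_neq0.
rewrite /psie /psi normc_div normcM -/E ler_pdivrMr ?mulr_gt0//; last by lra.
nra.
Qed.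

Lemma psi_scale (tau : C -> C) (c w : C) : psi (fun w => c * tau w) w = c^-1 * psi tau w.
Proof. by rewrite /psi !invfM; ring. Qed.

Lemma psi_eq (t1 t2 : C -> C) w : t1 w = t2 w -> psi t1 w = psi t2 w.
Proof. by rewrite /psi => ->. Qed.

(** The last hypothesis lives on a neighbourhood depending on the measures. The rotated point stays
    in the disk of radius 1/2, so both sides are analytic on |w| < d, with d depending on tau, kap
    and S only, and the identity theorem applies. *)
Lemma uniform_disk mu nu tau kap s S d (c e : C) : nonzero_mean nu ->
  good_radius tau kap S d -> 0 <= s <= S -> normc c = 1 ->
  (\forall w \near (0 : C), T_transform nu w = c * cexp (s%:C * tau w) /\
     cT_transform mu nu w = e * cexp (s%:C * kap w)) ->
  forall w, normc w < d -> moment_fun nu (c^-1 * psie tau s w) = w /\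
    B_fun mu (c^-1 * psie tau s w) = e * cexp (s%:C * kap w).
Proof.
move=> nu0 [d0 d2 pk bt] s01 c1 H.
have d1 : d < 1 by apply: le_lt_trans d2 _; rewrite invf_lt1// ltr1n.
have in1 w : normc w < d -> normc (c^-1 * psie tau s w) < 1.
  move=> wd; rewrite normcM normcV c1 invr1 mul1r; apply: le_lt_trans (bt s w s01 wd) _.
  by rewrite invf_lt1// ltr1n.
have pp w : normc w < d -> peano (fun w => c^-1 * psie tau s w) w.
  move=> wd; apply: peanoM; first exact: peano_cst.
  by apply: peano_psie; [exact: lt_trans d1|exact: (pk w wd).1].
have /near0CP[r r0 rP] : \forall w \near (0 : C),
    moment_fun nu (c^-1 * psie tau s w) = w /\
    B_fun mu (c^-1 * psie tau s w) = e * cexp (s%:C * kap w).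
  apply: filterS2 (transform_psi mu nu0) H => w [_ mp Bp] [TE cTE].
  have E : psi (T_transform nu) w = c^-1 * psie tau s w.
    by rewrite (@psi_eq _ (fun w => c * cexp (s%:C * tau w)))// psi_scale.
  by rewrite -E Bp mp cTE.
move=> w wd; split.
  apply: (identity_theorem r0 (F := fun w => moment_fun nu (c^-1 * psie tau s w)) (G := id) _ _ _ wd).
  - by move=> z zd; apply: peano_comp; [apply: peano_moment; exact: in1|exact: pp].
  - by move=> z _; exact: peano_id.
  - by move=> z /rP[].
apply: (identity_theorem r0 (F := fun w => B_fun mu (c^-1 * psie tau s w))
  (G := fun w => e * cexp (s%:C * kap w)) _ _ _ wd).
- by move=> z zd; apply: peano_comp; [apply: peano_B; exact: in1|exact: pp].
- move=> z zd; apply: peanoM; first exact: peano_cst.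
  apply: (@peano_comp _ (@cexp R)); first exact: peano_cexp.
  by apply: peanoM; [exact: peano_cst|exact: (pk z zd).2].
- by move=> z /rP[].
Qed.

Lemma cvg_psie (S : Type) (F : set_system S) (FF : Filter F) (a : S -> R) tau s w :
  normc w < 1 -> a t @[t --> F] --> s -> psie tau (a t) w @[t --> F] --> psie tau s w.
Proof.
move=> w1 ac; have w10 := addr1_neq0 w1.
have pE : peano (fun z => w / ((1 + w) * cexp (z * tau w))) (s%:C).
  apply: peano_div; [by rewrite mulf_neq0// cexp_neq0|exact: peano_cst|].
  apply: peanoM; first exact: peano_cst.
  apply: (@peano_comp _ (@cexp R) (fun z => z * tau w)); first exact: peano_cexp.
  by apply: peanoM; [exact: peano_id|exact: peano_cst].
apply/cvgCP => e e0; have [d d0 H] := peano_continuous pE e0.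
have /cvgrPdist_lt/(_ d d0) := ac; apply: filterS => t td; apply: (H (a t)%:C).
by rewrite -rmorphB normcR distrC.
Qed.

Lemma psie_0 tau w : psie tau 0 w = w / (1 + w).
Proof. by rewrite /psie /psi mul0r cexp0 mulr1. Qed.

(** Transforms of bounded mass are uniformly Lipschitz inside the disk, so trading y t for its limit
    x costs o(1). *)
Lemma cvg_herg_moving (S : Type) (F : set_system S) (FF : Filter F)
    (J : S -> (circle R -> R) -> R) (W : R) (y : S -> C) (x l : C) :
  (forall t, pos_functional (J t)) -> (\forall t \near F, J t (fun=> 1) <= W) ->
  normc x < 1 -> y t @[t --> F] --> x ->
  herg (J t) (y t) @[t --> F] --> l -> herg (J t) x @[t --> F] --> l.
Proof.
move=> Jpos JW x1 /cvgCP cy /cvgCP cl; apply/cvgCP => e e0.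
pose r := (1 + normc x) / 2.
have x0 := normc_ge0 x.
have r01 : 0 <= r < 1 by rewrite /r; apply/andP; split; lra.
have r1 : 0 < 1 - r by case/andP: r01; lra.
have xr : normc x <= r by rewrite /r; lra.
pose K := 4 / (1 - r) ^+ 2 * `|W| + 1.
have q0 : 0 <= 4 / (1 - r) ^+ 2 by rewrite divr_ge0// sqr_ge0.
have K0 : 0 < K by rewrite ltr_wpDl// mulr_ge0.
have m0 : 0 < Num.min (1 - r) (e / 2 / K) by rewrite lt_min r1 !divr_gt0.
have e2 : 0 < e / 2 by rewrite divr_gt0.
apply: filterS3 JW (cy _ m0) (cl _ e2) => t JtW yx hl.
move: yx; rewrite lt_min => /andP[yr]; rewrite ltr_pdivlMr// => yK.
have yr' : normc (y t) <= r.
  have -> : y t = (y t - x) + x by ring.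
  by have := normcD (y t - x) x; move: yr; rewrite /r; lra.
have := herg_lipschitz (Jpos t) r01 xr yr'.
have JtW' : J t (fun=> 1) <= `|W| by exact: le_trans JtW (ler_norm W).
have := ler_wpM2r (normc_ge0 (x - y t)) (ler_wpM2l q0 JtW').
rewrite (normcBC x) => k1 k2.
have -> : herg (J t) x - l = (herg (J t) x - herg (J t) (y t)) + (herg (J t) (y t) - l) by ring.
apply: le_lt_trans (normcD _ _) _.
have n0 := normc_ge0 (y t - x).
move: yK; rewrite /K mulrDr mulr1 mulrC => yK; lra.
Qed.

(** All that is kept of infinite divisibility. Taking mu = nu covers divisibility of nu alone, since
    then cT and T agree by [cT_diag]. *)
Definition has_roots mu nu := forall n, exists mu' nu', nonzero_mean nu' /\
  \forall w \near (0 : C), T_transform nu w = T_transform nu' w ^+ n.+1 /\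
    cT_transform mu nu w = cT_transform mu' nu' w ^+ n.+1.

Lemma transform0 mu nu : nonzero_mean nu ->
  [/\ T_transform nu 0 = mean_of nu, cT_transform mu nu 0 = mean_of mu,
     \forall w \near (0 : C), peano (T_transform nu) w &
     \forall w \near (0 : C), peano (cT_transform mu nu) w].
Proof.
move=> nu0; have [chi chiP] := germ_inverse_exists nu0.
have tg := transform_germ mu chiP; have [chi0 _ _] := chiP.
have := near0_at tg; rewrite chi0 !B_fun0 => -[? ? _ _]; split=> //.
  by apply: filterS tg => w [].
by apply: filterS tg => w [].
Qed.

Lemma transform_logs mu nu : nonzero_mean mu -> nonzero_mean nu -> exists tau kap,
  [/\ \forall w \near (0 : C), peano tau w, \forall w \near (0 : C), peano kap w &
    \forall w \near (0 : C), T_transform nu w = cexp (tau w) /\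
      cT_transform mu nu w = cexp (kap w)].
Proof.
move=> mu0 nu0; have [T0 cT0 pT pcT] := transform0 mu nu0.
have [lt ltE] := cexp_surj nu0; have [lk lkE] := cexp_surj mu0.
have [|tau [_ ptau Etau]] := @log_germ R _ lt pT; first by rewrite -ltE T0.
have [|kap [_ pkap Ekap]] := @log_germ R _ lk pcT; first by rewrite -lkE cT0.
by exists tau, kap; split=> //; apply: filterS2 Etau Ekap.
Qed.

Lemma peano_cexp_scaled tau s w : peano tau w -> peano (fun w => cexp (s%:C * tau w)) w.
Proof.
move=> pt; apply: (@peano_comp _ (@cexp R)); first exact: peano_cexp.
by apply: peanoM => //; exact: peano_cst.
Qed.

Lemma cexp_scaledX n (z : C) : cexp (n.+1%:R^-1%:C * z) ^+ n.+1 = cexp z.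
Proof.
rewrite -cexpMn mulrA realcV realc_nat divff ?mul1r// pnatr_eq0 //.
Qed.

Lemma root_transforms mu nu tau kap n mu' nu' : nonzero_mean nu' ->
  (\forall w \near (0 : C), peano tau w) -> (\forall w \near (0 : C), peano kap w) ->
  (\forall w \near (0 : C), T_transform nu w = cexp (tau w) /\
      cT_transform mu nu w = cexp (kap w)) ->
  (\forall w \near (0 : C), T_transform nu w = T_transform nu' w ^+ n.+1 /\
    cT_transform mu nu w = cT_transform mu' nu' w ^+ n.+1) ->
  exists c e, [/\ c ^+ n.+1 = 1, e ^+ n.+1 = 1 & \forall w \near (0 : C),
    T_transform nu' w = c * cexp (n.+1%:R^-1%:C * tau w) /\
    cT_transform mu' nu' w = e * cexp (n.+1%:R^-1%:C * kap w)].
Proof.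
move=> nu0 pt pk E1 E2; have [_ _ pT pcT] := transform0 mu' nu0.
have [|c [cn Tc]] := root_germ (ltn0Sn n) (near0_at pT) (peano_cexp_scaled n.+1%:R^-1 (near0_at pt)) (cexp_neq0 _).
  by apply: filterS2 E1 E2 => w [Tw _] [<- _]; rewrite Tw cexp_scaledX.
have [|e [en Te]] := root_germ (ltn0Sn n) (near0_at pcT) (peano_cexp_scaled n.+1%:R^-1 (near0_at pk)) (cexp_neq0 _).
  by apply: filterS2 E1 E2 => w [_ Tw] [_ <-]; rewrite Tw cexp_scaledX.
by exists c, e; split=> //; apply: filterS2 Tc Te.
Qed.

(* With [h_n = n (1 - B_(mu_n))] for the [n]-th roots [mu_n], suitably rotated,
   [h_n] has nonnegative real part and [h_n (psie tau (1/n) w) = n (1 - exp (kap w / n))],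
   so a limit point of the Herglotz measures of [h_n] represents [- kap]. *)
Theorem levy_khintchine mu nu : nonzero_mean mu -> nonzero_mean nu -> has_roots mu nu ->
  exists (b : R) (I : (circle R -> R) -> R), pos_functional I /\
    \forall w \near (0 : C), cT_transform mu nu w = cexp ('i * b%:C - herg I (w / (1 + w))).
Proof.
move=> mu0 nu0 roots.
have [tau [kap [pt pk E]]] := transform_logs mu0 nu0.
have [d gd] := good_radius_exists ler01 pt pk.
have [d0 dh ptd btd] := gd.
have dn1 : d < 1 by apply: le_lt_trans dh _; rewrite invf_lt1// ltr1n.
pose a (n : nat) : R := n.+1%:R^-1.
have a01 n : 0 <= a n <= 1 by rewrite /a invr_ge0 ler0n invf_le1// ler1n.
have a_gt0 n : 0 < a n by rewrite invr_gt0.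
have aC0 n : (a n)%:C != 0 :> C.
  by apply: contraTneq (a_gt0 n) => /(congr1 (@complex.Re R)) /= ->; rewrite ltxx.
have ca : a n @[n --> \oo] --> (0 : R) by exact: cvg_harmonic.
have /choice[J JP] : forall n, exists I, pos_functional I /\ forall w, normc w < d ->
    herg I (psie tau (a n) w) = (1 - cexp ((a n)%:C * kap w)) / (a n)%:C
      - 'i * (complex.Im ((1 - cexp ((a n)%:C * kap 0)) / (a n)%:C))%:C.
  move=> n; have [mu' [nu' [nu'0 rt]]] := roots n.
  have [c [e [cn en E']]] := root_transforms nu'0 pt pk E rt.
  have c1 := normc_root_unit (ltn0Sn n) cn; have e1 := normc_root_unit (ltn0Sn n) en.
  have c0 : c != 0 by rewrite -normc_gt0 c1.
  have e0 : e != 0 by rewrite -normc_gt0 e1.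
  have UD := uniform_disk nu'0 gd (a01 n) c1 E'.
  (* Undoing the roots of unity c and e, of modulus 1, keeps |B| <= 1, which makes the real part of
     h nonnegative. *)
  pose h x := (1 - e^-1 * B_fun mu' (c^-1 * x)) / (a n)%:C.
  have cx x : normc x < 1 -> normc (c^-1 * x) < 1 by rewrite normcM normcV c1 invr1 mul1r.
  have ph x : normc x < 1 -> peano h x.
    move=> x1; apply: peanoM; last exact: peano_cst.
    apply: peanoB; first exact: peano_cst.
    apply: peanoM; first exact: peano_cst.
    apply: (@peano_comp _ (B_fun mu') (fun x => c^-1 * x)); first by apply: peano_B; exact: cx.
    by apply: peanoM; [exact: peano_cst|exact: peano_id].
  have rh x : normc x < 1 -> 0 <= complex.Re (h x).
    move=> x1; rewrite /h mulrC -realcV ReMr mulr_ge0 ?invr_ge0 ?(ltW (a_gt0 n))//.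
    rewrite ReB /= subr_ge0; apply: le_trans (ler_norm _) _; apply: le_trans (normc_Re _) _.
    by rewrite normcM normcV e1 invr1 mul1r B_le1// cx.
  have hE w : normc w < d -> h (psie tau (a n) w) = (1 - cexp ((a n)%:C * kap w)) / (a n)%:C.
    by move=> wd; have [_ BE] := UD w wd; rewrite /h BE mulKf.
  have [I Ipos IH] := herglotz ph rh; exists I; split=> // w wd.
  have p1 : normc (psie tau (a n) w) < 1.
    by apply: le_lt_trans (btd _ _ (a01 n) wd) _; rewrite invf_lt1// ltr1n.
  rewrite IH// hE//; congr (_ - 'i * (complex.Im _)%:C).
  have d00 : normc (0 : C) < d by rewrite normc0.
  by have := hE 0 d00; rewrite psie0.
have an0 : \forall n \near \oo, a n != 0 by apply: nearW => n; rewrite gt_eqF.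
have cs (k : C) : (1 - cexp ((a n)%:C * k)) / (a n)%:C @[n --> \oo] --> - k.
  apply: (@cvg_exp_scaled R nat \oo _ a k); [exact: ca|exact: an0].
have cJ w : normc w < d -> herg (J n) (psie tau (a n) w) @[n --> \oo] -->
    - kap w - 'i * (complex.Im (- kap 0))%:C.
  move=> wd; have E1 : (fun n => herg (J n) (psie tau (a n) w)) =
      fun n => (1 - cexp ((a n)%:C * kap w)) / (a n)%:C
      - 'i * (complex.Im ((1 - cexp ((a n)%:C * kap 0)) / (a n)%:C))%:C.
    by apply/funext => n; case: (JP n) => _ /(_ w wd).
  rewrite E1; have h2 : ('i * (complex.Im ((1 - cexp ((a n)%:C * kap 0)) / (a n)%:C))%:C) @[n --> \oo] -->
      ('i * (complex.Im (- kap 0))%:C : C).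
    have cI : complex.Im ((1 - cexp ((a n)%:C * kap 0)) / (a n)%:C) @[n --> \oo] --> complex.Im (- kap 0).
      by apply: cvg_Im; exact: cs.
    have c0 : (fun n : nat => 0 : R) @ \oo --> (0 : R) by exact: cvg_cst.
    have cIc : (complex.Im ((1 - cexp ((a n)%:C * kap 0)) / (a n)%:C))%:C @[n --> \oo] --> (complex.Im (- kap 0))%:C.
      by apply: cvg_ReIm; [exact: cI|exact: c0].
    by apply: (@cvgM C nat \oo _ (fun=> 'i)); [exact: cvg_cst|exact: cIc].
  exact: (cvgB (cs (kap w)) h2).
have [U [UU FU]] := @ultraFilterLemma nat \oo _.
have Jpos n : pos_functional (J n) by case: (JP n).
have d00 : normc (0 : C) < d by rewrite normc0.
have c00 : herg (J n) 0 @[n --> \oo] --> (- kap 0 - 'i * (complex.Im (- kap 0))%:C).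
  by have := cJ 0 d00; under eq_fun do rewrite psie0.
have JW : \forall n \near \oo, J n (fun=> 1) <= complex.Re (- kap 0 - 'i * (complex.Im (- kap 0))%:C) + 1.
  by apply: near_mass_le; [exact: Jpos|exact: c00].
have [I Ipos IP] := ultra_functional UU Jpos (FU _ JW).
(* Herglotz transforms are real at 0, so b has to carry the imaginary part of kap(0). *)
exists (complex.Im (kap 0)), I; split=> //.
apply: filterS2 E (near0_ball d0) => w [_ ->] wd; congr cexp.
have w1 : normc w < 1 by exact: lt_trans dn1.
have x1 : normc (w / (1 + w)) < 1.
  rewrite -(psie_0 tau); have z01 : 0 <= (0 : R) <= 1 by rewrite lexx ler01.
  by apply: le_lt_trans (btd _ _ z01 wd) _; rewrite invf_lt1// ltr1n.
have H : herg I (w / (1 + w)) = - kap w - 'i * (complex.Im (- kap 0))%:C.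
  apply: (@cvgC_unique _ _ U _ (fun n => herg (J n) (w / (1 + w)))).
    exact: cvg_herg IP x1.
  have cy : psie tau (a n) w @[n --> \oo] --> w / (1 + w).
    by rewrite -(psie_0 tau); exact: cvg_psie w1 ca.
  have c : herg (J n) (w / (1 + w)) @[n --> \oo] --> - kap w - 'i * (complex.Im (- kap 0))%:C.
    by apply: (@cvg_herg_moving _ _ _ J _ (fun n => psie tau (a n) w)); [exact: Jpos|exact: JW|exact: x1|exact: cy|exact: cJ].
  by move=> A /c FA; exact: FU.
rewrite H ImN rmorphN; ring.
Qed.

End levy_khintchine.

(** * Exponents of Levy-Khintchine form *)

Section levy_exponent.
Variable R : realType.
Local Notation C := R[i].
Implicit Types (mu nu : prob_circle R) (z w u : C) (t b : R) (I : (circle R -> R) -> R).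

Definition levy b I (x : C) : C := 'i * b%:C - herg I x.

Lemma peano_levy b I x : pos_functional I -> normc x < 1 -> peano (levy b I) x.
Proof.
by move=> Ipos x1; apply: peanoB; [exact: peano_cst|exact: peano_herg].
Qed.

Lemma Re_levy b I x : pos_functional I -> normc x < 1 -> complex.Re (levy b I x) <= 0.
Proof.
by move=> Ipos x1; rewrite ReB ReM /= !(mul0r, mul1r, subr0, mulr0) sub0r oppr_le0 Re_herg_ge0.
Qed.

Lemma normc_cexp_levy t b I x : pos_functional I -> 0 <= t -> normc x < 1 ->
  normc (cexp (t%:C * levy b I x)) <= 1.
Proof.
move=> Ipos t0 x1; rewrite normc_cexp ReMr -expR0 ler_expR.
by rewrite mulr_ge0_le0// Re_levy.
Qed.

Lemma cexp_levy b I x : cexp (levy b I x) = cis b * cexp (- herg I x).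
Proof.
by rewrite /levy cexpD; congr (cexp _ * _); apply/eqcP; rewrite /=; ring.
Qed.

Lemma eta_lt1 nu u : normc u < 1 -> normc (eta_fun nu u) < 1.
Proof. by move=> u1; exact: le_lt_trans (eta_le nu u1) u1. Qed.

(** The exponent has nonpositive real part and eta_nu maps the disk into itself, so the right-hand
    side is a Schur function. *)
Lemma levy_marginal nu t b I : pos_functional I -> 0 <= t ->
  exists mu, forall u, normc u < 1 -> B_fun mu u = cexp (t%:C * levy b I (eta_fun nu u)).
Proof.
move=> Ipos t0; apply: schur_measure => u u1; last first.
  by apply: normc_cexp_levy => //; exact: eta_lt1.
apply: (@peano_comp _ (@cexp R) (fun u => t%:C * levy b I (eta_fun nu u))).
  exact: peano_cexp.
apply: peanoM; first exact: peano_cst.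
apply: (@peano_comp _ (levy b I) (eta_fun nu)); first by apply: peano_levy => //; exact: eta_lt1.
exact: peano_eta.
Qed.

Lemma cT_levy mu nu t b I : nonzero_mean nu ->
  (\forall u \near (0 : C), B_fun mu u = cexp (t%:C * levy b I (eta_fun nu u))) ->
  \forall w \near (0 : C), cT_transform mu nu w = cexp (t%:C * levy b I (w / (1 + w))).
Proof.
move=> nu0 H; have [chi chiP] := germ_inverse_exists nu0.
have [c0 c1 _] := chiP; have [_ _ pc] := near0_at c1.
apply: filterS3 (transform_germ mu chiP) c1 (near0_comp pc c0 H) => w [_ -> _ _] [cw mw _] ->.
by rewrite /eta_fun mw.
Qed.

Lemma near0_unit_disk (P : C -> Prop) : (forall u, normc u < 1 -> P u) ->
  \forall u \near (0 : C), P u.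
Proof. by move=> H; apply: filterS (near0_ball ltr01). Qed.

Lemma cT_diag nu : nonzero_mean nu ->
  \forall w \near (0 : C), cT_transform nu nu w = T_transform nu w.
Proof.
move=> nu0; have [chi chiP] := germ_inverse_exists nu0.
by apply: filterS (transform_germ nu chiP) => w [-> -> _ _].
Qed.

(** Sigma is cT in the variable w = z/(1 - z), whose inverse is z = w/(1 + w). *)
Lemma Sigma_representationP mu nu (g : circle R) sigma :
  Sigma_representation mu nu g sigma <->
  \forall w \near (0 : C), cT_transform mu nu w =
    (g : C) * cexp (- herg (integral_functional sigma) (w / (1 + w))).
Proof.
split=> H.
  apply: filterS2 (near0_moebius H) (near0_ball ltr01) => w Hw w1.
  rewrite -Hw /Sigma_transform; congr cT_transform.
  by have := addr1_neq0 w1 => h; field; rewrite h addrK oner_neq0.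
apply: filterS2 (near0_moebius_inv H) (near0_ball ltr01) => z Hz z1'.
rewrite /Sigma_transform Hz; congr (_ * cexp (- _)).
rewrite -[RHS]/(herg (integral_functional sigma) z); congr herg.
have h := oner_sub_neq0 z1'.
by field; rewrite h subrK oner_neq0.
Qed.

End levy_exponent.

(** * Invariance under equality on Borel sets *)

Section invariance.
Variable R : realType.
Local Notation C := R[i].
Local Notation M := (prob_circle R).
Implicit Types (mu nu : M) (p q : M * M).

Lemma eq_measure_cintegral mu nu (f : circle R -> C) :
  Defs.eq_measure mu nu -> cintegral mu f = cintegral nu f.
Proof. by move=> E; rewrite /cintegral !(eq_measure_Rintegral _ E). Qed.

Lemma eq_measure_moment mu nu : Defs.eq_measure mu nu -> moment_fun mu = moment_fun nu.
Proof. by move=> E; apply/funext => z; exact: eq_measure_cintegral. Qed.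

Lemma eq_measure_T mu nu : Defs.eq_measure mu nu -> T_transform mu = T_transform nu.
Proof.
by move=> E; rewrite /T_transform /R_transform (eq_measure_moment E).
Qed.

Lemma eq_measure_cT mu nu mu' nu' : Defs.eq_measure mu mu' -> Defs.eq_measure nu nu' ->
  cT_transform mu nu = cT_transform mu' nu'.
Proof.
move=> E E'; rewrite /cT_transform /cR_transform /R_transform.
by rewrite (eq_measure_moment E) (eq_measure_moment E').
Qed.

Lemma eq_measure_mean mu nu : Defs.eq_measure mu nu -> nonzero_mean mu -> nonzero_mean nu.
Proof. by move=> E; rewrite /nonzero_mean (eq_measure_cintegral _ E). Qed.

Lemma eq_measure_sym mu nu : Defs.eq_measure mu nu -> Defs.eq_measure nu mu.
Proof. by move=> E A /E ->. Qed.

Lemma eq_measure_distribution (A : algType C) (phi : {scalar A}) u mu nu :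
  Defs.eq_measure mu nu -> has_distribution phi u mu -> has_distribution phi u nu.
Proof. by move=> E D n; rewrite D (eq_measure_cintegral _ E). Qed.

Lemma cfree_conv_eq p q r r' : eq_pair r r' -> cfree_conv p q r -> cfree_conv p q r'.
Proof.
case: r r' => [r1 r2] [s1 s2] [/= E1 E2] [[/= a b c H]|[a [A [star [phi [psi [u [v [H1 [H2 H3 H4 [H5 H6]]]]]]]]]]].
  left; split; [exact: a|exact: b|exact: eq_measure_mean E2 c|].
  by rewrite /= -(eq_measure_T E2) -(eq_measure_cT E1 E2).
right; split=> //; exists A, star, phi, psi, u, v; split=> //; split=> //.
by split; [exact: eq_measure_distribution E1 H5|exact: eq_measure_distribution E2 H6].
Qed.

End invariance.

(** * Convolution powers; the equivalence of (1) and (2) *)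

Section convolution_powers.
Variable R : realType.
Local Notation C := R[i].
Local Notation M := (prob_circle R).
Implicit Types (mu nu : M) (p q : M * M).

(** Freeness makes psi vanish on the alternating word (u - psi u) (v - psi v), which is then
    expanded. *)
Lemma free_mean (A : algType C) (star : A -> A) (psi : {scalar A}) u v :
  state star psi -> free_family psi (pair_generated star u v) ->
  psi (u * v) = psi u * psi v.
Proof.
move=> [psi1 _] free.
pose cen (x : A) := x - psi x *: 1.
have cen0 x : psi (cen x) = 0 by rewrite linearB linearZ /= psi1 mulr1 subrr.
have gen x : star_generated star x (cen x).
  apply: sg_add; first exact: sg_gen.
  by rewrite -scaleNr; apply: sg_scale; exact: sg_one.
have := free [:: (true, cen u); (false, cen v)] isT; rewrite big_cons big_seq1 /=.
move=> /(_ _)/wrap[].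
  split=> // x; rewrite !inE => /orP[]/eqP -> /=; split=> //; exact: gen.
rewrite /cen mulrBl !mulrBr -!scalerAl -!scalerAr !mul1r !mulr1.
rewrite !linearB !linearZ /= psi1 => h; apply/eqP; rewrite -subr_eq0 -h; apply/eqP.
move: (psi u) (psi v) (psi (u * v)) => a b c.
by rewrite -[RHS]/(c + b * - a + (a * - b + a * (b * - (-1)))); ring.
Qed.

Lemma free_product_mean nu1 nu2 nu : free_product_distribution nu1 nu2 nu ->
  mean_of nu = mean_of nu1 * mean_of nu2.
Proof.
move=> [A [star [psi [u [v [[_ st _ _] [fr D1 D2 D]]]]]]].
by rewrite -[LHS](D 1%N) -[mean_of nu1](D1 1%N) -[mean_of nu2](D2 1%N) (free_mean st fr).
Qed.

(** In the case defined by free variables the mean of nu is the product of the two means, one of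
    which is 0 there. *)
Lemma free_conv_nonzero nu1 nu2 nu : free_conv nu1 nu2 nu -> nonzero_mean nu ->
  [/\ nonzero_mean nu1, nonzero_mean nu2
    & \forall z \near (0 : C), T_transform nu z = T_transform nu1 z * T_transform nu2 z].
Proof.
case=> [[]//|[N /free_product_mean E]]; rewrite {1}/nonzero_mean -/(mean_of _) E mulf_eq0 negb_or.
by case/andP => a b; case: N.
Qed.

Lemma cfree_conv_nonzero p1 p2 p : cfree_conv p1 p2 p -> nonzero_mean p.2 ->
  [/\ nonzero_mean p1.2, nonzero_mean p2.2
    & \forall z \near (0 : C), T_transform p.2 z = T_transform p1.2 z * T_transform p2.2 z /\
      cT_transform p.1 p.2 z = cT_transform p1.1 p1.2 z * cT_transform p2.1 p2.2 z].
Proof.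
case=> [[]//|[N [A [star [phi [psi [u [v [[sa [_ st] uu vv] [[fr _] [_ D1] [_ D2] [_ D]]]]]]]]]]].
have : free_product_distribution p1.2 p2.2 p.2 by exists A, star, psi, u, v.
move=> /free_product_mean E; rewrite {1}/nonzero_mean -/(mean_of _) E mulf_eq0 negb_or.
by case/andP => a b; case: N.
Qed.

Lemma free_power_transform n nu1 nu :
  conv_power (fun a b : M => Defs.eq_measure a b) (@free_conv R) n nu1 nu -> nonzero_mean nu ->
  nonzero_mean nu1 /\ \forall z \near (0 : C), T_transform nu z = T_transform nu1 z ^+ n.+1.
Proof.
elim: n nu => [|n IH] nu /=.
  move=> E nu0; split; first exact: eq_measure_mean (eq_measure_sym E) nu0.
  by rewrite (eq_measure_T E); apply: filterS (@near0_ball R 1 ltr01) => z _; rewrite expr1.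
move=> [w /IH{}IH c] /(free_conv_nonzero c)[w0 n0 H].
have [_ H'] := IH w0; split=> //; apply: filterS2 H H' => z -> ->.
by rewrite [RHS]exprSr.
Qed.

Lemma cfree_power_transform n p1 p :
  conv_power (@eq_pair R) (@cfree_conv R) n p1 p -> nonzero_mean p.2 ->
  nonzero_mean p1.2 /\ \forall z \near (0 : C),
    T_transform p.2 z = T_transform p1.2 z ^+ n.+1 /\
    cT_transform p.1 p.2 z = cT_transform p1.1 p1.2 z ^+ n.+1.
Proof.
elim: n p => [|n IH] p /=.
  move=> [E1 E2] nu0; split; first exact: eq_measure_mean (eq_measure_sym E2) nu0.
  by rewrite (eq_measure_T E2) (eq_measure_cT E1 E2); apply: filterS (@near0_ball R 1 ltr01) => z _; rewrite !expr1.
move=> [w /IH{}IH c] /(cfree_conv_nonzero c)[w0 n0 H].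
have [_ H'] := IH w0; split=> //; apply: filterS2 H H' => z [-> ->] [-> ->].
by rewrite ![_ ^+ n.+2]exprSr.
Qed.

Lemma free_infdiv_roots nu : nonzero_mean nu -> free_infdiv nu -> has_roots nu nu.
Proof.
move=> nu0 H n; have [nun /free_power_transform/(_ nu0)[n0 E]] := H n.
exists nun, nun; split=> //.
apply: filterS3 E (cT_diag nu0) (cT_diag n0) => w E T1 T2.
rewrite T1 T2; split; exact: E.
Qed.

Lemma cfree_infdiv_roots mu nu : nonzero_mean nu -> cfree_infdiv (mu, nu) -> has_roots mu nu.
Proof.
move=> nu0 H n; have [[mun nun] /cfree_power_transform/(_ nu0)[n0 E]] := H n.
by exists mun, nun.
Qed.

Lemma herg_ext (I J : (circle R -> R) -> R) (x : C) :
  (forall f, continuous f -> I f = J f) -> normc x < 1 -> herg I x = herg J x.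
Proof.
move=> E x1; have c := continuous_herg_kernel x1.
by rewrite /herg /cfun !E//; [exact: continuous_Imc|exact: continuous_Rec].
Qed.

Lemma infdiv_representation mu nu : nonzero_mean mu -> nonzero_mean nu ->
  cfree_infdiv (mu, nu) -> exists g sigma, Sigma_representation mu nu g sigma.
Proof.
move=> mu0 nu0 /(cfree_infdiv_roots nu0)/(levy_khintchine mu0 nu0)[b [I [Ipos E]]].
have [sigma sE] := riesz_circle_finite Ipos; exists (circ b), sigma.
apply/Sigma_representationP; apply: filterS2 E (near0_moebius (near0_ball ltr01)) => w -> w1.
by rewrite -/(levy b I (w / (1 + w))) cexp_levy (@herg_ext (integral_functional sigma) I).
Qed.

(** The powers of nu1 are given; over each of them [levy_marginal] supplies a first component with
    exponent (k + 1) t, and exponents add up along the chain. *)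
Lemma infdiv_chain mu0 nu1 nu b I t k : pos_functional I -> 0 <= t ->
  conv_power (fun a b : M => Defs.eq_measure a b) (@free_conv R) k nu1 nu -> nonzero_mean nu ->
  (\forall w \near (0 : C), cT_transform mu0 nu1 w = cexp (t%:C * levy b I (w / (1 + w)))) ->
  exists mu, conv_power (@eq_pair R) (@cfree_conv R) k (mu0, nu1) (mu, nu) /\
   \forall w \near (0 : C), cT_transform mu nu w = cexp ((k.+1%:R * t)%:C * levy b I (w / (1 + w))).
Proof.
move=> Ipos t0; elim: k nu => [|k IH] nu /=.
  move=> E nu0 H; exists mu0; split=> //.
  by rewrite mul1r -(@eq_measure_cT R mu0 nu1).
move=> [w cw c] nu0 H; have [w0 n0 TE] := free_conv_nonzero c nu0.
have [mu [cmu Emu]] := IH w cw w0 H.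
have kt : 0 <= k.+2%:R * t by rewrite mulr_ge0.
have [mu' mu'P] := levy_marginal nu b Ipos kt.
have E' := cT_levy nu0 (near0_unit_disk mu'P).
exists mu'; split=> //; exists (mu, w) => //; left; split=> //=.
apply: filterS2 (filterI E' TE) (filterI Emu H) => z [-> ->] [-> ->]; split=> //.
by rewrite -cexpD -mulrDl -rmorphD -{3}(mul1r t) -mulrDl -natr1.
Qed.

Lemma representation_levy mu nu g sigma : Sigma_representation mu nu g sigma ->
  exists b, (g : C) = cis b /\ \forall w \near (0 : C),
    cT_transform mu nu w = cexp (levy b (integral_functional sigma) (w / (1 + w))).
Proof.
move=> /Sigma_representationP H; have [b _ gE] := unit_circleP (normc_circle g).
by exists b; split=> //; apply: filterS H => w ->; rewrite cexp_levy gE.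
Qed.

(** The chain stops one factor early: the last pair must be (mu, nu) itself, whose cT is given by
    the representation. *)
Lemma representation_infdiv mu nu g sigma : nonzero_mean nu -> free_infdiv nu ->
  Sigma_representation mu nu g sigma -> cfree_infdiv (mu, nu).
Proof.
move=> nu0 H /representation_levy[b [_ E]] [|n]; first by exists (mu, nu); split.
have Ipos := integral_functional_pos sigma.
have [nu1 [w cw c]] := H n.+1.
have [w0 n0 TE] := free_conv_nonzero c nu0.
have t0 : 0 <= n.+2%:R^-1 :> R by rewrite invr_ge0.
have [mu0 mu0P] := levy_marginal nu1 b Ipos t0.
have E0 := cT_levy n0 (near0_unit_disk mu0P).
have [mu1 [cmu1 Emu1]] := infdiv_chain Ipos t0 cw w0 E0.
exists (mu0, nu1), (mu1, w) => //; left; split=> //=.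
apply: filterS2 (filterI E TE) (filterI Emu1 E0) => z [-> ->] [-> ->]; split=> //.
rewrite -cexpD -mulrDl -rmorphD -{2}(mul1r n.+2%:R^-1) -mulrDl natr1 divff ?pnatr_eq0//.
by rewrite mul1r.
Qed.

Lemma semigroup_power (p : R -> M * M) (a : R) k : cfree_semigroup p -> 0 <= a ->
  conv_power (@eq_pair R) (@cfree_conv R) k (p a) (p (k.+1%:R * a)).
Proof.
move=> [pD _ _] a0; elim: k => [|k IH] /=; first by rewrite mul1r; split.
exists (p (k.+1%:R * a)) => //; rewrite -(natr1 k.+1) mulrDl mul1r.
by apply: pD => //; rewrite mulr_ge0.
Qed.

Lemma semigroup_infdiv mu nu (p : R -> M * M) : cfree_semigroup_through p mu nu -> cfree_infdiv (mu, nu).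
Proof.
move=> [sg p1 _] n; pose a : R := n.+1%:R^-1.
have a0 : 0 <= a by rewrite invr_ge0.
exists (p a); have := semigroup_power n sg a0; rewrite {2}/a divff ?pnatr_eq0//; case: n a a0 => [|n] a a0.
  by move=> [E1 E2]; case: p1 => F1 F2; split=> A mA; rewrite ?E1// ?E2// ?F1// ?F2.
by move=> [w cw c]; exists w => //; exact: cfree_conv_eq p1 c.
Qed.

End convolution_powers.

(** * Weak convergence from transforms *)

Section law_convergence.
Variable R : realType.
Local Notation C := R[i].
Local Notation M := (prob_circle R).
Implicit Types (mu nu : M) (z w u : C) (b s : R).

Lemma moment_of_eta mu z : normc z < 1 ->
  moment_fun mu z = eta_fun mu z / (1 - eta_fun mu z).
Proof.
move=> z1; have h := moment_neq mu z1; rewrite /eta_fun; field.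
by rewrite h addrK oner_neq0.
Qed.

Lemma eta_neq1 mu z : normc z < 1 -> 1 - eta_fun mu z != 0.
Proof.
by move=> z1; apply: oner_sub_neq0; exact: eta_lt1.
Qed.

(* A moving evaluation point suffices: it identifies the limit of the
   Herglotz functions near 0. *)
Lemma law_cvg (S : Type) (F : set_system S) (FF : ProperFilter F) (m : S -> M) mu (r : R) :
  0 < r -> r <= 1 ->
  (forall z, normc z < r -> exists2 y : S -> C, y t @[t --> F] --> z &
     moment_fun (m t) (y t) @[t --> F] --> moment_fun mu z) ->
  forall f, continuous f -> \int[m t]_x f x @[t --> F] --> \int[mu]_x f x.
Proof.
move=> r0 r1 H; apply: (@functional_cvg R S F _ (fun t => lawf (m t)) (lawf mu) r r0).
- by move=> t; exact: lawf_pos.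
- exact: lawf_pos.
move=> z zr; have z1 := lt_le_trans zr r1.
have [y yz my] := H z zr.
have JW : \forall t \near F, lawf (m t) (fun=> 1) <= 1 by apply: nearW => t; rewrite lawf1.
apply: (@cvg_herg_moving _ _ F _ (fun t => lawf (m t)) 1 y); first by move=> t; exact: lawf_pos.
- exact: JW.
- exact: z1.
- exact: yz.
rewrite (herg_moment mu z1).
have y1 : \forall t \near F, normc (y t) < 1.
  have z1' : 0 < 1 - normc z by rewrite subr_gt0.
  have /cvgCP cy := yz; apply: filterS (cy _ z1') => t h.
  rewrite -(subrK z (y t)); have := normcD (y t - z) z; move: h; lra.
have h : (1 + 2 * moment_fun (m t) (y t)) @[t --> F] --> 1 + 2 * moment_fun mu z.
  exact: (cvgD (cvg_cst _) (cvgM (cvg_cst _) my)).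
apply: cvg_trans h; apply: near_eq_cvg; apply: filterS y1 => t y1.
by rewrite herg_moment.
Qed.

Lemma cvg_divC (S : Type) (F : set_system S) (FF : Filter F) (f g : S -> C) (a b : C) : b != 0 ->
  f t @[t --> F] --> a -> g t @[t --> F] --> b -> f t / g t @[t --> F] --> a / b.
Proof. by move=> b0 fa gb; exact: (cvgM fa (cvgV b0 gb)). Qed.

Lemma cvg_cexp (S : Type) (F : set_system S) (FF : Filter F) (f : S -> C) (a : C) :
  f t @[t --> F] --> a -> cexp (f t) @[t --> F] --> cexp a.
Proof.
move=> /cvgCP fa; apply/cvgCP => e e0.
have [d d0 H] := peano_continuous (peano_cexp a) e0.
by apply: filterS (fa d d0) => t; exact: H.
Qed.

Lemma cvg_realc (S : Type) (F : set_system S) (FF : Filter F) (f : S -> R) (a : R) :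
  f t @[t --> F] --> a -> (f t)%:C @[t --> F] --> (a%:C : C).
Proof.
move=> fa; have c0 : (fun _ : S => 0 : R) @ F --> (0 : R) by exact: cvg_cst.
by apply: cvg_ReIm; [exact: fa|exact: c0].
Qed.

Definition exp_pair (tau kap : C -> C) s (p : M * M) := nonzero_mean p.2 /\
  \forall w \near (0 : C), T_transform p.2 w = cexp (s%:C * tau w) /\
    cT_transform p.1 p.2 w = cexp (s%:C * kap w).

Lemma exp_pair_disk tau kap s S d p : good_radius tau kap S d ->
  0 <= s <= S -> exp_pair tau kap s p ->
  forall w, normc w < d -> moment_fun p.2 (psie tau s w) = w /\
    B_fun p.1 (psie tau s w) = cexp (s%:C * kap w).
Proof.
move=> gd sS [p0 E] w wd; have := @uniform_disk _ p.1 p.2 tau kap s S d 1 1 p0 gd sS.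
rewrite normc_1 => /(_ erefl)/(_ _)/(_ w wd); rewrite invr1 !mul1r; apply.
by apply: filterS E => z [-> ->]; rewrite !mul1r.
Qed.

(** At the moving point [psie tau (a t) w] the second moment function is w and the first B is
    exp(a(t) kap(w)), whose limits are explicit. Every z near 0 is [psie tau s w] for w the value at
    z of the second moment function of q, so [law_cvg] applies. *)
Lemma exp_pair_cvg (S0 : Type) (F : set_system S0) (FF : ProperFilter F) (p : S0 -> M * M)
    (a : S0 -> R) tau kap s S q : 0 <= S ->
  (\forall w \near (0 : C), peano tau w) -> (\forall w \near (0 : C), peano kap w) ->
  0 <= s <= S -> exp_pair tau kap s q ->
  (\forall t \near F, 0 <= a t <= S /\ exp_pair tau kap (a t) (p t)) ->
  a t @[t --> F] --> s -> forall f, continuous f ->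
  (\int[(p t).1]_x f x @[t --> F] --> \int[q.1]_x f x) /\
  (\int[(p t).2]_x f x @[t --> F] --> \int[q.2]_x f x).
Proof.
move=> S_0 pt pk sS Eq Ep ca.
have [d gd] := good_radius_exists S_0 pt pk.
have [d0 dh ptd btd] := gd.
have hlt1 : 2^-1 < 1 :> R by rewrite invf_lt1// ltr1n.
have dn1 : d < 1 by exact: le_lt_trans dh _.
have Dq := exp_pair_disk gd sS Eq.
have [q0 _] := Eq; have [chi [chi0 chi1 chi2]] := germ_inverse_exists q0.
have n01 : normc (0 : C) < 1 by rewrite normc0.
have ppsi : peano (psie tau s) 0 by apply: peano_psie; rewrite ?normc0//; apply: (ptd 0 _).1; rewrite normc0.
have inv : \forall u \near (0 : C), normc (moment_fun q.2 u) < d /\ psie tau s (moment_fun q.2 u) = u.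
  have i1 : \forall w \near (0 : C), chi w = psie tau s w.
    have := near0_comp ppsi (psie0 tau s) chi2.
    by apply: filterS2 (near0_ball d0) => w wd; have [-> _] := Dq w wd.
  have m0 := moment_fun0 q.2; have pm := peano_moment q.2 n01.
  have h1 := near0_comp pm m0 i1; have h2 := near0_comp pm m0 (near0_ball d0).
  by apply: filterS3 h1 h2 chi2 => u <- hd ->.
have /near0CP[r0 r00 rP] := inv.
have r1 : 0 < Num.min r0 1 by rewrite lt_min r00 ltr01.
have r2 : Num.min r0 1 <= 1 by rewrite ge_min lexx orbT.
have cy w : normc w < d -> psie tau (a t) w @[t --> F] --> psie tau s w.
  by move=> wd; apply: cvg_psie; [exact: lt_trans dn1|exact: ca].
have y1 w : normc w < d -> \forall t \near F, normc (psie tau (a t) w) < 1.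
  by move=> wd; apply: filterS Ep => t [aS _]; apply: le_lt_trans (btd _ _ aS wd) _.
have psi1 w : normc w < d -> normc (psie tau s w) < 1.
  by move=> wd; apply: le_lt_trans (btd _ _ sS wd) _.
move=> f cf; split; [apply: (@law_cvg S0 F FF (fun t => (p t).1) q.1 _ r1 r2 _ f cf)
    |apply: (@law_cvg S0 F FF (fun t => (p t).2) q.2 _ r1 r2 _ f cf)] => z;
    rewrite lt_min => /andP[/rP[wd zE]] z1; rewrite -zE; move: (moment_fun q.2 z) wd => w wd;
    exists (fun t => psie tau (a t) w); [exact: cy| |exact: cy|].
  rewrite moment_of_eta; last exact: psi1.
  have cB : cexp ((a t)%:C * kap w) @[t --> F] --> cexp (s%:C * kap w).
    apply: cvg_cexp; have := cvg_realc _ ca => ca'; exact: (cvgM (ca' _) (cvg_cst _)).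
  have ce : eta_fun (p t).1 (psie tau (a t) w) @[t --> F] --> eta_fun q.1 (psie tau s w).
    rewrite -B_funE (Dq w wd).2.
    have h : psie tau (a t) w * cexp ((a t)%:C * kap w) @[t --> F] --> psie tau s w * cexp (s%:C * kap w).
      exact: (cvgM (cy w wd) cB).
    apply: cvg_trans h; apply: near_eq_cvg; apply: filterS Ep => t [aS E].
    by rewrite -B_funE (exp_pair_disk gd aS E wd).2.
  have h : eta_fun (p t).1 (psie tau (a t) w) / (1 - eta_fun (p t).1 (psie tau (a t) w)) @[t --> F] -->
      eta_fun q.1 (psie tau s w) / (1 - eta_fun q.1 (psie tau s w)).
    apply: cvg_divC; [by apply: eta_neq1; exact: psi1|exact: ce|exact: (cvgB (cvg_cst _) ce)].
  apply: cvg_trans h; apply: near_eq_cvg; apply: filterS (y1 w wd) => t y1'.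
  by rewrite moment_of_eta.
have h : (fun _ : S0 => w) @ F --> w by exact: cvg_cst.
rewrite (Dq w wd).1; apply: cvg_trans h; apply: near_eq_cvg; apply: filterS Ep => t [aS E].
by rewrite (exp_pair_disk gd aS E wd).1.
Qed.

End law_convergence.

(** * Pairs with given exponents *)

Section free_semigroup.
Variable R : realType.
Local Notation C := R[i].
Local Notation M := (prob_circle R).
Implicit Types (mu nu : M) (z w u : C) (b t : R) (I : (circle R -> R) -> R).

Lemma eta_herg mu u : normc u < 1 ->
  eta_fun mu u = (herg (lawf mu) u - 1) / (herg (lawf mu) u + 1) /\
  herg (lawf mu) u + 1 != 0.
Proof.
move=> u1; rewrite (herg_moment mu u1) /eta_fun; have h := moment_neq mu u1.
have -> : 1 + 2 * moment_fun mu u + 1 = 2 * (1 + moment_fun mu u) by ring.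
have two0 : (2 : C) != 0 by rewrite pnatr_eq0.
by split; [field; rewrite h|rewrite mulf_neq0].
Qed.

(* The subordination equation [eta = u beta(eta)] is solved by iteration on
   probability measures; compactness makes the limit an eta-function again. *)
Lemma free_levy_exists b t I : pos_functional I -> 0 <= t ->
  exists nu, nonzero_mean nu /\
    \forall u \near (0 : C), B_fun nu u = cexp (t%:C * levy b I (eta_fun nu u)).
Proof.
move=> Ipos t0; pose beta x := cexp (t%:C * levy b I x).
have pb x : normc x < 1 -> peano beta x.
  move=> x1; apply: (@peano_cexp_scaled R (levy b I)); exact: peano_levy.
have b1 x : normc x < 1 -> normc (beta x) <= 1 by exact: normc_cexp_levy.
have /choice[g gP] : forall nu, exists mu, forall u, normc u < 1 -> B_fun mu u = beta (eta_fun nu u).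
  by move=> nu; exact: levy_marginal.
pose N k := iter k g (\d_(circle1 R : borel_circle R) : M).
pose e k u := eta_fun (N k) u.
have eS k u : normc u < 1 -> e k.+1 u = u * beta (e k u).
  by move=> u1; rewrite /e -B_funE /N iterS gP.
(* beta is 8-Lipschitz on |x| <= 1/2, so for |u| <= r = 1/16 the map eta -> u beta(eta) contracts by
   1/2. *)
have [r [r0 r16]] : exists r : R, 0 < r /\ r * 16 = 1.
  by exists 16^-1; rewrite invr_gt0 ltr0n mulVf// pnatr_eq0.
have r1 u : normc u <= r -> normc u < 1 by move=> h; lra.
have el k u : normc u <= r -> normc (e k u) <= r.
  by move=> ur; exact: (le_trans (eta_le _ (r1 _ ur)) ur).
have rh : r <= 1 / 2 by lra.
have d_small k u : normc u <= r -> normc (e k.+1 u - e k u) <= 2 * 2^-1 ^+ k.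
  move=> ur; elim: k => [|k IH].
    rewrite expr0 mulr1; apply: le_trans (normcB _ _) _.
    by have := el 0%N u ur; have := el 1%N u ur; lra.
  have -> : e k.+2 u - e k.+1 u = u * (beta (e k.+1 u) - beta (e k u)).
    by rewrite mulrBr -!eS ?r1.
  rewrite normcM.
  have := lipschitz_half ltr01 pb b1 (le_trans (el k.+1 u ur) rh) (le_trans (el k u ur) rh).
  rewrite mulr1 divr1 exprS; set L := normc (beta _ - _) => Ll.
  have L0 : 0 <= L by exact: normc_ge0.
  have := ler_pM (normc_ge0 u) L0 ur Ll; move: IH; set D := normc (e k.+1 u - e k u); set q := 2^-1 ^+ k.
  move=> IH h.
  have -> : 2 * (2^-1 * q) = q :> R by rewrite mulrA divff ?mul1r// pnatr_eq0.
  move: h; rewrite mulrA; have -> : r * 8 = 2^-1 by lra.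
  lra.
(* An ultrafilter on the naturals is not shift invariant; vanishing increments are what gives e k
   and e k.+1 the same limit along it. *)
have d0 u : normc u <= r -> (e k.+1 u - e k u) @[k --> \oo] --> (0 : C).
  move=> ur; apply/cvgCP => eps eps0.
  have q01 : 0 <= (2^-1 : R) < 1 by rewrite invr_ge0 ler0n invf_lt1// ltr1n.
  have [k0 hk] := geometric_small q01 eps0 (ler0n R 2).
  exists k0 => // k kk; rewrite [_ - 0]subr0; apply: le_lt_trans (d_small k u ur) _.
  apply: le_lt_trans hk; rewrite ler_wpM2l//; case/andP: q01 => q0 q1.
  by rewrite ler_wiXn2l// ltW.
have [U [UU FU]] := @ultraFilterLemma nat \oo _.
have Jpos k : pos_functional (lawf (N k)) by exact: lawf_pos.
have JW : \forall k \near U, lawf (N k) (fun=> 1) <= 1 by apply: filterE => k; rewrite lawf1.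
have [I0 I0pos I0P] := ultra_functional UU Jpos JW.
have I01 : I0 (fun=> 1) = 1.
  have c1 : continuous (fun _ : circle R => 1 : R) by exact: cst_continuous.
  have h := I0P _ c1; have h2 : lawf (N k) (fun=> 1) @[k --> U] --> (1 : R).
    have -> : (fun k => lawf (N k) (fun=> 1)) = fun=> 1 by apply/funext => k; rewrite lawf1.
    exact: cvg_cst.
  exact: (cvg_unique _ h h2).
have [nu nuP] := riesz_circle I0pos I01.
have cJ f : continuous f -> lawf (N k) f @[k --> U] --> lawf nu f.
  by move=> cf; rewrite -[lawf nu f]/(\int[nu]_x f x) nuP//; exact: I0P.
have ce u : normc u < 1 -> e k u @[k --> U] --> eta_fun nu u.
  move=> u1; have [-> h0] := eta_herg nu u1.
  have ch := cvg_herg _ cJ u1.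
  have c : (herg (lawf (N k)) u - 1) / (herg (lawf (N k)) u + 1) @[k --> U] -->
     (herg (lawf nu) u - 1) / (herg (lawf nu) u + 1).
    apply: cvg_divC => //; first exact: (cvgB (ch _) (cvg_cst _)).
    exact: (cvgD (ch _) (cvg_cst _)).
  by apply: cvg_trans c; apply: near_eq_cvg; apply: filterE => k; rewrite /e (eta_herg _ u1).1.
have cb u : normc u < 1 -> beta (e k u) @[k --> U] --> beta (eta_fun nu u).
  move=> u1; apply/cvgCP => eps eps0.
  have [d d_0 H] := peano_continuous (pb _ (eta_lt1 nu u1)) eps0.
  by have /cvgCP/(_ d d_0) := ce u u1; apply: filterS => k; exact: H.
have etaE u : normc u <= r -> eta_fun nu u = u * beta (eta_fun nu u).
  move=> ur; have u1 := r1 u ur; apply: (@cvgC_unique _ _ U _ (fun k => e k.+1 u)).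
    have h : (e k.+1 u - e k u + e k u) @[k --> U] --> 0 + eta_fun nu u.
      by apply: (@cvgD C _ _ U _); [move=> A /(d0 u ur) hA; exact: FU|exact: ce].
    rewrite add0r in h; apply: cvg_trans h; apply: near_eq_cvg; apply: filterE => k.
    by rewrite subrK.
  have h : u * beta (e k u) @[k --> U] --> u * beta (eta_fun nu u).
    by apply: (@cvgM C _ U _ (fun=> u)); [exact: cvg_cst|exact: cb].
  by apply: cvg_trans h; apply: near_eq_cvg; apply: filterE => k; rewrite eS.
have n01 : normc (0 : C) < 1 by rewrite normc0.
have BE u : normc u < r -> u != 0 -> B_fun nu u = beta (eta_fun nu u).
  by move=> ur u0; apply: (mulfI u0); rewrite B_funE -etaE// ltW.
have pbe : peano (fun u => beta (eta_fun nu u)) 0.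
  apply: (@peano_comp _ beta (eta_fun nu)); last exact: peano_eta.
  by apply: pb; rewrite eta_fun0.
have B0 : B_fun nu 0 = beta (eta_fun nu 0).
  apply: (@near0_peano_inj _ (B_fun nu) (fun u => beta (eta_fun nu u))) => //.
    exact: peano_B.
  by apply: filterS (near0_ball r0) => u; exact: BE.
exists nu; split.
  by rewrite /nonzero_mean -/(mean_of nu) -B_fun0 B0 cexp_neq0.
apply: filterS (near0_ball r0) => u ur; have [->//|u0] := eqVneq u 0; exact: BE.
Qed.

Lemma exp_pair_exists b I b' I' t : pos_functional I -> pos_functional I' -> 0 <= t ->
  exists p, exp_pair (fun w => levy b' I' (w / (1 + w))) (fun w => levy b I (w / (1 + w))) t p.
Proof.
move=> Ipos Ipos' t0; have [nu [nu0 nuP]] := free_levy_exists b' Ipos' t0.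
have [mu muP] := levy_marginal nu b Ipos t0.
exists (mu, nu); split=> //=.
apply: filterS3 (cT_levy nu0 nuP) (cT_diag nu0) (cT_levy nu0 (near0_unit_disk muP)) => w E1 E2 E3.
by rewrite -E2.
Qed.

Definition dirac1 : M := \d_(circle1 R : borel_circle R).

Lemma dirac1_cintegral (f : circle R -> C) : continuous f ->
  cintegral dirac1 f = f (circle1 R).
Proof.
move=> cf; have E g : continuous g -> \int[dirac1]_x g x = g (circle1 R).
  move=> cg; rewrite /Rintegral integral_dirac//.
    by rewrite diracT mul1e.
  by apply/measurable_EFinP; exact: continuous_measurable_circle.
rewrite /cintegral !E; [by case: (f _)|exact: continuous_Imc|exact: continuous_Rec].
Qed.

Lemma dirac1_moment u : normc u < 1 -> moment_fun dirac1 u = u / (1 - u).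
Proof.
move=> u1; rewrite /moment_fun dirac1_cintegral ?mulr1//.
apply: continuousMc; first by apply: continuousMc; [exact: continuous_cstc|exact: circle_val_continuous].
apply: continuousVc => [|x]; last by have := one_sub_circle_neq0 x u1; rewrite mulrC.
apply: continuousDc; first exact: continuous_cstc.
by apply: continuousNc; apply: continuousMc; [exact: continuous_cstc|exact: circle_val_continuous].
Qed.

Lemma exp_pair_dirac1 tau kap : 
  exp_pair tau kap 0 (dirac1, dirac1).
Proof.
set D := dirac1.
have D0 : nonzero_mean D.
  by rewrite /nonzero_mean dirac1_cintegral ?oner_neq0//; exact: circle_val_continuous.
have BD u : normc u < 1 -> u != 0 -> B_fun D u = 1.
  move=> u1 u0; apply: (mulfI u0); rewrite B_funE /eta_fun mulr1 dirac1_moment//.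
  have h := oner_sub_neq0 u1.
  by field; rewrite h subrK oner_neq0.
have n01 : normc (0 : C) < 1 by rewrite normc0.
have BD0 : B_fun D 0 = 1.
  apply: (@near0_peano_inj _ (B_fun D) (fun=> 1)); [exact: peano_B|exact: peano_cst|].
  by apply: near0_unit_disk => u; exact: BD.
have [chi chiP] := germ_inverse_exists D0; have [_ c1 _] := chiP.
split=> //=; apply: filterS2 (transform_germ D chiP) c1 => w [-> -> _ _] [cw _ _].
have -> : B_fun D (chi w) = 1 by have [->//|c0] := eqVneq (chi w) 0; exact: BD.
by rewrite !mul0r cexp0.
Qed.

Lemma exp_pair_conv tau kap s t p q r : exp_pair tau kap s p -> exp_pair tau kap t q ->
  exp_pair tau kap (s + t) r -> cfree_conv p q r.
Proof.
move=> [p0 pE] [q0 qE] [r0 rE]; left; split=> //.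
apply: filterS3 pE qE rE => z [-> ->] [-> ->] [-> ->].
by rewrite -!cexpD -!mulrDl -rmorphD.
Qed.

End free_semigroup.

(** * Weak continuity and existence of the semigroup *)

Section semigroup.
Variable R : realType.
Local Notation C := R[i].
Local Notation M := (prob_circle R).
Implicit Types (mu nu : M) (z w u : C) (b t : R) (I : (circle R -> R) -> R).

Lemma peano_levy_moebius b I : pos_functional I ->
  \forall w \near (0 : C), peano (fun w => levy b I (w / (1 + w))) w.
Proof.
move=> Ipos; apply: filterS2 (near0_moebius (near0_ball ltr01)) (near0_ball ltr01) => w w1 w1'.
apply: (@peano_comp _ (levy b I) (fun w => w / (1 + w))); first exact: peano_levy.
exact: peano_moebius.
Qed.

Lemma exp_pair_weakly_continuous tau kap (p : R -> M * M) :
  (\forall w \near (0 : C), peano tau w) -> (\forall w \near (0 : C), peano kap w) ->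
  (forall t, 0 <= t -> exp_pair tau kap t (p t)) ->
  weakly_continuous (fun t => (p t).1) /\ weakly_continuous (fun t => (p t).2).
Proof.
move=> pt pk pP.
suff H f : continuous f -> forall s : R, 0 <= s ->
    (\int[(p t).1]_x f x @[t --> within `[0, +oo[ (nbhs s)] --> \int[(p s).1]_x f x) /\
    (\int[(p t).2]_x f x @[t --> within `[0, +oo[ (nbhs s)] --> \int[(p s).2]_x f x).
  by split=> f cf; apply/subspace_continuousP => s; rewrite /= in_itv /= andbT => s0;
    have [] := H f cf s s0.
move=> cf s s0; have s10 : 0 <= s + 1 by rewrite addr_ge0.
have FF : ProperFilter (within `[0, +oo[%classic (nbhs s)).
  apply: within_nbhs_proper; apply: subset_closure.
  by rewrite /= in_itv /= s0.
have s_in : 0 <= s <= s + 1 by rewrite s0 lerDl ler01.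
apply: (@exp_pair_cvg R R _ FF p id tau kap s (s + 1) (p s) s10 pt pk s_in (pP s s0) _ _ f cf).
  have s1 : s < s + 1 by rewrite ltrDl.
  rewrite near_withinE; apply: filterS (lt_nbhsl s1) => t /ltW ts.
  by rewrite /= in_itv /= andbT => t0; rewrite t0 ts; split; [|exact: pP].
exact: cvg_within.
Qed.

Lemma representation_semigroup mu nu g sigma : nonzero_mean nu -> free_infdiv nu ->
  Sigma_representation mu nu g sigma ->
  exists p : R -> M * M, cfree_semigroup_through p mu nu.
Proof.
move=> nu0 nuinf /representation_levy[b [_ cTE]].
have Ipos := integral_functional_pos sigma.
have [b' [I' [Ipos' TE]]] := levy_khintchine nu0 nu0 (free_infdiv_roots nu0 nuinf).
pose tau w := levy b' I' (w / (1 + w)).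
pose kap w := levy b (integral_functional sigma) (w / (1 + w)).
have /choice[q qP] : forall t, exists p, 0 <= t -> exp_pair tau kap t p.
  move=> t; have [t0|t0] := leP 0 t; last by exists (dirac1 R, dirac1 R).
  by have [p pP] := exp_pair_exists b b' Ipos Ipos' t0; exists p.
(* [exp_pair] fixes transforms only; inserting the prescribed pairs at 0 and 1 makes the boundary
   conditions equalities of measures. *)
pose p t := if t == 0 then (dirac1 R, dirac1 R) else if t == 1 then (mu, nu) else q t.
have pP t : 0 <= t -> exp_pair tau kap t (p t).
  rewrite /p; have [->|_] := eqVneq t 0; first by move=> _; exact: exp_pair_dirac1.
  have [->|_] := eqVneq t 1; last exact: qP.
  move=> _; split=> //=; apply: filterS3 cTE TE (cT_diag nu0) => w E1 E2 E3.
  by rewrite !mul1r; split; [rewrite -E3; exact: E2|exact: E1].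
have [c1 c2] := exp_pair_weakly_continuous (peano_levy_moebius b' Ipos') (peano_levy_moebius b Ipos) pP.
exists p; split.
- split=> // s t s0 t0; apply: exp_pair_conv (pP s s0) (pP t t0) (pP _ _).
  by rewrite addr_ge0.
- by rewrite /p oner_eq0 eqxx.
- by rewrite /p eqxx.
Qed.

End semigroup.

(** * Multiplicative functions on [0, 1] *)

Section multiplicative.
Variable R : realType.
Local Notation C := R[i].

Lemma cexp_eq1 (z : C) : cexp z = 1 -> `|complex.Im z| < 1 -> z = 0.
Proof.
move=> z1 Iz.
have Re0 : complex.Re z = 0.
  apply: expR_inj; rewrite expR0 -normc_cexp z1 normc_1 //.
have zE : z = 0 +i* complex.Im z by case: z Re0 {z1 Iz} => x y /= ->.
have pi2 := @pi_ge2 R.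
move: Iz z1; rewrite {2}zE -/(cis _) ltr_norml => /andP[I1 I2] c1.
rewrite zE; apply/eqcP => //=; have [h|h|//] := ltrgtP (complex.Im z) 0.
  have := @cis_neq1 R (- complex.Im z); rewrite oppr_gt0 h /= => /(_ _)/wrap[].
    by rewrite mulr2n; lra.
  by have := cisD (complex.Im z) (- complex.Im z); rewrite subrr cis0 c1 mul1r => <-; rewrite eqxx.
have := @cis_neq1 R (complex.Im z); rewrite h c1 eqxx /= => /(_ _)/wrap[]//.
by rewrite mulr2n; lra.
Qed.

Lemma multiplicative_exp (a : R -> C) :
  (forall s t, 0 <= s -> 0 <= t -> s + t <= 1 -> a (s + t) = a s * a t) ->
  a t @[t --> 0^'+] --> (1 : C) ->
  exists lam, forall n, a n.+1%:R^-1 = cexp (n.+1%:R^-1%:C * lam).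
Proof.
move=> aM a1.
have p1 : peano (fun w : C => 1 + w) 0 by apply: peanoD; [exact: peano_cst|exact: peano_id].
have [L [L0 pL LE]] : exists L : C -> C, [/\ L 0 = 0, \forall w \near (0 : C), peano L w &
    \forall w \near (0 : C), 1 + w = cexp (L w)].
  apply: log_germ; last by rewrite cexp0 addr0.
  by apply: filterS (near0_ball (@ltr01 R)) => w _; apply: peanoD; [exact: peano_cst|exact: peano_id].
(* Three logarithms below 1/4 combine to less than 1, which excludes nonzero multiples of 2 pi i in
   l(s + t) - l(s) - l(t). *)
have t0 : 0 < 4^-1 :> R by rewrite invr_gt0.
have [e1 e10 Ls] := peano_continuous (near0_at pL) t0.
move/near0CP: LE => [e2 e20 LE].
have e0 : 0 < Num.min e1 e2 by rewrite lt_min e10.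
have /cvgCP/(_ _ e0)[d /= d0 aP] := a1.
pose l t := L (a t - 1).
have lP t : 0 < t < d -> normc (l t) < 4^-1 /\ a t = cexp (l t).
  move=> /andP[t00 td]; have := aP t; rewrite /ball /= sub0r normrN gtr0_norm// => /(_ td t00).
  rewrite lt_min => /andP[h1 h2]; split; last by rewrite -LE// addrCA subrr addr0.
  by have := Ls (a t - 1); rewrite subr0 L0 subr0; apply.
have lD s t : 0 < s -> 0 < t -> s + t < d -> s + t <= 1 -> l (s + t) = l s + l t.
  move=> s0 t00 std st1.
  have [|b1 E1] := lP s; first by rewrite s0 /=; lra.
  have [|b2 E2] := lP t; first by rewrite t00 /=; lra.
  have [|b3 E3] := lP (s + t); first by rewrite addr_gt0.
  apply/eqP; rewrite -subr_eq0; apply/eqP; apply: cexp_eq1.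
    rewrite cexpB cexpD -E1 -E2 -E3 aM ?(ltW s0) ?(ltW t00)//.
    by apply: divff; rewrite mulf_neq0 ?E1 ?E2 ?cexp_neq0.
  apply: le_lt_trans (normc_Im _) _.
  have := normcB (l (s + t)) (l s + l t); have := normcD (l s) (l t); lra.
have lM s k : 0 < s -> k.+1%:R * s < d -> k.+1%:R * s <= 1 -> l (k.+1%:R * s) = k.+1%:R * l s.
  move=> s0; elim: k => [|k IH]; first by rewrite !mul1r.
  rewrite -natr1 [in LHS]mulrDl [in X in X < d]mulrDl [in X in X <= 1]mulrDl mul1r => kd k1.
  have ks : 0 < k.+1%:R * s by rewrite mulr_gt0.
  rewrite lD// IH; [by rewrite -[in RHS](natr1 k.+1) mulrDl mul1r|lra|lra].
have aX s k : 0 <= s -> k.+1%:R * s <= 1 -> a (k.+1%:R * s) = a s ^+ k.+1.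
  move=> s0; elim: k => [|k IH]; first by rewrite mul1r expr1.
  rewrite -natr1 mulrDl mul1r => k1; rewrite aM ?mulr_ge0// IH ?exprSr//; lra.
have [N Nd] : exists N : nat, N.+1%:R^-1 < d.
  have := @cvg_harmonic R; move=> /cvgrPdist_lt/(_ d d0)[N _ /(_ N)/(_ (leqnn N))] /=.
  by rewrite sub0r normrN gtr0_norm ?invr_gt0// => h; exists N.
exists (N.+1%:R * l N.+1%:R^-1) => n.
(* A common submultiple of 1/(N + 1), below which l is additive, and of 1/(n + 1), where a is
   wanted. *)
pose s : R := (N.+1%:R * n.+1%:R)^-1.
have s0 : 0 < s by rewrite invr_gt0 mulr_gt0.
have sN : n.+1%:R * s = N.+1%:R^-1 by rewrite /s invfM mulrCA divff ?mulr1// pnatr_eq0.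
have sn : N.+1%:R * s = n.+1%:R^-1 by rewrite /s invfM mulrA divff ?mul1r// pnatr_eq0.
have le1 k : k.+1%:R^-1 <= 1 :> R by rewrite invf_le1// ler1n.
have := lM s n s0; rewrite sN => /(_ Nd (le1 N)) ->.
rewrite -sn aX ?sn// ?ltW//.
have [|_ ->] := lP s.
  rewrite s0 /=; apply: le_lt_trans Nd; rewrite -sN; apply: ler_peMl; [exact: ltW|by rewrite ler1n].
rewrite -cexpMn; congr cexp.
rewrite realcV realc_nat (mulrCA N.+1%:R) [RHS]mulrA mulVf ?mul1r//.
Qed.

End multiplicative.

(** * Rigidity of semigroups through (mu, nu) *)

Section semigroup_rigidity.
Variable R : realType.
Local Notation C := R[i].
Local Notation M := (prob_circle R).
Implicit Types (mu nu : M) (z w u : C) (b t s : R) (I : (circle R -> R) -> R).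
Implicit Types p : R -> M * M.

Lemma levy_shift b I lam : pos_functional I -> cexp (levy b I 0) = cexp lam ->
  levy (complex.Im lam) I 0 = lam /\
  forall x, cexp (levy (complex.Im lam) I x) = cexp (levy b I x).
Proof.
move=> Ipos E.
have l0 (c : R) : levy c I 0 = - I (fun=> 1) +i* c.
  by rewrite /levy herg0//; apply/eqcP; rewrite /=; ring.
have ReE : - I (fun=> 1) = complex.Re lam.
  by apply: expR_inj; rewrite -normc_cexp -E l0 normc_cexp.
have E0 : levy (complex.Im lam) I 0 = lam by rewrite l0 ReE; case: (lam).
split=> // x.
have -> : levy (complex.Im lam) I x = levy b I x + (levy (complex.Im lam) I 0 - levy b I 0).
  by rewrite /levy; ring.
by rewrite cexpD cexpB E0 E divff ?mulr1// cexp_neq0.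
Qed.

(** p(t) and p(1 - t) convolve to p(1), whose second component has nonzero mean. *)
Lemma semigroup_nonzero p t : cfree_semigroup p -> nonzero_mean (p 1).2 -> 0 <= t <= 1 ->
  nonzero_mean (p t).2.
Proof.
move=> [pD _ _] p1 /andP[t0 t1]; have t1' : 0 <= 1 - t by rewrite subr_ge0.
have := pD t (1 - t) t0 t1'; rewrite [t + _]addrCA subrr addr0 => c.
by have [] := cfree_conv_nonzero c p1.
Qed.

Lemma semigroup_mean p s t : cfree_semigroup p -> nonzero_mean (p 1).2 ->
  0 <= s -> 0 <= t -> s + t <= 1 ->
  mean_of (p (s + t)).1 = mean_of (p s).1 * mean_of (p t).1 /\
  mean_of (p (s + t)).2 = mean_of (p s).2 * mean_of (p t).2.
Proof.
move=> sg p1 s0 t0 st1.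
have st : 0 <= s + t <= 1 by rewrite st1 addr_ge0.
have [pD _ _] := sg.
have [a b /near0_at] := cfree_conv_nonzero (pD s t s0 t0) (semigroup_nonzero sg p1 st).
have [<- <- _ _] := transform0 (p (s + t)).1 (semigroup_nonzero sg p1 st).
have [<- <- _ _] := transform0 (p s).1 a.
by have [<- <- _ _] := transform0 (p t).1 b; case.
Qed.

Lemma mean_cvg1 (m : R -> M) : weakly_continuous m ->
  Defs.eq_measure (m 0) (dirac1 R) -> mean_of (m t) @[t --> 0^'+] --> (1 : C).
Proof.
move=> wc E0.
have cid := @circle_val_continuous R.
have c f : continuous f -> \int[m t]_x f x @[t --> 0^'+] --> \int[m 0]_x f x.
  move=> cf; have /subspace_continuousP/(_ 0) := wc f cf.
  rewrite /= in_itv /= lexx => /(_ isT); apply: cvg_trans; apply: cvg_app.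
  move=> A hA; have {}hA : nbhs (0 : R) (fun t => [set` `[0, +oo[] t -> A t) := hA.
  suff : nbhs (0 : R) (fun t => 0 < t -> A t) by [].
  by apply: filterS hA => t At t0; apply: At; rewrite /= in_itv /= ltW.
have -> : (1 : C) = (\int[m 0]_x complex.Re ((x : circle R) : C)) +i* (\int[m 0]_x complex.Im ((x : circle R) : C)).
  rewrite -[RHS]/(cintegral (m 0) (fun x => (x : C))) (eq_measure_cintegral _ E0).
  by rewrite dirac1_cintegral.
apply: cvg_ReIm; [exact: c (continuous_Rec cid)|exact: c (continuous_Imc cid)].
Qed.

Lemma exp_pair_unique tau kap s (q r : M * M) : 0 <= s ->
  (\forall w \near (0 : C), peano tau w) -> (\forall w \near (0 : C), peano kap w) ->
  exp_pair tau kap s q -> exp_pair tau kap s r -> forall f, continuous f ->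
  \int[q.1]_x f x = \int[r.1]_x f x.
Proof.
move=> s0 pt pk qP rP f cf; have ss : 0 <= s <= s by rewrite s0 lexx.
have [h _] := @exp_pair_cvg R nat \oo _ (fun=> q) (fun=> s) tau kap s s r s0 pt pk ss rP
  (nearW _ (fun=> conj ss qP)) (cvg_cst _) f cf.
by apply: (cvg_unique _ _ h) => //; exact: cvg_cst.
Qed.

(** p(1/(n + 1)) is a root of (mu, nu), so its transforms are the expected exponentials up to roots
    of unity; the values at w = 0, which are the means, force these to be 1. *)
Lemma exp_pair_rational mu nu p tau kap n k : cfree_semigroup_through p mu nu ->
  nonzero_mean nu ->
  (\forall w \near (0 : C), peano tau w) -> (\forall w \near (0 : C), peano kap w) ->
  (\forall w \near (0 : C), T_transform nu w = cexp (tau w) /\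
      cT_transform mu nu w = cexp (kap w)) ->
  mean_of (p n.+1%:R^-1).1 = cexp (n.+1%:R^-1%:C * kap 0) ->
  mean_of (p n.+1%:R^-1).2 = cexp (n.+1%:R^-1%:C * tau 0) ->
  (k <= n)%N -> exp_pair tau kap (k.+1%:R * n.+1%:R^-1) (p (k.+1%:R * n.+1%:R^-1)).
Proof.
move=> [sg [p11 p12] _] nu0 pt pk E m1 m2 kn; set a : R := n.+1%:R^-1 in m1 m2 *.
have a0 : 0 <= a by rewrite invr_ge0.
have na : n.+1%:R * a = 1 by rewrite divff// pnatr_eq0.
have le1 j : (j <= n)%N -> 0 <= j.+1%:R * a <= 1.
  by move=> jn; rewrite mulr_ge0//= /a ler_pdivrMr// mul1r ler_nat.
have p10 := eq_measure_mean (eq_measure_sym p12) nu0.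
have P j : (j <= n)%N -> nonzero_mean (p a).2 /\ \forall z \near (0 : C),
    T_transform (p (j.+1%:R * a)).2 z = T_transform (p a).2 z ^+ j.+1 /\
    cT_transform (p (j.+1%:R * a)).1 (p (j.+1%:R * a)).2 z = cT_transform (p a).1 (p a).2 z ^+ j.+1.
  move=> jn; exact: (cfree_power_transform (semigroup_power j sg a0) (semigroup_nonzero sg p10 (le1 j jn))).
have [pa0] := P n (leqnn n); rewrite na (eq_measure_T p12) (eq_measure_cT p11 p12) => En.
have [c [e [_ _ ce]]] := root_transforms pa0 pt pk E En.
have [T0 cT0 _ _] := transform0 (p a).1 pa0.
have [c1 e1] : c = 1 /\ e = 1.
  have := near0_at ce; rewrite T0 cT0 m1 m2 => -[h1 h2].
  by split; [apply: (mulIf (cexp_neq0 (a%:C * tau 0)))|apply: (mulIf (cexp_neq0 (a%:C * kap 0)))];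
    rewrite mul1r.
have [_ Ek] := P k kn.
split; first exact: (semigroup_nonzero sg p10 (le1 k kn)).
apply: filterS2 ce Ek => w; rewrite c1 e1 !mul1r => -[Tw cTw] [-> ->].
by rewrite Tw cTw -!cexpMn !mulrA rmorphM /= realc_nat.
Qed.

Lemma dense_fractions (t d : R) : 0 < t <= 1 -> 0 < d -> exists n k,
  (k <= n)%N /\ `|k.+1%:R * n.+1%:R^-1 - t| < d.
Proof.
move=> /andP[t0 t1] d0.
have [n nd] : exists n : nat, n.+1%:R^-1 < d.
  have := @cvg_harmonic R; move=> /cvgrPdist_lt/(_ d d0)[N _ /(_ N)/(_ (leqnn N))] /=.
  by rewrite sub0r normrN gtr0_norm ?invr_gt0// => h; exists N.
have n0 : 0 < n.+1%:R :> R by [].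
have ex : exists k : nat, t * n.+1%:R <= k.+1%:R by exists n; rewrite ger_pMl.
pose k := ex_minn ex; exists n, k; rewrite /k; case: ex_minnP => {}k kP kmin.
split; first by apply: kmin; rewrite ger_pMl.
have kt : k%:R < t * n.+1%:R.
  case: k kP kmin => [|k] kP kmin; first by rewrite mulr_gt0.
  by rewrite ltNge; apply/negP => /kmin; rewrite ltnn.
rewrite ltr_norml; apply/andP; split.
  by apply: lt_le_trans (_ : 0 <= _); [rewrite oppr_lt0|rewrite subr_ge0 ler_pdivlMr].
apply: le_lt_trans nd; have : k%:R * n.+1%:R^-1 <= t by rewrite ler_pdivrMr// ltW.
rewrite -(natr1 k) mulrDl mul1r => h.
by rewrite lerBlDr addrC lerD2l.
Qed.

(** g fixes b only modulo 2 pi, and T likewise b'. The logarithms of the means of p select the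
    values for which p and the constructed q have the same transforms at all fractions (k + 1)/(n +
    1) in ]0, 1]; weak continuity of both reaches the other t. *)
Lemma semigroup_exp_pairs mu nu g sigma p : nonzero_mean mu -> nonzero_mean nu ->
  free_infdiv nu -> Sigma_representation mu nu g sigma -> cfree_semigroup_through p mu nu ->
  exists b b' I' (q : R -> M * M), [/\ (g : C) = cis b, pos_functional I',
   forall t, 0 <= t -> exp_pair (fun w => levy b' I' (w / (1 + w)))
      (fun w => levy b (integral_functional sigma) (w / (1 + w))) t (q t) &
   forall t, 0 < t <= 1 -> forall f, continuous f -> \int[(p t).1]_x f x = \int[(q t).1]_x f x].
Proof.
move=> mu0 nu0 nuinf /representation_levy[b0 [gE cTE]] pthrough.
have Ipos := integral_functional_pos sigma.
have [b' [I' [Ipos' TE]]] := levy_khintchine nu0 nu0 (free_infdiv_roots nu0 nuinf).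
have [sg [p11 p12] [p01 p02]] := pthrough.
have [_ wc1 wc2] := sg.
have p10 := eq_measure_mean (eq_measure_sym p12) nu0.
have [l1 L1] : exists lam, forall n, mean_of (p n.+1%:R^-1).1 = cexp (n.+1%:R^-1%:C * lam).
  apply: (@multiplicative_exp R (fun t => mean_of (p t).1)); last exact: mean_cvg1.
  by move=> s t s0 t0 st; have [] := semigroup_mean sg p10 s0 t0 st.
have [l2 L2] : exists lam, forall n, mean_of (p n.+1%:R^-1).2 = cexp (n.+1%:R^-1%:C * lam).
  apply: (@multiplicative_exp R (fun t => mean_of (p t).2)); last exact: mean_cvg1.
  by move=> s t s0 t0 st; have [] := semigroup_mean sg p10 s0 t0 st.
have [T0 cT0 _ _] := transform0 mu nu0.
have M1 : mean_of mu = cexp l1.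
  by have := L1 0%N; rewrite invr1 mul1r => <-; rewrite /mean_of (eq_measure_cintegral _ p11).
have M2 : mean_of nu = cexp l2.
  by have := L2 0%N; rewrite invr1 mul1r => <-; rewrite /mean_of (eq_measure_cintegral _ p12).
have z0 : (0 : C) / (1 + 0) = 0 by rewrite mul0r.
have [] := @levy_shift b0 (integral_functional sigma) l1 Ipos.
  by have := near0_at cTE; rewrite z0 cT0 M1.
set b := complex.Im l1 => kap0 kapE.
have [] := @levy_shift b' I' l2 Ipos'.
  by have := near0_at TE; rewrite z0 (near0_at (cT_diag nu0)) T0 M2.
set b2 := complex.Im l2 => tau0 tauE.
pose tau w := levy b2 I' (w / (1 + w)).
pose kap w := levy b (integral_functional sigma) (w / (1 + w)).
have pt : \forall w \near (0 : C), peano tau w := peano_levy_moebius b2 Ipos'.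
have pk : \forall w \near (0 : C), peano kap w := peano_levy_moebius b Ipos.
have E : \forall w \near (0 : C), T_transform nu w = cexp (tau w) /\ cT_transform mu nu w = cexp (kap w).
  apply: filterS3 cTE TE (cT_diag nu0) => w E1 E2 E3; split.
    by rewrite /tau tauE -E3; exact: E2.
  by rewrite /kap kapE; exact: E1.
have /choice[q qP] : forall t, exists r : M * M, 0 <= t -> exp_pair tau kap t r.
  move=> t; have [t0|t0] := leP 0 t; last by exists (dirac1 R, dirac1 R).
  by have [r rP] := exp_pair_exists b b2 Ipos Ipos' t0; exists r.
exists b, b2, I', q; split=> //.
  have := kapE 0; rewrite !cexp_levy => /mulIf; rewrite cexp_neq0 => /(_ isT) ->.
  exact: gE.
move=> t t01 f cf.
have rat n k : (k <= n)%N ->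
    \int[(p (k.+1%:R * n.+1%:R^-1)).1]_x f x = \int[(q (k.+1%:R * n.+1%:R^-1)).1]_x f x.
  move=> kn; have s0 : 0 <= k.+1%:R * n.+1%:R^-1 :> R by rewrite mulr_ge0// invr_ge0.
  apply: (exp_pair_unique s0 pt pk) => //; last exact: qP.
  apply: (exp_pair_rational pthrough) => //.
    by rewrite L1 /kap z0 kap0.
  by rewrite L2 /tau z0 tau0.
have [wq _] := exp_pair_weakly_continuous pt pk qP.
have /andP[t0 t1] := t01.
have tin : [set` `[0, +oo[] t by rewrite /= in_itv /= andbT ltW.
have /subspace_continuousP/(_ t tin) cp := wc1 f cf.
have /subspace_continuousP/(_ t tin) cq := wq f cf.
apply/eqP; rewrite -subr_eq0 -normr_le0 leNgt; apply/negP => D0.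
set D := `|_ - _| in D0.
have D2 : 0 < D / 2 by rewrite divr_gt0.
have /cvgrPdist_lt/(_ _ D2) hp := cp; have /cvgrPdist_lt/(_ _ D2) hq := cq.
have : \forall s \near t, 0 <= s ->
    `|\int[(p t).1]_x f x - \int[(p s).1]_x f x| < D / 2 /\
    `|\int[(q t).1]_x f x - \int[(q s).1]_x f x| < D / 2.
  move: hp hq; rewrite !near_withinE; apply: filterS2 => s h1 h2 s0.
  by split; [apply: h1|apply: h2]; rewrite /= in_itv /= andbT.
move=> -[d /= d0 hd].
have [n [k [kn kd]]] := dense_fractions t01 d0.
have [||] := hd (k.+1%:R * n.+1%:R^-1); first by rewrite /ball /= distrC.
  by rewrite mulr_ge0// invr_ge0.
rewrite (rat n k kn) => h1 h2.
have aux (x y z e : R) : `|x - z| < e / 2 -> `|y - z| < e / 2 -> `|x - y| < e.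
  by have := ler_distD z x y; rewrite (distrC z y); lra.
by have := aux _ _ _ _ h1 h2; rewrite ltxx.
Qed.

End semigroup_rigidity.

(** * The limits at time zero *)

Section infinitesimal_generator.
Variable R : realType.
Local Notation C := R[i].
Local Notation M := (prob_circle R).
Local Notation T := (circle R).
Implicit Types (mu nu : M) (z w u : C) (b t s : R) (I : (T -> R) -> R).

(** The absolute value keeps the functional positive for every real t, as [functional_cvg] demands
    of the whole family. *)
Definition rescaled mu t (f : T -> R) : R :=
  lawf mu (fun x : T => f x * (`|t|^-1 * (1 - complex.Re (x : C)))).

Lemma continuous_rescale t : continuous (fun x : T => `|t|^-1 * (1 - complex.Re (x : C))).
Proof.
have cid := @circle_val_continuous R.
have E : (fun x : T => `|t|^-1 * (1 - complex.Re (x : C))) =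
    fun x : T => complex.Re ((`|t|^-1)%:C * (1 - (x : C))).
  by apply/funext => x; rewrite ReMr ReB.
rewrite E; apply: continuous_Rec; apply: continuousMc; first exact: continuous_cstc.
by apply: continuousDc; [exact: continuous_cstc|exact: continuousNc cid].
Qed.

Lemma continuous_mulR (f g : T -> R) : continuous f -> continuous g ->
  continuous (fun x => f x * g x).
Proof. by move=> cf cg x; exact: (cvgM (cf x) (cg x)). Qed.

Lemma rescaled_pos mu t : pos_functional (rescaled mu t).
Proof.
have cw := @continuous_rescale t; have L := lawf_pos mu.
split=> [f g cf cg|a f cf|f cf f0].
- rewrite /rescaled -functionalD//; [|exact: continuous_mulR|exact: continuous_mulR].
  by congr lawf; apply/funext => x; rewrite mulrDl.
- rewrite /rescaled -functionalZ//; last exact: continuous_mulR.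
  by congr lawf; apply/funext => x; rewrite mulrA.
- apply: (functional_ge0 L); first exact: (continuous_mulR cf cw).
  move=> x; rewrite !mulr_ge0 ?invr_ge0// subr_ge0; apply: le_trans (ler_norm _) _.
  by rewrite -(normc_circle x); exact: normc_Re.
Qed.

(** For x != 0, (1 - y)/(1 - y x) = (1 - 1/x)/(1 - y x) + 1/x, and 1/(1 - y x) integrates to 1 +
    m(x). *)
Lemma cauchy_difference mu (x : C) : normc x < 1 ->
  cfun (lawf mu) (fun y : T => (1 - (y : C)) / (1 - (y : C) * x)) =
  (1 + moment_fun mu x) * (1 - B_fun mu x).
Proof.
move=> x1; have L := lawf_pos mu; have cid := @circle_val_continuous R.
have c1 : continuous (fun y : T => 1 / (1 - (y : C) * x)).
  by apply: (continuous_cauchy_kernel _ x1); exact: continuous_cstc.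
have cc (c : C) : continuous (fun _ : T => c) by exact: continuous_cstc.
have E1 : cfun (lawf mu) (fun y : T => 1 / (1 - (y : C) * x)) = 1 + moment_fun mu x.
  by rewrite (moment_funE mu x1) /cauchyT addrC subrK.
have [x0|x0] := eqVneq x 0.
  have -> : (fun y : T => (1 - (y : C)) / (1 - (y : C) * x)) = fun y : T => 1 - (y : C).
    by apply/funext => y; rewrite x0 mulr0 subr0 divr1.
  rewrite (cfunB L (cc 1) cid) (cfun_cst L) lawf1 x0 moment_fun0 B_fun0.
  by rewrite addr0 !mul1r.
have -> : (fun y : T => (1 - (y : C)) / (1 - (y : C) * x)) =
    fun y : T => (1 - x^-1) * (1 / (1 - (y : C) * x)) + x^-1.
  by apply/funext => y; have h := one_sub_circle_neq0 y x1; field; rewrite h x0.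
rewrite (cfunD L (continuousMc (cc _) c1) (cc _)) (cfunZ L _ c1) E1 (cfun_cst L) lawf1 mulr1.
have -> : B_fun mu x = x^-1 * eta_fun mu x by rewrite -B_funE mulKf.
by have h := moment_neq mu x1; rewrite /eta_fun; field; rewrite h x0.
Qed.

(** With a = 1 - Re y and c = i Im y one has a - c = 1 - y and a + c = 1 - conj(y); the rest uses y
    conj(y) = 1. *)
Lemma generator_kernel (y : T) (x : C) : normc x < 1 ->
  (1 + (y : C) * x) / (1 - (y : C) * x) * (1 - complex.Re (y : C))%:C
    - 'i * (complex.Im (y : C))%:C =
  (1 - x) * ((1 - (y : C)) / (1 - (y : C) * x)).
Proof.
move=> x1; have h := one_sub_circle_neq0 y x1.
pose v := conjc (y : C); have yv : (y : C) * v = 1 by rewrite mulc_conj normc_circle expr1n.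
have e1 : (1 - complex.Re (y : C))%:C - 'i * (complex.Im (y : C))%:C = 1 - (y : C).
  by apply/eqcP; rewrite /= ?ReB ?ImB /=; ring.
have e2 : (1 - complex.Re (y : C))%:C + 'i * (complex.Im (y : C))%:C = 1 - v.
  by rewrite /v; case: (y : C) => a c; apply/eqcP; rewrite /=; ring.
apply: (mulIf h); rewrite mulrBl -[RHS]mulrA divfK// mulrAC divfK//.
move: e1 e2; set a := (1 - complex.Re _)%:C; set c := 'i * _ => e1 e2.
set Y := circle_val y in yv e1 e2 *.
have -> : (1 + Y * x) * a - c * (1 - Y * x) = (a - c) + Y * x * (a + c) by ring.
rewrite e1 e2; have -> : Y * x * (1 - v) = Y * x - x * (Y * v) by ring.
by rewrite yv; ring.
Qed.

Lemma herg_rescaled mu t (x : C) : 0 < t -> normc x < 1 ->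
  herg (rescaled mu t) x - 'i * (t^-1 * lawf mu (fun y : T => complex.Im (y : C)))%:C =
  (1 - x) * (1 + moment_fun mu x) * ((1 - B_fun mu x) / t%:C).
Proof.
move=> t0 x1; have L := lawf_pos mu; have cid := @circle_val_continuous R.
have ck := continuous_herg_kernel x1.
have tn : t%:C != 0 :> C.
  by apply: contraTneq t0 => /(congr1 (@complex.Re R)) /= ->; rewrite ltxx.
have cRe (f : T -> R) : continuous f -> continuous (fun y : T => (f y)%:C : C).
  by move=> cf y; exact: (@cvg_realc R _ _ _ f _ (cf y)).
have cIm : continuous (fun y : T => (complex.Im (y : C))%:C : C).
  by apply: cRe; exact: (continuous_Imc cid).
have cI : continuous (fun y : T => 'i * (complex.Im (y : C))%:C : C).
  by apply: continuousMc; [exact: continuous_cstc|exact: cIm].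
have cR : continuous (fun y : T => (1 - complex.Re (y : C))%:C : C).
  have cR' := continuous_Rec cid.
  by apply: cRe => y; exact: (cvgB (cvg_cst _) (cR' y)).
have ReMrr (z : C) (r : R) : complex.Re (z * r%:C) = complex.Re z * r by rewrite mulrC ReMr mulrC.
have ImMrr (z : C) (r : R) : complex.Im (z * r%:C) = complex.Im z * r by rewrite mulrC ImMr mulrC.
have E1 : herg (rescaled mu t) x = t%:C^-1 * cfun (lawf mu)
    (fun y : T => (1 + (y : C) * x) / (1 - (y : C) * x) * (1 - complex.Re (y : C))%:C).
  rewrite -(cfunZ L _ (continuousMc ck cR)).
  rewrite /herg /cfun /rescaled gtr0_norm//; congr (lawf mu _ +i* lawf mu _); apply/funext => y.
    by rewrite -realcV ReMr ReMrr mulrCA.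
  by rewrite -realcV ImMr ImMrr mulrCA.
have E2 : 'i * (t^-1 * lawf mu (fun y : T => complex.Im (y : C)))%:C =
    t%:C^-1 * cfun (lawf mu) (fun y : T => 'i * (complex.Im (y : C))%:C).
  rewrite rmorphM /= realcV mulrCA; congr (_ * _).
  have -> : cfun (lawf mu) (fun y : T => 'i * (complex.Im (y : C))%:C) =
      'i * cfun (lawf mu) (fun y : T => (complex.Im (y : C))%:C).
    by rewrite (cfunZ L _ cIm).
  by congr (_ * _); rewrite /cfun /= (functional_cst L) mul0r.
rewrite E1 E2 -mulrBr -(cfunB L (continuousMc ck cR) cI).
have -> : (fun y : T => (1 + (y : C) * x) / (1 - (y : C) * x) * (1 - complex.Re (y : C))%:C -
     'i * (complex.Im (y : C))%:C) = fun y : T => (1 - x) * ((1 - (y : C)) / (1 - (y : C) * x)).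
  by apply/funext => y; exact: generator_kernel.
have c1 : continuous (fun y : T => (1 - (y : C)) / (1 - (y : C) * x)).
  apply: (continuous_cauchy_kernel _ x1); apply: continuousDc; first exact: continuous_cstc.
  exact: continuousNc cid.
by rewrite (cfunZ L _ c1) (cauchy_difference mu x1); field.
Qed.

Lemma generator_limit b b' I I' (q : R -> M * M) : pos_functional I -> pos_functional I' ->
  (forall t, 0 <= t -> exp_pair (fun w => levy b' I' (w / (1 + w)))
     (fun w => levy b I (w / (1 + w))) t (q t)) ->
  (t^-1 * lawf (q t).1 (fun y : T => complex.Im (y : C)) @[t --> 0^'+] --> b) /\
  (forall f, continuous f -> rescaled (q t).1 t f @[t --> 0^'+] --> I f).
Proof.
move=> Ipos Ipos' qP.
pose tau w := levy b' I' (w / (1 + w)); pose kap w := levy b I (w / (1 + w)).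
have pt : \forall w \near (0 : C), peano tau w := peano_levy_moebius b' Ipos'.
have pk : \forall w \near (0 : C), peano kap w := peano_levy_moebius b Ipos.
have [d gd] := good_radius_exists (@ler01 R) pt pk.
have [d0 dh ptd btd] := gd.
have hlt1 : 2^-1 < 1 :> R by rewrite invf_lt1// ltr1n.
have dn1 : d < 1 by exact: le_lt_trans dh _.
have FF : ProperFilter (0^'+ : set_system R) by exact: at_right_proper_filter.
have near01 : \forall t \near (0 : R)^'+, 0 < t <= 1.
  by apply: filterS2 (nbhs_right_gt 0) (nbhs_right_le ltr01) => t -> ->.
have ct : t @[t --> (0 : R)^'+] --> (0 : R) by exact: cvg_at_right_filter cvg_id.
have tn0 : \forall t \near (0 : R)^'+, t != 0 by apply: filterS near01 => t /andP[t0 _]; rewrite gt_eqF.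
pose beta t := t^-1 * lawf (q t).1 (fun y : T => complex.Im (y : C)).
pose J t := rescaled (q t).1 t.
have Jpos t : pos_functional (J t) by exact: rescaled_pos.
have x0lt w : normc w < d -> normc (w / (1 + w)) < 1.
  move=> wd; rewrite -(psie_0 tau); apply: le_lt_trans (btd _ _ _ wd) _ => //.
  by rewrite lexx ler01.
have cy w : normc w < d -> psie tau t w @[t --> (0 : R)^'+] --> w / (1 + w).
  by move=> wd; rewrite -(psie_0 tau); apply: cvg_psie ct; exact: lt_trans dn1.
have H w : normc w < d ->
    herg (J t) (psie tau t w) - 'i * (beta t)%:C @[t --> (0 : R)^'+] --> - kap w.
  move=> wd; have x01 := x0lt w wd; set x0 := w / (1 + w) in x01 *.
  have cB : cexp (t%:C * kap w) @[t --> (0 : R)^'+] --> (1 : C).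
    rewrite -cexp0 -(mul0r (kap w)); apply: cvg_cexp.
    exact: (cvgM (cvg_realc _ ct) (cvg_cst _)).
  have n1 : 1 - x0 != 0 by exact: oner_sub_neq0.
  have ce : psie tau t w * cexp (t%:C * kap w) @[t --> (0 : R)^'+] --> x0.
    by rewrite -[x0]mulr1; exact: (cvgM (cy w wd) cB).
  (* The middle factor is 1 + m = 1/(1 - eta), because eta at x = [psie tau t w] is x B(x) = x exp(t
     kap(w)). *)
  have cf : (1 - psie tau t w) * (1 / (1 - psie tau t w * cexp (t%:C * kap w))) *
      ((1 - cexp (t%:C * kap w)) / t%:C) @[t --> (0 : R)^'+] --> (1 - x0) * (1 / (1 - x0)) * (- kap w).
    have h1 : (1 - psie tau t w) @[t --> (0 : R)^'+] --> 1 - x0 by exact: (cvgB (cvg_cst _) (cy w wd)).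
    have h2 : 1 / (1 - psie tau t w * cexp (t%:C * kap w)) @[t --> (0 : R)^'+] --> 1 / (1 - x0).
      by apply: cvg_divC; [exact: n1|exact: cvg_cst|exact: (cvgB (cvg_cst _) ce)].
    have h3 : (1 - cexp (t%:C * kap w)) / t%:C @[t --> (0 : R)^'+] --> - kap w.
      by apply: (@cvg_exp_scaled R R _ _ id (kap w)); [exact: ct|exact: tn0].
    exact: (cvgM (cvgM h1 h2) h3).
  have -> : - kap w = (1 - x0) * (1 / (1 - x0)) * (- kap w) by rewrite mulrA mulr1 mulfV ?mul1r.
  apply: cvg_trans cf; apply: near_eq_cvg; apply: filterS near01 => t t01.
  have /andP[t0 t1] := t01; have t01' : 0 <= t <= 1 by rewrite ltW.
  have y1 : normc (psie tau t w) < 1 by apply: le_lt_trans (btd _ _ t01' wd) _.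
  have [_ BE] := exp_pair_disk gd t01' (qP t (ltW t0)) wd.
  rewrite (herg_rescaled _ t0 y1) BE; congr (_ * _ * _).
  have := moment_of_eta (q t).1 y1; rewrite -B_funE BE => ->.
  have h := eta_neq1 (q t).1 y1; rewrite -B_funE BE in h.
  by field.
have n0 : normc (0 : C) < d by rewrite normc0.
(* At w = 0 the moving point is 0 and the transform is real: the imaginary part of this limit gives
   beta, the real part the masses. *)
have H0 := H 0 n0.
have kap0 : - kap 0 = I (fun=> 1) +i* (- b).
  by rewrite /kap /levy mul0r (herg0 Ipos); apply/eqcP; rewrite /=; ring.
have E0 t : herg (J t) (psie tau t 0) - 'i * (beta t)%:C = J t (fun=> 1) +i* (- beta t).
  by rewrite psie0 (herg0 (Jpos t)); apply/eqcP; rewrite /=; ring.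
have cbeta : beta t @[t --> (0 : R)^'+] --> b.
  have h : - complex.Im (herg (J t) (psie tau t 0) - 'i * (beta t)%:C) @[t --> (0 : R)^'+] -->
      - complex.Im (- kap 0) by apply: cvgN; apply: cvg_Im; exact: H0.
  have e1 : (fun t => - complex.Im (herg (J t) (psie tau t 0) - 'i * (beta t)%:C)) = beta.
    by apply/funext => t; rewrite E0 /= opprK.
  have e2 : - complex.Im (- kap 0) = b by rewrite kap0 /= opprK.
  by rewrite e1 e2 in h.
have cJ w : normc w < d -> herg (J t) (psie tau t w) @[t --> (0 : R)^'+] --> herg I (w / (1 + w)).
  move=> wd; have h : herg (J t) (psie tau t w) - 'i * (beta t)%:C + 'i * (beta t)%:C @[t --> (0 : R)^'+] -->
      - kap w + 'i * b%:C.
    exact: (cvgD (H w wd) (cvgM (cvg_cst _) (cvg_realc _ cbeta))).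
  have -> : herg I (w / (1 + w)) = - kap w + 'i * b%:C by rewrite /kap /levy; ring.
  by apply: cvg_trans h; apply: near_eq_cvg; apply: (@filterE _ (0 : R)^'+) => t; rewrite subrK.
have mass : \forall t \near (0 : R)^'+, J t (fun=> 1) <= complex.Re (herg I 0) + 1.
  apply: near_mass_le; first exact: Jpos.
  have h := cJ 0 n0; rewrite mul0r in h; apply: cvg_trans h.
  by apply: near_eq_cvg; apply: (@filterE _ (0 : R)^'+) => t; rewrite psie0.
split; first exact: cbeta.
have /near0CP[r r0 rP] : \forall z \near (0 : C), normc (z / (1 - z)) < d /\ normc z < 1.
  by apply: filterS2 (near0_moebius_inv (near0_ball d0)) (near0_ball (@ltr01 R)).
apply: (@functional_cvg R R _ FF J I r r0); [exact: Jpos|exact: Ipos|].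
move=> z /rP[wd z1].
have zE : z = z / (1 - z) / (1 + z / (1 - z)).
  have h := oner_sub_neq0 z1.
  by field; rewrite h subrK oner_neq0.
have cz := cJ _ wd; have cyz := cy _ wd; rewrite -zE in cz cyz.
by apply: (cvg_herg_moving _ Jpos mass z1 cyz cz).
Qed.

End infinitesimal_generator.

Section generator.
Variable R : realType.
Local Notation C := R[i].
Local Notation M := (prob_circle R).

(** Only t in ]0, 1] matters for the limits, and there the first component of p may be replaced by
    that of q. *)
Lemma semigroup_limits (mu nu : M) (g : circle R)
    (sigma : {finite_measure set (borel_circle R) -> \bar R}) (p : R -> M * M) :
  nonzero_mean mu -> nonzero_mean nu -> free_infdiv nu ->
  Sigma_representation mu nu g sigma -> cfree_semigroup_through p mu nu ->
  (cexp ((t : R)^-1%:C * cintegral (p t).1 (fun x => 0 +i* complex.Im (x : R[i])))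
     @[t --> 0^'+] --> (g : C)) /\
  (forall f : circle R -> R, continuous f ->
     \int[(p t).1]_x (f x * (t^-1 * (1 - complex.Re (x : circle R))))
       @[t --> 0^'+] --> \int[sigma]_x f x).
Proof.
move=> mu0 nu0 nuinf rep thr.
have [b [b' [I' [q [gE Ipos' qP pq]]]]] := semigroup_exp_pairs mu0 nu0 nuinf rep thr.
have [cb cJ] := generator_limit (integral_functional_pos sigma) Ipos' qP.
have near01 : \forall t \near (0 : R)^'+, 0 < t <= 1.
  by apply: filterS2 (nbhs_right_gt 0) (nbhs_right_le ltr01) => t -> ->.
have cid := @circle_val_continuous R.
split.
  have h : cexp (0 +i* (t^-1 * lawf (q t).1 (fun y : circle R => complex.Im (y : C))))
      @[t --> 0^'+] --> cexp (0 +i* b).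
    by apply: cvg_cexp; apply: cvg_ReIm; [exact: cvg_cst|exact: cb].
  rewrite gE -[cis b]/(cexp (0 +i* b)); apply: cvg_trans h; apply: near_eq_cvg.
  apply: filterS near01 => t t01; congr cexp.
  have c0 := functional_cst (lawf_pos (p t).1) 0.
  have e : lawf (q t).1 (fun y : circle R => complex.Im (y : C)) =
      lawf (p t).1 (fun y : circle R => complex.Im (y : C)).
    by have := pq t t01 _ (continuous_Imc cid).
  rewrite e -[cintegral _ _]/(lawf (p t).1 (fun=> 0) +i* lawf (p t).1 (fun y : circle R => complex.Im (y : C))).
  by rewrite c0; apply/eqcP; rewrite /=; ring.
move=> f cf; have h := cJ f cf; apply: cvg_trans h; apply: near_eq_cvg.
apply: filterS near01 => t t01; rewrite /rescaled gtr0_norm; last by case/andP: t01.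
by have := pq t t01 _ (continuous_mulR cf (@continuous_rescale R t));
  rewrite gtr0_norm; last by case/andP: t01.
Qed.

End generator.

Theorem theorem6p4 (R : realType) (mu nu : prob_circle R)
    (hmu : nonzero_mean mu) (hnu : nonzero_mean nu)
    (nu_infdiv : free_infdiv nu) :
  [/\ cfree_infdiv (mu, nu) <->
        (exists (g : circle R)
                (sigma : {finite_measure set (borel_circle R) -> \bar R}),
           Sigma_representation mu nu g sigma),
      (exists (g : circle R)
              (sigma : {finite_measure set (borel_circle R) -> \bar R}),
         Sigma_representation mu nu g sigma) <->
        (exists p : R -> prob_circle R * prob_circle R,
           cfree_semigroup_through p mu nu)
    & forall (g : circle R)
             (sigma : {finite_measure set (borel_circle R) -> \bar R})
             (p : R -> prob_circle R * prob_circle R),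
        Sigma_representation mu nu g sigma ->
        cfree_semigroup_through p mu nu ->
        (cexp ((t : R)^-1%:C *
               cintegral (p t).1 (fun x => 0 +i* complex.Im (x : R[i])))
           @[t --> 0^'+] --> (g : R[i])) /\
        (forall f : circle R -> R, continuous f ->
           \int[(p t).1]_x (f x * (t^-1 * (1 - complex.Re (x : circle R))))
             @[t --> 0^'+] --> \int[sigma]_x f x)].
Proof.
split.
- split; first exact: infdiv_representation.
  by move=> [g [sigma]]; exact: representation_infdiv.
- split=> [[g [sigma]]|[p /semigroup_infdiv]]; first exact: representation_semigroup.
  exact: infdiv_representation.
- by move=> g sigma p; exact: semigroup_limits.
Qed.
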